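(* Let $(F_n)_{n\ge0}$ and $(C_n)_{n\ge1}$ be sequences of subsets of $H_3(\mathbb R)$ satisfying: (I) $(F_n)_{n\ge 0}$ is a Følner sequence in $H_3(\mathbb R)$; (II) each $C_n$ is finite and $\#C_n>1$; (III) $F_nC_{n+1}\subset F_{n+1}$; (IV) $F_nc\cap F_nc'=\emptyset$ for all $c\ne c'\in C_{n+1}$; and suppose that $\prod_{n=0}^\infty\frac{\lambda(F_{n+1})}{\lambda(F_n)\,\#C_{n+1}}=\infty$, and that for all $n$: (i) $F_nF_n^{-1}F_nC_{n+1}\subset F_{n+1}$, (ii) the sets $F_nc_1c_2^{-1}F_n^{-1}$, $c_1\neq c_2\in C_{n+1}$, and $F_nF_n^{-1}$ are all pairwise disjoint, and (iii) $\#C_n\to\infty$ as $n\to\infty$. Let $T$ be the $(C,F)$-action of $H_3(\mathbb R)$ associated with $(C_{n+1},F_n)_{n\ge0}$, acting on the infinite measure space $(X,\mathfrak B,\mu)$. Then the Poisson suspension $\widetilde T$ of $T$ is mixing of all orders. The corresponding Gaussian action $T^*$ of $H_3(\mathbb R)$ is also mixing of all orders.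
   Context: $H_3(\mathbb R)$ is the locally compact group of $3\times3$ upper triangular real matrices with ones on the diagonal; it is unimodular and $\lambda$ is a Haar measure on it. For subsets $E,F$ of the group, $EF=\{ef\mid e\in E,f\in F\}$ and $E^{-1}=\{e^{-1}\mid e\in E\}$. A Følner sequence is a sequence of relatively compact Borel subsets $F_n$ of positive Haar measure with $\lambda(gF_n\triangle F_n)/\lambda(F_n)\to0$ for every $g$. $(C,F)$-action: put $X_n=F_n\times\prod_{k>n}C_k$ with the product Borel structure, and embed $X_n$ into $X_{n+1}$ by $(f_n,c_{n+1},c_{n+2},\dots)\mapsto(f_nc_{n+1},c_{n+2},\dots)$. Let $X=\bigcup_nX_n$ be the resulting increasing union (a standard Borel space). Let $\kappa_k$ be the uniform probability on $C_k$, let $\nu_n=(\#C_1\cdots\#C_n)^{-1}\lambda\restriction F_n$, and let $\mu$ be the $\sigma$-finite measure on $X$ whose restriction to $X_n$ is $\nu_n\times\kappa_{n+1}\times\kappa_{n+2}\times\cdots$ for each $n$. The action $T=(T_g)$ is the $\mu$-preserving action defined, for each $g$ and $\mu$-a.e. $x\in X$, by $T_g(f_n,c_{n+1},c_{n+2},\dots)=(gf_n,c_{n+1},c_{n+2},\dots)$, where $x=(f_n,c_{n+1},\dots)\in X_n$ and $n$ is large enough that $gf_n\in F_n$. Poisson suspension: $(\widetilde X,\widetilde\mu)$ is the space of ($\mathbb Z_{\ge0}\cup\{\infty\}$-valued) counting measures $\omega$ on $X$, with the $\sigma$-algebra generated by the maps $\omega\mapsto\omega(A)$, $A\in\mathfrak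 B$, and the probability $\widetilde\mu$ under which $\omega(A)$ is Poisson with parameter $\mu(A)$ when $\mu(A)<\infty$ and $\omega(A_1),\dots,\omega(A_k)$ are independent for disjoint $A_1,\dots,A_k$. $\widetilde T=(\widetilde T_g)$ is given by $\widetilde T_g\omega=\omega\circ T_g^{-1}$. Gaussian action: $T^*$ is the probability preserving Gaussian action associated with the Koopman representation $U_T(g)f=f\circ T_g^{-1}$ in $L^2(X,\mu)$, i.e. an action $T^*=(T^*_g)$ on a standard probability space $(Y,\nu)$ with an isometric linear equivariant map from the real space $L^2_{\mathbb R}(X,\mu)$ into $L^2_{\mathbb R}(Y,\nu)$ whose image consists of centered (jointly) Gaussian random variables and generates the $\sigma$-algebra of $Y$. A probability preserving action $S$ of a locally compact group $G$ on $(Y,\nu)$ is mixing of order $l$ if for each $\epsilon>0$ and all measurable $A_0,\dots,A_l$ there is a compact $K\subset G$ such that $|\nu(S_{g_0}A_0\cap\dots\cap S_{g_l}A_l)-\nu(A_0)\cdots\nu(A_l)|<\epsilon$ for all $g_0,\dots,g_l\in G$ with $g_i^{-1}g_j\notin K$ whenever $i\ne j$; it is mixing of all orders if this holds for every $l\ge1$. *)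

(* Defs.v *)
From HB Require Import structures.
From mathcomp Require Import all_boot all_order all_algebra.
From mathcomp Require Import finmap.
From mathcomp Require Import all_classical all_reals all_analysis.
From mathcomp Require Import measurable_realfun.
From mathcomp Require Import ring.

Set Implicit Arguments.
Unset Strict Implicit.
Unset Printing Implicit Defensive.

Import Order.TTheory GRing.Theory Num.Theory.
Import numFieldNormedType.Exports.

Local Open Scope classical_set_scope.
Local Open Scope ring_scope.

Definition unitriangular (R : realType) (A : 'M[R]_3) : bool :=
  [forall i, A i i == 1] &&
  [forall i : 'I_3, forall j : 'I_3, (j < i)%N ==> (A i j == 0)].

Record H3 (R : realType) := MkH3 {
  H3mx :> 'M[R]_3 ;
  H3mxP : unitriangular H3mx }.

Section H3_group.
Variable R : realType.
Implicit Types A B : 'M[R]_3.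

HB.instance Definition _ := [isSub for @H3mx R].
HB.instance Definition _ := [Choice of H3 R by <:].

Lemma unitriangularP A : unitriangular A <->
  (forall i, A i i = 1) /\ (forall i j : 'I_3, (j < i)%N -> A i j = 0).
Proof.
split=> [/andP[/forallP a1 /forallP a0]|[a1 a0]].
  split=> [i|i j ji]; first exact/eqP.
  by have /forallP/(_ j) := a0 i; rewrite ji => /eqP.
apply/andP; split; apply/forallP => i; first exact/eqP.
by apply/forallP => j; apply/implyP => ji; apply/eqP/a0.
Qed.

Let ut_mx A B : unitriangular A -> unitriangular B -> unitriangular (A *m B).
Proof.
move=> /unitriangularP[A1 A0] /unitriangularP[B1 B0].
apply/unitriangularP; split=> [i|i j ji]; rewrite mxE.
  rewrite (bigD1 i)//= big1 => [|k ki]; first by rewrite A1 B1 mulr1 addr0.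
  case: (ltngtP k i) => [lt|lt|/val_inj kE].
  - by rewrite A0// mul0r.
  - by rewrite B0// mulr0.
  - by rewrite kE eqxx in ki.
rewrite big1// => k _; case: (ltnP k i) => [ki|ik]; first by rewrite A0// mul0r.
by rewrite B0 ?mulr0// (leq_trans ji).
Qed.

Let ut_1 : unitriangular (1%:M : 'M[R]_3).
Proof.
apply/unitriangularP; split=> [i|i j ji]; first by rewrite mxE eqxx.
by rewrite mxE gt_eqF.
Qed.

(* [(A - 1)^3 = 0], hence [A^-1 = A^2 - 3 A + 3]. *)
Let inv_mx A := A *m A - 3 *: A + 3%:M.

Let ut_inv A : unitriangular A -> unitriangular (inv_mx A).
Proof.
move=> uA; have /unitriangularP[S1 S0] := ut_mx uA uA.
move/unitriangularP : uA => [A1 A0].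
apply/unitriangularP; split=> [i|i j ji].
  rewrite /inv_mx mxE (mxE _ _ i i) S1 !mxE A1 eqxx mulr1n; ring.
rewrite /inv_mx mxE (mxE _ _ i j) S0// !mxE A0// gt_eqF//= mulr0n; ring.
Qed.

Definition H3mul (x y : H3 R) : H3 R := MkH3 (ut_mx (H3mxP x) (H3mxP y)).
Definition H3one : H3 R := MkH3 ut_1.
Definition H3inv (x : H3 R) : H3 R := MkH3 (ut_inv (H3mxP x)).

Let H3mulA : associative H3mul.
Proof. by move=> x y z; apply: val_inj; rewrite /= mulmxA. Qed.

Let H3mul1g : left_id H3one H3mul.
Proof. by move=> x; apply: val_inj; rewrite /= mul1mx. Qed.

Let H3mulg1 : right_id H3one H3mul.
Proof. by move=> x; apply: val_inj; rewrite /= mulmx1. Qed.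

Let nilp A : unitriangular A -> A *m inv_mx A = 1%:M.
Proof.
move=> /unitriangularP[A1 A0].
pose o0 : 'I_3 := inord 0; pose o1 : 'I_3 := inord 1; pose o2 : 'I_3 := inord 2.
have big3 (F : 'I_3 -> R) : \sum_i F i = F o0 + F o1 + F o2.
  rewrite !big_ord_recr big_ord0 /= add0r.
  by congr (F _ + F _ + F _); apply: val_inj; rewrite /= inordK.
have E (i : 'I_3) : [\/ i = o0, i = o1 | i = o2].
  case: i => -[|[|[|//]]] ?; [constructor 1|constructor 2|constructor 3];
  by apply: val_inj; rewrite /= inordK.
have [n10 n20 n21] : [/\ A o1 o0 = 0, A o2 o0 = 0 & A o2 o1 = 0].
  by split; apply: A0; rewrite /= !inordK.
have [e01 e02 e12] : [/\ (o0 == o1) = false, (o0 == o2) = false &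
    (o1 == o2) = false] by split; rewrite -val_eqE /= !inordK.
apply/matrixP => i j; rewrite mxE big3 /inv_mx !mxE !big3.
by case: (E i) => ->; case: (E j) => ->;
  rewrite ?eqxx ?(eq_sym o1 o0) ?(eq_sym o2) ?e01 ?e02 ?e12 !A1 ?n10 ?n20 ?n21
    ?mulr0n ?mulr1n; ring.
Qed.

Let H3mulgV : right_inverse H3one H3inv H3mul.
Proof. by move=> x; apply: val_inj; rewrite /= nilp// H3mxP. Qed.

Let H3mulVg : left_inverse H3one H3inv H3mul.
Proof.
by move=> x; apply: val_inj; rewrite /= (mulmx1C (nilp (H3mxP x))).
Qed.

HB.instance Definition _ :=
  isGroup.Build (H3 R) H3mulA H3mul1g H3mulg1 H3mulVg H3mulgV.

HB.instance Definition _ := isPointed.Build (H3 R) H3one.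

HB.instance Definition _ :=
  Topological.copy (H3 R) (initial_topology (@H3mx R)).

HB.instance Definition _ := Measurable.copy (H3 R)
  (g_sigma_algebraType (@open (H3 R))).

End H3_group.

Section group_sets.
Variable R : realType.
Implicit Types E : set (H3 R).

Definition mulset E1 E2 : set (H3 R) :=
  [set (x * y)%g | x in E1 & y in E2].

Definition invset E : set (H3 R) := [set (x^-1)%g | x in E].

End group_sets.

Notation "E *s F" := (mulset E F) (at level 40, left associativity)
  : classical_set_scope.

(* Meaningful for finite sets only. *)
Definition ncard (T : choiceType) (E : set T) : nat := #|` fset_set E|%fset.

Section haar_folner.
Variable R : realType.

(* On a second countable locally compact group, Borel measures that are finite
   on compact sets are automatically regular. *)
Definition haar_measure (lambda : {measure set (H3 R) -> \bar R}) : Prop :=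
  [/\ forall K, compact K -> (lambda K < +oo)%E,
      (0 < lambda setT)%E &
      forall g E, measurable E -> lambda ([set g] *s E) = lambda E].

Definition folner (lambda : {measure set (H3 R) -> \bar R})
    (F : nat -> set (H3 R)) : Prop :=
  [/\ forall n, measurable (F n),
      forall n, compact (closure (F n)),
      forall n, (0 < lambda (F n))%E &
      forall g, fine (lambda (([set g] *s F n) `+` F n)) / fine (lambda (F n))
        @[n --> \oo] --> (0 : R)].

End haar_folner.

(* [C 0] plays no role. *)
Record CF_sequences (R : realType) (lambda : {measure set (H3 R) -> \bar R})
    (F C : nat -> set (H3 R)) : Prop := MkCFSequences {
  CF_folner : folner lambda F ;
  CF_finite : forall n, finite_set (C n.+1) /\ (1 < ncard (C n.+1))%N ;
  CF_sub : forall n, F n *s C n.+1 `<=` F n.+1 ;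
  CF_disj : forall n c c', C n.+1 c -> C n.+1 c' -> c <> c' ->
    (F n *s [set c]) `&` (F n *s [set c']) = set0 }.

Section CF_space.
Variables (R : realType) (lambda : {measure set (H3 R) -> \bar R}).
Variables F C : nat -> set (H3 R).

(* The sequence [(f_n, c_{n+1}, c_{n+2}, ...)] is encoded as a pair [(f, c)]
   with [c i] standing for [c_{n+1+i}]. *)
Definition CFcoord : Type := (H3 R * (nat -> H3 R))%type.

Definition CFlevel (n : nat) : set CFcoord :=
  [set p | F n p.1 /\ forall i, C (n + i).+1 (p.2 i)].

Definition CFembed (p : CFcoord) : CFcoord :=
  ((p.1 * p.2 0)%g, fun i => p.2 i.+1).

(* Two sequences, at levels [n] and [m], define the same point of the increasing
   union iff their images at some common level coincide. *)
Definition CFeq (n : nat) (p : CFcoord) (m : nat) (q : CFcoord) : Prop :=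
  exists i j, (n + i = m + j)%N /\ iter i CFembed p = iter j CFembed q.

Definition CFclass (n : nat) (p : CFcoord) : set (nat * CFcoord) :=
  [set mq | CFlevel mq.1 mq.2 /\ CFeq n p mq.1 mq.2].

(* The inductive limit of the [X_n]'s; the hypothesis on the sequences makes it
   nonempty, as required for a [measurableType]. *)
Definition CFspace (h : CF_sequences lambda F C) : Type :=
  {x : set (nat * CFcoord) | exists n p, CFlevel n p /\ x = CFclass n p}.

Section instances.
Variable h : CF_sequences lambda F C.

HB.instance Definition _ := gen_eqMixin (CFspace h).
HB.instance Definition _ := gen_choiceMixin (CFspace h).

Lemma CFspace_inhabited : exists x : CFspace h, True.
Proof.
have [_ _ lF _] := CF_folner h.
have [f Ff] : F 0 !=set0.
  by apply/set0P/eqP => F0; have := lF 0%N; rewrite F0 measure0 ltxx.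
have Cn n : C n.+1 !=set0.
  apply/set0P/eqP => C0; have [_] := CF_finite h n.
  by rewrite C0 /ncard fset_set0.
pose p : CFcoord := (f, fun i => xget 1%g (C i.+1)).
have lp : CFlevel 0 p by split=> // i; have [c Cc] := Cn i; exact: xgetI Cc.
by exists (exist _ (CFclass 0 p) (ex_intro _ 0%N (ex_intro _ p (conj lp erefl)))).
Qed.

HB.instance Definition _ :=
  isPointed.Build (CFspace h) (projT1 (cid CFspace_inhabited)).

(* [CFat n p x]: the point [x] belongs to [X_n], with coordinates [p]. *)
Definition CFat (n : nat) (p : CFcoord) (x : CFspace h) : Prop :=
  sval x (n, p).

(* The measurable rectangle [A x B_0 x ... x B_(k-1) x C_(n+k+1) x ...]
   of [X_n]. *)
Definition CFrect (n : nat) (A : set (H3 R)) (k : nat) (B : nat -> set (H3 R))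
    : set (CFspace h) :=
  [set x | exists p, [/\ CFat n p x, A p.1 &
                         forall i, (i < k)%N -> B i (p.2 i)]].

Definition CFrects : set (set (CFspace h)) :=
  [set S | exists n A k B, [/\ measurable A, forall i, measurable (B i) &
                               S = CFrect n A k B]].

(* The trace on [X_n] of the sigma-algebra generated by the measurable
   rectangles of all the [X_m]'s is the product Borel structure. *)
HB.instance Definition _ := Measurable.copy (CFspace h)
  (g_sigma_algebraType CFrects).

(* The restriction of [mu] to [X_n] is
   [nu_n x kappa_(n+1) x kappa_(n+2) x ...]: both sides agree on the measurable
   rectangles, which determines a finite measure. *)
Definition CF_measure (mu : {measure set (CFspace h) -> \bar R}) : Prop :=
  forall n A k B, measurable A -> (forall i, measurable (B i)) ->
  mu (CFrect n A k B) =
    (((\prod_(1 <= i < n.+1) (ncard (C i))%:R)^-1)%:E * lambda (A `&` F n) *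
     (\prod_(i < k) ((ncard (B i `&` C (n + i).+1))%:R /
                     (ncard (C (n + i).+1))%:R))%:E)%E.

End instances.
End CF_space.

Section actions.
Variable R : realType.

(* The individual maps are only meaningful up to null sets. *)
Definition mp_action d (Y : measurableType d)
    (m : {measure set Y -> \bar R}) (S : H3 R -> Y -> Y) : Prop :=
  [/\ forall g, measurable_fun setT (S g),
      forall g A, measurable A -> m (S g @^-1` A) = m A,
      {ae m, forall y, S 1%g y = y} &
      forall g h, {ae m, forall y, S (g * h)%g y = S g (S h y)}].

(* The set [S_g A] is taken to be the preimage of [A] under [S_(g^-1)], with
   which it coincides up to a null set. *)
Definition mixing_of_order d (Y : measurableType d)
    (nu : probability Y R) (S : H3 R -> Y -> Y) (l : nat) : Prop :=
  forall eps : R, 0 < eps ->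
  forall A : 'I_l.+1 -> set Y, (forall i, measurable (A i)) ->
  exists K : set (H3 R), compact K /\
    forall g : 'I_l.+1 -> H3 R,
      (forall i j, i != j -> ~ K ((g i)^-1 * g j)%g) ->
      `| fine (nu (\bigcap_(i in [set: 'I_l.+1]) (S (g i)^-1%g @^-1` A i))) -
         \prod_(i < l.+1) fine (nu (A i)) | < eps.

Definition mixing_of_all_orders d (Y : measurableType d)
    (nu : probability Y R) (S : H3 R -> Y -> Y) : Prop :=
  mp_action nu S /\ forall l, (1 <= l)%N -> mixing_of_order nu S l.

(* For almost every [x], the formula
   [T_g (f_n, c_(n+1), ...) = (g f_n, c_(n+1), ...)] holds at some level [n]
   with [g f_n] in [F_n]; it then holds at every such level. *)
Definition CF_action (lambda : {measure set (H3 R) -> \bar R})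
    (F C : nat -> set (H3 R)) (h : CF_sequences lambda F C)
    (mu : {measure set (CFspace h) -> \bar R})
    (T : H3 R -> {mfun CFspace h >-> CFspace h}) : Prop :=
  mp_action mu T /\
  forall g, {ae mu, forall x, exists n f c,
    [/\ CFat n (f, c) x, F n (g * f)%g & CFat n ((g * f)%g, c) (T g x)]}.

End actions.

Section poisson.
Context d (X : measurableType d) (R : realType).

(* A measure of the library is a function on all the subsets of [X]; making it
   vanish on the non-measurable ones, two counting measures are equal iff they
   agree on the sigma-algebra. *)
Record cmeasure := MkCMeasure {
  cmeas :> {measure set X -> \bar R} ;
  cmeas_counting : forall A, measurable A ->
    cmeas A = +oo%E \/ exists k : nat, cmeas A = k%:R%:E ;
  cmeas_nmeas : forall A, ~ measurable A -> cmeas A = 0%E }.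

HB.instance Definition _ := gen_eqMixin cmeasure.
HB.instance Definition _ := gen_choiceMixin cmeasure.
HB.instance Definition _ := isPointed.Build cmeasure
  (@MkCMeasure mzero (fun _ _ => or_intror (ex_intro _ 0%N erefl))
     (fun _ _ => erefl)).

Definition cmeas_evs : set (set cmeasure) :=
  [set E | exists A B, [/\ measurable A, measurable B &
                           E = [set w : cmeasure | B (w A)]]].

HB.instance Definition _ := Measurable.copy cmeasure
  (g_sigma_algebraType cmeas_evs).

(* The first clause is the Poisson law of parameter [m = mu A], which for
   [m = 0] is the Dirac mass at [0]. *)
Definition poisson_law (mu : {measure set X -> \bar R})
    (P : probability cmeasure R) : Prop :=
  (forall A, measurable A -> (mu A < +oo)%E -> forall k : nat,
     P [set w : cmeasure | w A = k%:R%:E] =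
     (let m := fine (mu A) in m ^+ k / k`!%:R * expR (- m))%:E) /\
  (forall k (A : 'I_k -> set X) (B : 'I_k -> set (\bar R)),
     (forall i, measurable (A i)) -> (forall i, measurable (B i)) ->
     trivIset setT A ->
     P (\bigcap_(i in [set: 'I_k]) [set w : cmeasure | B i (w (A i))]) =
     (\prod_(i < k) P [set w : cmeasure | B i (w (A i))])%E).

Section image.
Variables (f : {mfun X >-> X}) (w : cmeasure).

Definition cimage (A : set X) : \bar R :=
  if `[< measurable A >] then w (f @^-1` A) else 0%E.

Let mpre A : measurable A -> measurable (f @^-1` A).
Proof. by move=> mA; rewrite -[X in measurable X]setTI; exact: measurable_funP. Qed.

Let cimageE A : measurable A -> cimage A = w (f @^-1` A).
Proof. by move=> mA; rewrite /cimage asboolT. Qed.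

Let cimage0 : cimage set0 = 0%E.
Proof. by rewrite cimageE// preimage_set0 measure0. Qed.

Let cimage_ge0 A : (0 <= cimage A)%E.
Proof. by rewrite /cimage; case: asboolP => // mA; exact/measure_ge0/mpre. Qed.

Let cimage_sigma_additive : semi_sigma_additive cimage.
Proof.
move=> E mE tE mUE; rewrite cimageE// preimage_bigcup.
under eq_fun do under eq_bigr do rewrite cimageE//.
apply: measure_semi_sigma_additive.
- by move=> n; exact: mpre.
- apply/trivIsetP => i j _ _ ij; rewrite -preimage_setI.
  by move/trivIsetP : tE => /(_ _ _ _ _ ij) ->//; rewrite preimage_set0.
- by rewrite -preimage_bigcup; exact: mpre.
Qed.

HB.instance Definition _ := isMeasure.Build _ _ _ cimage
  cimage0 cimage_ge0 cimage_sigma_additive.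

Let cimage_counting A : measurable A ->
  cimage A = +oo%E \/ exists k : nat, cimage A = k%:R%:E.
Proof. by move=> mA; rewrite cimageE//; apply/cmeas_counting/mpre. Qed.

Let cimage_nmeas A : ~ measurable A -> cimage A = 0%E.
Proof. by move=> nA; rewrite /cimage asboolF. Qed.

Definition cmeas_image : cmeasure :=
  @MkCMeasure cimage cimage_counting cimage_nmeas.

End image.

Definition poisson_suspension (T : H3 R -> {mfun X >-> X})
  (g : H3 R) (w : cmeasure) : cmeasure := cmeas_image (T g) w.

End poisson.

Section gaussian.
Variable R : realType.

Definition standard_borel d (Y : measurableType d) : Prop :=
  exists Z : completePseudoMetricType R,
    [/\ hausdorff_space Z, @second_countable Z &
        exists phi : Y -> Z, bijective phi /\
          forall A : set Y, measurable A <-> <<s @open Z >> (phi @` A)].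

(* The library's [normal_prob 0 s] has standard deviation [s], and is not the
   Dirac mass for [s = 0]. *)
Definition centered_gaussian d (Y : measurableType d) (nu : probability Y R)
    (f : Y -> R) : Prop :=
  exists s : R, forall B : set R, measurable B ->
    nu (f @^-1` B) = if s == 0 then \d_(0 : R) B else normal_prob 0 s B.

Definition koopman d (X : measurableType d) (T : H3 R -> X -> X)
  (g : H3 R) (f : X -> R) : X -> R := f \o T (g^-1)%g.

(* Elements of [L^2] are represented by square integrable functions, and
   equalities in [L^2] are almost everywhere equalities; [Phi] respects them,
   being linear and isometric. The generated sigma-algebra is likewise taken
   modulo null sets. Joint Gaussianity is that of all the finite linear
   combinations. *)
Definition gaussian_map d (X : measurableType d) d' (Y : measurableType d')
    (mu : {measure set X -> \bar R}) (T : H3 R -> X -> X)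
    (nu : probability Y R) (S : H3 R -> Y -> Y)
    (Phi : (X -> R) -> (Y -> R)) : Prop :=
  let L2X := [set f : X -> R | f \in Lfun mu 2%:E] in
  [/\ [/\ forall f, L2X f -> Phi f \in Lfun nu 2%:E,
          forall (a : R) f g, L2X f -> L2X g ->
            {ae nu, forall y, Phi (fun x => a * f x + g x) y =
                              a * Phi f y + Phi g y} &
          forall f, L2X f ->
            ('N[nu]_2%:E [EFin \o Phi f] = 'N[mu]_2%:E [EFin \o f])%E],
      forall g f, L2X f ->
        {ae nu, forall y, Phi (koopman T g f) y = koopman S g (Phi f) y},
      forall k (f : 'I_k -> X -> R) (a : 'I_k -> R), (forall i, L2X (f i)) ->
        centered_gaussian nu (fun y => \sum_(i < k) a i * Phi (f i) y) &
      forall A, measurable A ->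
        exists2 B, <<s [set Phi f @^-1` D | f in L2X & D in measurable] >> B &
          nu.-negligible (A `+` B)].

Definition gaussian_action d (X : measurableType d) d' (Y : measurableType d')
    (mu : {measure set X -> \bar R}) (T : H3 R -> X -> X)
    (nu : probability Y R) (S : H3 R -> Y -> Y) : Prop :=
  [/\ standard_borel Y, mp_action nu S &
      exists Phi, gaussian_map mu T nu S Phi].

End gaussian.

(* Main.v *)
(* Let [X_n] be the image in [X] of the [n]-th level. If [T_g] sends a point of
   [X_n] back to [X_n], then, comparing coordinates at a high common level, either
   [g] lies in [F_n F_n^-1] or [g] lies in [F_(k-1) c' c^-1 F_(k-1)^-1] for a last
   index [k] at which the coordinates [c] of [x] and [c'] of [T_g x] differ. By (ii),
   [g] determines [k], [c] and [c'], so the return set lies in a slice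
   [{c_k = c}] of [X_n], of measure [mu(X_n) / #C_k]; and [k] is large when [g] is
   outside a large compact set. Hence [mu(X_n & T_g^-1 X_n)] tends to 0.

   Both the Poisson and the Gaussian space carry, for each measurable [E], a
   sigma-algebra of the events that depend on what happens in [E]; those of disjoint
   sets are independent. When the elements [g_i] are far apart, the translates of
   [X_n] are almost disjoint; deleting the small overlaps makes them disjoint and
   moves the translated events very little, whence mixing of all orders.

   Independence is a direct computation on atoms in the Poisson case. In the
   Gaussian case it comes from the multiplicativity of [s |-> E cos(s Z)] and from
   the fact that bounded limits of trigonometric polynomials in the [Phi f] include
   the indicators of all events generated by them. *)
Require Import Defs.
From HB Require Import structures.
From mathcomp Require Import all_boot all_order all_algebra.
From mathcomp Require Import finmap.
From mathcomp Require Import all_classical all_reals all_analysis.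
From mathcomp Require Import measurable_realfun.
From mathcomp Require Import zify ring lra.

Set Implicit Arguments.
Unset Strict Implicit.
Unset Printing Implicit Defensive.
Import Order.TTheory GRing.Theory Num.Theory.
Import numFieldNormedType.Exports.
Local Open Scope classical_set_scope.
Local Open Scope ring_scope.

(** * The topology of the Heisenberg group *)

Section H3_topology.
Variable R : realType.

(** The overlaps to be deleted depend on all the [g_i] at once, so an event must have approximations
    uniform in [g] and in the deleted set [N], of which only the measure is controlled. This is the
    property [robust]. The events having it form a sigma-algebra, so it is checked on generators
    only: finite counts in the Poisson case, level sets of the [Phi f] in the Gaussian case. The
    mixing criterion is stated for an abstract family [gen] and serves both.

    In the Gaussian case [Phi f] may vanish almost surely, and its law then has an atom at 0; hence
    the levels [c != 0] are treated first. The characteristic function of the normal law is never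
    computed: variances of disjointly supported parts add, so its multiplicativity is all that
    independence needs, and this follows from the rotation invariance of the Gaussian measure in the
    plane. Cosines appear as [1 + cos] to keep the integrands nonnegative and Tonelli's theorem
    applicable. *)

Lemma mx_continuous (T : topologicalType) m n (f : T -> 'M[R]_(m, n)) :
  (forall i j, continuous (fun x => f x i j)) -> continuous f.
Proof.
move=> cf x A [P Px PA]; rewrite nbhs_filterE /=.
have H : \forall y \near x, forall ij : 'I_m * 'I_n, P ij.1 ij.2 (f y ij.1 ij.2).
  by apply: filter_forall => -[i j]; apply: cf; exact: Px.
by apply: filterS H => y Py; apply: PA => i j; exact: (Py (i, j)).
Qed.

Lemma continuous_mulmx (T : topologicalType) m n p
    (f : T -> 'M[R]_(m, n)) (g : T -> 'M[R]_(n, p)) :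
  continuous f -> continuous g -> continuous (fun x => f x *m g x).
Proof.
move=> cf cg; apply: mx_continuous => i j; under eq_fun do rewrite mxE.
move=> x; apply: cvg_big => [|k _]; first exact: add_continuous.
apply: cvgM.
  exact: (continuous_comp (@cf x) (@coord_continuous _ _ _ i k _)).
exact: (continuous_comp (@cg x) (@coord_continuous _ _ _ k j _)).
Qed.

Lemma H3mx_continuous : continuous (@H3mx R).
Proof. exact: initial_continuous. Qed.

Lemma H3inv_mxE (x : H3 R) :
  (x^-1)%g = H3mx x *m H3mx x - 3 *: H3mx x + 3%:M :> 'M[R]_3.
Proof. by []. Qed.

(** The inverse is a polynomial in the matrix, and for the initial topology continuity only has to
    be checked on matrices. *)
Lemma H3_div_continuous : continuous (fun z : H3 R * H3 R => (z.1 * z.2^-1)%g).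
Proof.
have c1 : continuous (fun z : H3 R * H3 R => H3mx z.1).
  by move=> z; apply: continuous_comp; [exact: cvg_fst|exact: H3mx_continuous].
have c2 : continuous (fun z : H3 R * H3 R => H3mx z.2).
  by move=> z; apply: continuous_comp; [exact: cvg_snd|exact: H3mx_continuous].
apply: (@continuous_comp_initial _ _ _ (@H3mx R)) => /=.
apply: continuous_mulmx => // z; under eq_fun do rewrite H3inv_mxE.
apply: cvgD; last exact: cvg_cst.
apply: cvgB; first exact: (continuous_mulmx c2 c2).
by apply: cvgZr; exact: c2.
Qed.

Lemma H3_set1_measurable (x : H3 R) : measurable [set x].
Proof.
rewrite -[[set x]]setCK; apply: measurableC; apply: sub_sigma_algebra.
have -> : ~` [set x] = @H3mx R @^-1` (~` [set H3mx x]).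
  by apply/seteqP; split=> y /= + xy; apply; [exact: val_inj|rewrite xy].
move/continuousP : H3mx_continuous; apply; apply: closed_openC.
exact/accessible_closed_set1/hausdorff_accessible/norm_hausdorff.
Qed.

Lemma compact_mulset_invset (E : set (H3 R)) :
  compact E -> compact (E *s invset E).
Proof.
move=> cE; have -> : E *s invset E =
    (fun z : H3 R * H3 R => (z.1 * z.2^-1)%g) @` (E `*` E).
  apply/seteqP; split=> [_ [x Ex [_ [y Ey <-] <-]]|_ [[x y] [/= Ex Ey] <-]].
    by exists (x, y).
  by exists x => //; exists y^-1%g => //; exists y.
apply: continuous_compact; last exact: compact_setX.
exact/continuous_subspaceT/H3_div_continuous.
Qed.

End H3_topology.

(** * Recurrence sets of the (C,F)-action *)

Section CF_coordinates.
Variables (R : realType) (lambda : {measure set (H3 R) -> \bar R}).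
Variables (F C : nat -> set (H3 R)) (h : CF_sequences lambda F C).

Lemma CFembed_level n p : CFlevel F C n p -> CFlevel F C n.+1 (CFembed p).
Proof.
move=> [Fp Cp]; split=> [|i /=]; last by have := Cp i.+1; rewrite addnS addSn.
apply: (CF_sub h); exists p.1 => //; exists (p.2 0%N) => //.
by have := Cp 0%N; rewrite addn0.
Qed.

Lemma iter_CFembed_level n i p :
  CFlevel F C n p -> CFlevel F C (n + i) (iter i (@CFembed R) p).
Proof.
move=> np; elim: i => [|i IH]; first by rewrite addn0.
by rewrite addnS iterS; exact: CFembed_level.
Qed.

(** By (IV) the product [f * c 0] determines [c 0], and then [f] by cancellation. *)
Lemma CFembed_inj n p q : CFlevel F C n p -> CFlevel F C n q ->
  CFembed p = CFembed q -> p = q.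
Proof.
case: p q => [f c] [f' c'] [/= Ff Cc] [/= Ff' Cc'] E0.
have fc : (f * c 0 = f' * c' 0)%g by exact: (congr1 fst E0).
have cc : (fun i => c i.+1) = (fun i => c' i.+1) by exact: (congr1 snd E0).
have c0 : c 0%N = c' 0%N.
  apply: contrapT => c00.
  have := CF_disj h (n := n) (c := c 0%N) (c' := c' 0%N).
  have := Cc 0%N; have := Cc' 0%N; rewrite addn0 => ? ? /(_ _ _ c00) E.
  suff : set0 ((f * c 0)%g : H3 R) by [].
  rewrite -E//; split; first by exists f => //; exists (c 0%N).
  by rewrite fc; exists f' => //; exists (c' 0%N).
move: fc; rewrite c0 => /mulIg ->; congr (_, _); apply/funext => -[|i]//.
exact: (congr1 (@^~ i) cc).
Qed.

Lemma iter_CFembed_inj n i p q : CFlevel F C n p -> CFlevel F C n q ->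
  iter i (@CFembed R) p = iter i (@CFembed R) q -> p = q.
Proof.
move=> np nq; elim: i => //= i IH E; apply: IH.
by apply: (@CFembed_inj (n + i)) E; exact: iter_CFembed_level.
Qed.

Lemma CFat_level n p (x : CFspace h) : CFat n p x -> CFlevel F C n p.
Proof. by case: x => /= _ [m [q [mq ->]]] []. Qed.

Lemma CFat_cover (x : CFspace h) : exists n p, CFat n p x.
Proof.
case: x => /= S [m [q [mq E]]]; exists m, q; rewrite /CFat /= E.
by split=> //; exists 0%N, 0%N.
Qed.

Lemma CFat_embed n p (x : CFspace h) : CFat n p x -> CFat n.+1 (CFembed p) x.
Proof.
move=> np; have lp := CFat_level np; move: np; rewrite /CFat.
case: (svalP x) => m [q [mq ->]] [_ [i [j [ij E]]]].
split; first exact: CFembed_level.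
by exists i.+1, j; rewrite -iterSr !iterS E addnS ij addSn.
Qed.

Lemma CFat_iter n i p (x : CFspace h) :
  CFat n p x -> CFat (n + i) (iter i (@CFembed R) p) x.
Proof.
move=> np; elim: i => [|i IH]; first by rewrite addn0.
by rewrite addnS iterS; exact: CFat_embed.
Qed.

Lemma CFat_inj n p q (x : CFspace h) : CFat n p x -> CFat n q x -> p = q.
Proof.
move=> np nq; have lp := CFat_level np; have lq := CFat_level nq; move: np nq.
rewrite /CFat; case: (svalP x) => m [r [mr ->]] [_ [i [j [ij E]]]] [_ [i' [j' [ij' E']]]].
wlog ii : i j i' j' p q ij E ij' E' lp lq / (i <= i')%N.
  move=> H; have [ii|ii] := leqP i i'; first exact: (H i j i' j').
  by apply/esym; apply: (H i' j' i j) => //; exact: ltnW.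
(* Both [p] and [q] meet the representative [r]; pushing the earlier meeting to the later level
   makes their [j']-th iterates equal. *)
have jE : (j' = (i' - i) + j)%N by move: ij ij' => /=; lia.
apply: (@iter_CFembed_inj n j') => //.
by rewrite -[RHS]E' {1}jE iterD -[X in iter _ _ X]E -iterD subnK.
Qed.

Lemma iter_CFembed2 i p : (iter i (@CFembed R) p).2 = fun k => p.2 (k + i)%N.
Proof.
elim: i => [|i IH] /=; first by apply/funext => k; rewrite addn0.
by rewrite IH; apply/funext => k; rewrite addSn addnS.
Qed.

End CF_coordinates.

(** * Difference sets and the measure of return sets *)

Section CF_zero_type.
Variables (R : realType) (lambda : {measure set (H3 R) -> \bar R}).
Variables (F C : nat -> set (H3 R)) (h : CF_sequences lambda F C).

Definition CFset (n : nat) : set (CFspace h) := [set x | exists p, CFat n p x].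

Lemma CFset_rect n : CFset n = CFrect n setT 0 (fun _ => setT).
Proof. by apply/seteqP; split=> [x [p px]|x [p [px _ _]]]; exists p. Qed.

Lemma CFset_nondecreasing : nondecreasing_seq CFset.
Proof.
apply/nondecreasing_seqP => n; apply/subsetPset => x [p px].
by exists (CFembed p); exact: CFat_embed.
Qed.

Lemma bigcup_CFset : \bigcup_n CFset n = setT.
Proof.
apply/seteqP; split=> // x _; have [n [p px]] := CFat_cover x.
by exists n => //; exists p.
Qed.

(** These are the sets of condition (ii); on the diagonal, for [c.1 = c.2], one gets [F n (F n)^-1]
    back. *)
Definition difset n (c : H3 R * H3 R) : set (H3 R) :=
  F n *s [set c.1] *s [set (c.2^-1)%g] *s invset (F n).

Definition offdiag n : set (H3 R * H3 R) :=
  [set c | [/\ C n.+1 c.1, C n.+1 c.2 & c.1 <> c.2]].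

Lemma difset_mem n f f' c c' : F n f -> F n f' ->
  difset n (c, c') (f * c * c'^-1 * f'^-1)%g.
Proof.
move=> Ff Ff'; exists (f * c * c'^-1)%g; last by exists f'^-1%g => //; exists f'.
exists (f * c)%g; last by exists c'^-1%g.
by exists f => //; exists c.
Qed.

(** Links consecutive levels: a difference set of level [n] is absorbed, by (III), in
    [F n.+1 (F n.+1)^-1], which (ii) separates from the off-diagonal difference sets of level
    [n.+1]. *)
Lemma difset_sub n c : C n.+1 c.1 -> C n.+1 c.2 ->
  difset n c `<=` F n.+1 *s invset (F n.+1).
Proof.
case: c => c c' /= Cc Cc' _ [_ [_ [f Ff [_ -> <-]]] [_ -> <-]] [_ [f' Ff' <-] <-].
exists (f * c)%g; first by apply: (CF_sub h); exists f => //; exists c.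
exists (f' * c')^-1%g; last by rewrite invgM !mulgA.
by exists (f' * c')%g => //; apply: (CF_sub h); exists f' => //; exists c'.
Qed.

Lemma CF_nonempty n : C n.+1 !=set0.
Proof.
apply/set0P/eqP => C0; have [_] := CF_finite h n.
by rewrite C0 /ncard fset_set0.
Qed.

Lemma FFV_nondecreasing m n : (m <= n)%N ->
  F m *s invset (F m) `<=` F n *s invset (F n).
Proof.
elim: n => [|n IH]; first by rewrite leqn0 => /eqP ->.
rewrite leq_eqVlt => /predU1P[-> //|/IH H].
apply: (subset_trans H) => _ [f Ff [_ [f' Ff' <-] <-]].
have [c Cc] := CF_nonempty n.
apply: (@difset_sub n (c, c)) => //=.
(* Seen as an element of a diagonal difference set, the quotient falls under [difset_sub]. *)
have -> : (f * f'^-1 = f * c * c^-1 * f'^-1)%g by rewrite mulgK.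
exact: difset_mem.
Qed.

Hypothesis H_ii : forall n,
  (forall c c', offdiag n c -> offdiag n c' -> c <> c' ->
     difset n c `&` difset n c' = set0) /\
  (forall c, offdiag n c -> difset n c `&` (F n *s invset (F n)) = set0).

(** Condition (ii) compares sets of one level only. For [m < n] the difference set of level [m] lies
    in [F n (F n)^-1], which (ii) at level [n] excludes. *)
Lemma difset_inj m n c d g : offdiag m c -> offdiag n d ->
  difset m c g -> difset n d g -> m = n /\ c = d.
Proof.
wlog mn : m n c d / (m <= n)%N.
  move=> H oc od cg dg; have [mn|/ltnW mn] := leqP m n; first exact: H.
  by have [-> ->] := H _ _ _ _ mn od oc dg cg.
move=> oc od cg dg; have [mn'|nm] := ltnP m n.
  exfalso; have [_ /(_ d od) E] := H_ii n.
  suff : set0 g by []; rewrite -E; split => //.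
  by apply: (FFV_nondecreasing mn'); case: (oc) => ? ? _; exact: difset_sub cg.
have {mn nm}mn : m = n by apply/eqP; rewrite eqn_leq mn.
split=> //; move: oc cg; rewrite mn => oc cg; apply: contrapT => cd.
have [/(_ c d oc od cd) E _] := H_ii n.
by suff : set0 g by []; rewrite -E.
Qed.

(** The embeddings multiply on the right and so commute with left translation by [g]. *)
Lemma CFat_shift n f c g (x y : CFspace h) i :
  CFat n (f, c) x -> CFat n ((g * f)%g, c) y ->
  exists p, CFat (n + i) p x /\ CFat (n + i) ((g * p.1)%g, p.2) y.
Proof.
move=> nx ny; elim: i => [|i [p [px py]]]; first by exists (f, c); rewrite addn0.
exists (CFembed p); rewrite addnS; split; first exact: CFat_embed.
by have := CFat_embed py; rewrite /CFembed /= mulgA.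
Qed.

Lemma CFat_difference n p q (x y : CFspace h) g m f c :
  CFat n p x -> CFat n q y ->
  CFat m (f, c) x -> CFat m ((g * f)%g, c) y ->
  (F n *s invset (F n)) g \/
  exists k, offdiag (n + k) (q.2 k, p.2 k) /\
            difset (n + k) (q.2 k, p.2 k) g.
Proof.
move=> px qy mx my.
have [r [rx ry]] := CFat_shift n mx my.
have [lp lq] := (CFat_level px, CFat_level qy).
pose u i (p : CFcoord R) := (iter i (@CFembed R) p).1.
have uF i z : CFlevel F C n z -> F (n + i) (u i z).
  by move=> /(iter_CFembed_level h i)[].
have uS i z : u i.+1 z = (u i z * z.2 i)%g.
  by rewrite /u iterS /= iter_CFembed2 add0n.
(* At level [n + m] both pairs of coordinates, those of level [n] and those of level [m], are
   available and must coincide. *)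
have ex : exists i, (g * u i p)%g == u i q.
  exists m; apply/eqP; rewrite /u.
  have -> : iter m (@CFembed R) p = r.
    by apply: CFat_inj rx; rewrite addnC; exact: CFat_iter.
  have -> // : iter m (@CFembed R) q = ((g * r.1)%g, r.2).
  by apply: CFat_inj ry; rewrite addnC; exact: CFat_iter.
(* At a minimal index [k.+1] the coordinates [p.2 k] and [q.2 k] differ, since equal ones would
   cancel on the right and make [k] admissible. Index 0 puts [g] in [F n (F n)^-1]. *)
case: (ex_minnP ex) => -[|k] /eqP gk mink.
  left; exists q.1; first by case: lq.
  exists p.1^-1%g; first by exists p.1 => //; case: lp.
  by rewrite -[q.1]/(u 0%N q) -gk mulgK.
right; exists k; have Cp := lp.2 k; have Cq := lq.2 k.
move: gk; rewrite !uS => gk; split.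
  split=> //= qp; have := mink k; rewrite ltnn => H; apply/notF/H/eqP.
  by apply: (mulIg (q.2 k)); rewrite -gk qp mulgA.
have -> : g = (u k q * q.2 k * (p.2 k)^-1 * (u k p)^-1)%g.
  by rewrite -gk mulgA mulgK mulgK.
by apply: difset_mem; exact: uF.
Qed.

Lemma CFrect_measurable n A k B : measurable A -> (forall i, measurable (B i)) ->
  measurable (CFrect n A k B : set (CFspace h)).
Proof. by move=> mA mB; apply: sub_sigma_algebra; exists n, A, k, B. Qed.

Lemma CFset_measurable n : measurable (CFset n).
Proof. by rewrite CFset_rect; exact: CFrect_measurable. Qed.

Hypothesis Hlambda : haar_measure lambda.
Hypothesis H_iii : ncard (C n) @[n --> \oo] --> \oo.
Variables (mu : {measure set (CFspace h) -> \bar R}) (Hmu : CF_measure mu).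

Lemma CFset_fin_num n : mu (CFset n) \is a fin_num.
Proof.
rewrite CFset_rect Hmu// big_ord0 mule1 setTI.
rewrite fin_numM// ge0_fin_numE//.
have [mF cF _ _] := CF_folner h; have [lK _ _] := Hlambda.
apply: le_lt_trans (lK _ (cF n)).
apply: le_measure; rewrite ?inE//; last exact: subset_closure.
rewrite -[closure _]setCK; apply: measurableC; apply: sub_sigma_algebra.
exact/closed_openC/closed_closure.
Qed.

Let slice n k c : set (CFspace h) := [set x | exists2 p, CFat n p x & p.2 k = c].

Let sliceE n k c :
  slice n k c = CFrect n setT k.+1 (fun i => if i == k then [set c] else setT).
Proof.
apply/seteqP; split=> x [p].
  move=> px pk; exists p; split=> // i _.
  by case: eqVneq => //= ->.
move=> [px _] /(_ k (ltnSn k)); rewrite eqxx => pk.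
by exists p.
Qed.

Let slice_measurable n k c : measurable (slice n k c).
Proof.
rewrite sliceE; apply: CFrect_measurable => // i.
by case: ifP => // _; exact: H3_set1_measurable.
Qed.

(** Only an inequality, because [c] need not belong to [C (n + k).+1]; the slice is then null. *)
Let mu_slice n k c :
  (mu (slice n k c) <= mu (CFset n) * ((ncard (C (n + k).+1))%:R^-1)%:E)%E.
Proof.
rewrite sliceE CFset_rect !Hmu//; last first.
  by move=> i; case: ifP => // _; exact: H3_set1_measurable.
rewrite big_ord0 mule1; apply: lee_wpmul2l.
  by rewrite mule_ge0// lee_fin invr_ge0 prodr_ge0.
have C0 m : (0 < (ncard (C m.+1))%:R :> R).
  by rewrite ltr0n; have [_ /ltnW] := CF_finite h m.
rewrite lee_fin big_ord_recr big1 => [|i _] /=; last first.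
  by rewrite ltn_eqF// setTI divff// gt_eqF.
rewrite eqxx mul1r ler_pdivrMr// mulVf ?gt_eqF//.
have [Cc|nCc] := pselect (C (n + k).+1 c).
  have -> : [set c] `&` C (n + k).+1 = [set c].
    by apply/seteqP; split=> [x []|x ->].
  by rewrite /ncard fset_set1 cardfs1.
have -> : [set c] `&` C (n + k).+1 = set0.
  by apply/seteqP; split=> // x [-> /nCc].
by rewrite /ncard fset_set0 cardfs0.
Qed.

Variables (T : H3 R -> {mfun CFspace h >-> CFspace h}) (HT : CF_action mu T).

Lemma CF_zero_type n (d : R) : 0 < d -> exists K : set (H3 R), compact K /\
  forall g, ~ K g -> (mu (CFset n `&` T g @^-1` CFset n) < d%:E)%E.
Proof.
move=> d0; set r := fine (mu (CFset n)).
have rE : mu (CFset n) = r%:E by rewrite fineK// CFset_fin_num.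
have r0 : 0 <= r by rewrite fine_ge0.
(* From [N0] on, [#C_m > r / d], so that a slice has measure at most [r / #C_m < d]. *)
have /cvgnyPge/(_ (Num.truncn (r / d)).+1)[N0 _ HN] := H_iii.
pose N := maxn n N0.
have [_ cF _ _] := CF_folner h.
(* Outside this compact set [g] avoids every [F m (F m)^-1] with [m <= N], hence all difference sets
   of levels below [N]. *)
exists (closure (F N) *s invset (closure (F N))); split.
  exact: compact_mulset_invset.
move=> g nKg.
have nFg m : (m <= N)%N -> ~ (F m *s invset (F m)) g.
  move=> mN /(FFV_nondecreasing mN)[x Fx [_ [y Fy <-] xy]]; apply: nKg.
  exists x; first exact: subset_closure.
  by exists y^-1%g => //; exists y => //; exact: subset_closure.
pose good x := exists m f c,
    [/\ CFat m (f, c) x, F m (g * f)%g & CFat m ((g * f)%g, c) (T g x)].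
have mI : measurable (CFset n `&` T g @^-1` CFset n).
  apply: measurableI; first exact: CFset_measurable.
  by rewrite -[X in measurable X]setTI; apply: measurable_funP => //; exact: CFset_measurable.
have diff x : (CFset n `&` T g @^-1` CFset n) x -> good x -> exists p q k,
    [/\ CFat n p x, (N <= n + k)%N, offdiag (n + k) (q k, p.2 k) &
        difset (n + k) (q k, p.2 k) g].
  move=> [[p px] [q qx]] [m [f [c [mx _ my]]]].
  have [/nFg|[k [ok dk]]] := CFat_difference px qx mx my.
    by rewrite leq_maxl => /(_ isT).
  exists p, q.2, k; split=> //; rewrite leqNgt; apply/negP => kN.
  by apply: (nFg _ kN); case: (ok) => ? ? _; exact: difset_sub dk.
have [_ /(_ g)[Z [mZ Z0 goodZ]]] := HT.
have {}goodZ x : ~ Z x -> good x by move=> nZ; apply: contrapT => /goodZ.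
(* A single good point of the return set names the slice that contains all the others. If there is
   none, the return set lies in the null set [Z]. *)
have [[x [Ix gx]]|nx] := pselect (exists x, (CFset n `&` T g @^-1` CFset n) x /\ good x).
  have [p [q [k [px Nk ok dk]]]] := diff x Ix gx.
  apply: (@le_lt_trans _ _ (mu (Z `|` slice n k (p.2 k)))).
    apply: le_measure; rewrite ?inE//; first exact: measurableU.
    move=> y Iy; have [Zy|/goodZ gy] := pselect (Z y); first by left.
    right; have [p' [q' [k' [py _ ok' dk']]]] := diff y Iy gy.
    have [kk [_ pp]] := difset_inj ok' ok dk' dk.
    by exists p' => //; rewrite -pp; congr (p'.2 _); apply/esym/(@addnI n).
  apply: (le_lt_trans (measureU2 _ _ _)) => //.
  rewrite [X in (X + _)%E]Z0 add0e; apply: (le_lt_trans (mu_slice _ _ _)).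
  rewrite rE -EFinM lte_fin.
  have /HN /= Ck : (N0 <= (n + k).+1)%N.
    by rewrite (leq_trans (leq_maxr n N0))// ltnW.
  rewrite ltr_pdivrMr; last by rewrite ltr0n (leq_trans _ Ck).
  rewrite mulrC -ltr_pdivrMr//; apply: (lt_le_trans (truncnS_gt _)).
  by rewrite ler_nat.
apply: (@le_lt_trans _ _ (mu Z)); last by rewrite [X in (X < _)%E]Z0 lte_fin.
apply: le_measure; rewrite ?inE// => y Iy; apply: contrapT => /goodZ gy.
by apply: nx; exists y.
Qed.

End CF_zero_type.

(** * A criterion for mixing of all orders *)

Lemma measure_le_ae d (X : measurableType d) (R : realType)
    (mu : {measure set X -> \bar R}) (A B : set X) :
  measurable A -> measurable B -> {ae mu, forall x, A x -> B x} ->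
  (mu A <= mu B)%E.
Proof.
move=> mA mB [Z [mZ Z0 AB]].
apply: (@le_trans _ _ (mu (B `|` Z))).
  apply: le_measure; rewrite ?inE//; first exact: measurableU.
  move=> x Ax; have [Zx|nZx] := pselect (Z x); first by right.
  by left; apply: contrapT => nBx; apply: nZx; apply: AB => /(_ Ax).
apply: (le_trans (measureU2 _ _ _)) => //.
by rewrite [X in (_ + X)%E]Z0 adde0.
Qed.

Lemma measure_eq_ae d (X : measurableType d) (R : realType)
    (mu : {measure set X -> \bar R}) (A B : set X) :
  measurable A -> measurable B -> {ae mu, forall x, A x <-> B x} -> mu A = mu B.
Proof.
move=> mA mB AB; apply/eqP; rewrite eq_le; apply/andP; split.
  by apply: measure_le_ae => //; apply: filterS AB => x [].
by apply: measure_le_ae => //; apply: filterS AB => x [].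
Qed.

(** * Symmetric differences and finite intersections of events *)

Section real_probability.
Context d (Y : measurableType d) (R : realType) (P : probability Y R).
Implicit Types A B C : set Y.

Definition pr A : R := fine (P A).

Lemma prE A : measurable A -> P A = (pr A)%:E.
Proof. by move=> mA; rewrite fineK// fin_num_measure. Qed.

Lemma pr_ge0 A : 0 <= pr A. Proof. by rewrite fine_ge0. Qed.

Lemma pr_le1 A : measurable A -> pr A <= 1.
Proof. by move=> mA; rewrite -lee_fin -prE// probability_le1. Qed.

Lemma pr_le A B : measurable A -> measurable B -> A `<=` B -> pr A <= pr B.
Proof. by move=> mA mB AB; rewrite -lee_fin -!prE// le_measure ?inE. Qed.

Lemma pr_setU A B : measurable A -> measurable B -> pr (A `|` B) <= pr A + pr B.
Proof.
move=> mA mB; rewrite -lee_fin EFinD -!prE//; first exact: measureU2.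
exact: measurableU.
Qed.

Lemma measurable_setY A B : measurable A -> measurable B -> measurable (A `+` B).
Proof. by move=> mA mB; apply: measurableU; exact: measurableD. Qed.

Lemma pr_le_setY A B : measurable A -> measurable B -> pr A <= pr B + pr (A `+` B).
Proof.
move=> mA mB; apply: (le_trans _ (pr_setU _ _)) => //; last exact: measurable_setY.
apply: pr_le => //; first exact/measurableU/measurable_setY.
by move=> x Ax; have [Bx|Bx] := pselect (B x); [left|right; left].
Qed.

Lemma pr_dist A B : measurable A -> measurable B ->
  `|pr A - pr B| <= pr (A `+` B).
Proof.
move=> mA mB; rewrite ler_distl lerBlDr pr_le_setY// andbT.
by rewrite setYC pr_le_setY.
Qed.

Lemma pr_bigsetI_dist (I : Type) (s : seq I) (A B : I -> set Y) :
  (forall i, measurable (A i)) -> (forall i, measurable (B i)) ->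
  `|pr (\big[setI/setT]_(i <- s) A i) - pr (\big[setI/setT]_(i <- s) B i)| <=
  \sum_(i <- s) pr (A i `+` B i).
Proof.
move=> mA mB.
have mI (D : I -> set Y) r : (forall i, measurable (D i)) ->
    measurable (\big[setI/setT]_(i <- r) D i).
  by move=> mD; apply: bigsetI_measurable.
apply: (le_trans (pr_dist (mI _ _ mA) (mI _ _ mB))).
have mY i : measurable (A i `+` B i) by exact: measurable_setY.
elim: s => [|i s IH]; first by rewrite !big_nil setYK /pr measure0.
rewrite !big_cons; apply: (le_trans _ (lerD (lexx _) IH)).
have mYs := measurable_setY (mI _ s mA) (mI _ s mB).
apply: (le_trans _ (pr_setU (mY i) mYs)); apply: pr_le.
- by apply: measurable_setY; apply: measurableI => //; exact: mI.
- exact: measurableU.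
- by move=> y /=; have [] := pselect (A i y); have [] := pselect (B i y); tauto.
Qed.

End real_probability.

(** Telescoping: replace one factor at a time, the others being at most 1. *)
Lemma prod_dist (R : realDomainType) (I : Type) (s : seq I) (a b : I -> R) :
  (forall i, 0 <= a i <= 1) -> (forall i, 0 <= b i <= 1) ->
  `|\prod_(i <- s) a i - \prod_(i <- s) b i| <= \sum_(i <- s) `|a i - b i|.
Proof.
move=> a01 b01; elim: s => [|i s IH]; first by rewrite !big_nil subrr normr0.
rewrite !big_cons; set p := \prod_(_ <- _) a _; set q := \prod_(_ <- _) b _.
have -> : a i * p - b i * q = (a i - b i) * p + b i * (p - q) by ring.
apply: (le_trans (ler_normD _ _)); rewrite !normrM; apply: lerD.
  rewrite ler_piMr// ger0_norm; first by apply: prodr_ile1 => j _.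
  by apply: prodr_ge0 => j _; case/andP: (a01 j).
apply: le_trans IH; rewrite ler_piMl//.
by case/andP: (b01 i) => b0 b1; rewrite ger0_norm.
Qed.

(** * Uniform approximation and mixing *)

Section mixing_criterion.
Context d (X : measurableType d) (R : realType) (mu : {measure set X -> \bar R}).
Variables (T : H3 R -> {mfun X >-> X}) (D : nat -> set X).
Hypotheses (mpT : mp_action mu T) (mD : forall n, measurable (D n)).
Hypothesis ndD : nondecreasing_seq D.
Hypothesis zeroT : forall n (e : R), 0 < e -> exists K : set (H3 R), compact K /\
  forall g, ~ K g -> (mu (D n `&` T g @^-1` D n) < e%:E)%E.
Context d' (Y : measurableType d') (nu : probability Y R) (S : H3 R -> Y -> Y).
Hypothesis mpS : mp_action nu S.
Variable gen : set X -> set (set Y).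
Hypothesis gen_measurable : forall E, gen E `<=` measurable.
Hypothesis gen_mono : forall E E', E `<=` E' -> gen E `<=` gen E'.
Hypothesis gen_indep : forall E E' A B, measurable E -> measurable E' ->
  E `&` E' = set0 -> <<s gen E >> A -> <<s gen E' >> B ->
  pr nu (A `&` B) = pr nu A * pr nu B.

(* [A] can be approximated, uniformly in [g], after deleting from
   [T_g^-1 D_n] any set of small measure. *)
Definition robust (A : set Y) : Prop := measurable A /\
  forall e : R, 0 < e -> exists n (r : R), 0 < r /\
    forall g N, measurable N -> (mu (T g @^-1` D n `&` N) < r%:E)%E ->
    exists A', <<s gen (T g @^-1` D n `\` N) >> A' /\
               pr nu ((S g @^-1` A) `+` A') < e.

Lemma sgen_measurable E : <<s gen E >> `<=` measurable.
Proof. by apply: smallest_sub => //; exact: sigma_algebra_measurable. Qed.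

Lemma sgen_mono E E' : E `<=` E' -> <<s gen E >> `<=` <<s gen E' >>.
Proof. by move=> EE'; apply: sub_smallest2r => //; exact: gen_mono. Qed.

Lemma sgen_setI E A B : <<s gen E >> A -> <<s gen E >> B -> <<s gen E >> (A `&` B).
Proof. exact: (@measurableI _ (g_sigma_algebraType (gen E))). Qed.

Lemma sgen_setU E A B : <<s gen E >> A -> <<s gen E >> B -> <<s gen E >> (A `|` B).
Proof. exact: (@measurableU _ (g_sigma_algebraType (gen E))). Qed.

Lemma sgen_setC E A : <<s gen E >> A -> <<s gen E >> (~` A).
Proof. exact: (@measurableC _ (g_sigma_algebraType (gen E))). Qed.

Let mT g A : measurable A -> measurable (T g @^-1` A).
Proof. by move=> mA; rewrite -[X in measurable X]setTI; exact: measurable_funP. Qed.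

Let mS g A : measurable A -> measurable (S g @^-1` A).
Proof. by move=> mA; rewrite -[X in measurable X]setTI; case: mpS => + _ _ _; apply. Qed.

Let prS g A : measurable A -> pr nu (S g @^-1` A) = pr nu A.
Proof. by move=> mA; rewrite /pr; case: mpS => _ + _ _ => ->. Qed.

(** Enlarging [D n] strengthens the assumption on [N] and weakens the conclusion. The index may thus
    be raised, which brings finitely many events to a common [D m]. *)
Lemma robust_shift A e : robust A -> 0 < e -> exists n (r : R), 0 < r /\
  forall m, (n <= m)%N -> forall g N, measurable N ->
    (mu (T g @^-1` D m `&` N) < r%:E)%E ->
    exists A', <<s gen (T g @^-1` D m `\` N) >> A' /\
               pr nu ((S g @^-1` A) `+` A') < e.
Proof.
move=> [mA rA] e0; have [n [r [r0 H]]] := rA e e0.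
exists n, r; split=> // m nm g N mN muN.
have DD : D n `<=` D m by exact/subsetPset/ndD.
have [|A' [genA' prA']] := H g N mN.
  apply: le_lt_trans muN; apply: le_measure; rewrite ?inE.
  - by apply: measurableI => //; exact: mT.
  - by apply: measurableI => //; exact: mT.
  - by move=> x [] /DD.
by exists A'; split=> //; apply: sgen_mono genA' => x [] /DD.
Qed.

Lemma robust0 : robust set0.
Proof.
split=> // e e0; exists 0%N, 1; split=> // g N mN _; exists set0.
by split; [exact: sigma_algebra0|rewrite preimage_set0 setYK /pr measure0].
Qed.

Lemma robustC A : robust A -> robust (~` A).
Proof.
move=> [mA rA]; split; first exact: measurableC.
move=> e /rA[n [r [r0 H]]]; exists n, r; split=> // g N mN /(H _ _ mN)[A' [gA' pA']].
exists (~` A'); split; first exact: sgen_setC.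
rewrite preimage_setC; congr (pr nu _ < _) : pA'.
by apply/seteqP; split=> y /=; have [] := pselect (A (S g y));
  have [] := pselect (A' y); tauto.
Qed.

Lemma robustU A B : robust A -> robust B -> robust (A `|` B).
Proof.
move=> rA rB; have [mA _] := rA; have [mB _] := rB.
split=> [|e e0]; first exact: measurableU.
have e20 : 0 < e / 2 by rewrite divr_gt0.
have [n [r [r0 HA]]] := robust_shift rA e20.
have [m [s [s0 HB]]] := robust_shift rB e20.
exists (maxn n m), (Num.min r s); split=> [|g N mN]; first by rewrite lt_min r0.
rewrite EFin_min lt_min => /andP[muA muB].
have [A' [gA pA]] := HA _ (leq_maxl _ _) g N mN muA.
have [B' [gB pB]] := HB _ (leq_maxr _ _) g N mN muB.
exists (A' `|` B'); split; first exact: sgen_setU.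
have mA' := sgen_measurable gA; have mB' := sgen_measurable gB.
have mYA := measurable_setY (mS g mA) mA'; have mYB := measurable_setY (mS g mB) mB'.
apply: (@le_lt_trans _ _ (pr nu ((S g @^-1` A) `+` A') + pr nu ((S g @^-1` B) `+` B'))).
  apply: (le_trans _ (pr_setU _ mYA mYB)); apply: pr_le.
  - by apply: measurable_setY; [apply/mS|]; exact: measurableU.
  - exact: measurableU.
  - by move=> y /=; tauto.
by rewrite [ltRHS](splitr e) ltrD.
Qed.

(** [S g] preserves [nu], so the error made by replacing [B] with [A] is the same for all [g]. *)
Lemma robust_approx B : measurable B ->
  (forall e : R, 0 < e -> exists2 A, robust A & pr nu (A `+` B) < e) -> robust B.
Proof.
move=> mB BA; split=> // e e0; have e20 : 0 < e / 2 by rewrite divr_gt0.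
have [A rA AB] := BA _ e20; have [mA _] := rA.
have [n [r [r0 H]]] := robust_shift rA e20.
exists n, r; split=> // g N mN /(H n (leqnn n) _ _ mN)[A' [gA' pA']].
exists A'; split=> //; have mA' := sgen_measurable gA'.
have mAB : measurable (A `+` B) by exact: measurable_setY.
apply: (@le_lt_trans _ _ (pr nu (S g @^-1` (A `+` B)) + pr nu ((S g @^-1` A) `+` A'))).
  have mYA := measurable_setY (mS g mA) mA'.
  apply: (le_trans _ (pr_setU _ (mS g mAB) mYA)); apply: pr_le.
  - by apply: measurable_setY => //; exact: mS.
  - by apply: measurableU => //; exact: mS.
  - by move=> y /=; have [] := pselect (A (S g y)); tauto.
by rewrite prS// [ltRHS](splitr e) ltrD.
Qed.

(** Finite unions exhaust the countable one in probability, so [robust_approx] applies. *)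
Lemma robust_bigcup (A : (set Y)^nat) : (forall n, robust (A n)) ->
  robust (\bigcup_n A n).
Proof.
move=> rA; have mA n : measurable (A n) by case: (rA n).
have mbigA : measurable (\bigcup_n A n) by exact: bigcup_measurable.
pose B n := \bigcup_(i < n) A i.
have rB n : robust (B n).
  rewrite /B bigcup_mkord; elim: n => [|n IH]; first by rewrite big_ord0; exact: robust0.
  by rewrite big_ord_recr; exact: robustU.
have mB n : measurable (B n) by case: (rB n).
have UB : \bigcup_n B n = \bigcup_n A n.
  apply/seteqP; split=> y [n _]; first by move=> [i _ ?]; exists i.
  by move=> ?; exists n.+1 => //; exists n => /=.
apply: robust_approx => // e e0.
have ndB : nondecreasing_seq B.
  move=> n m nm; apply/subsetPset => y [i /= ? ?].
  by exists i => //=; exact: leq_trans nm.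
have mUB : measurable (\bigcup_n B n) by rewrite UB.
have /fine_cvgP[_ /cvgrPdist_lt/(_ _ e0)[n _ Hn]] :
    nu (B n) @[n --> \oo] --> (pr nu (\bigcup_n A n))%:E.
  by rewrite -prE// -UB; exact: nondecreasing_cvg_mu.
exists (B n) => //; have := Hn n (leqnn n).
have BA : B n `<=` \bigcup_n A n by rewrite -UB; exact: bigcup_sup.
rewrite /= -[fine _]/(pr nu _) => H.
have -> : B n `+` \bigcup_n A n = (\bigcup_n A n) `\` B n.
  by apply/seteqP; split=> y /=; [move=> [[/BA]|]|]; tauto.
have -> : pr nu (\bigcup_n A n `\` B n) = pr nu (\bigcup_n A n) - pr nu (B n).
  have nu_lty : (nu (\bigcup_n A n) < +oo)%E by rewrite prE// ltry.
  have := measureD mbigA (mB n) nu_lty; rewrite setIidr// => E; rewrite {1}/pr E fineB ?fin_num_measure//.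
by apply: le_lt_trans H; exact: ler_norm.
Qed.

Lemma robust_sigma_algebra : sigma_algebra setT robust.
Proof.
split; [exact: robust0| |exact: robust_bigcup].
by move=> A rA; rewrite setTD; exact: robustC.
Qed.

(** The two claims need a joint induction: to split off [A i] by [gen_indep], the intersection of
    the remaining events must be known to depend only on the union of the remaining sets. *)
Let bigsetI_pr (I : eqType) (s : seq I) (E : I -> set X) (A : I -> set Y) :
  uniq s -> (forall i, measurable (E i)) ->
  (forall i j, i != j -> E i `&` E j = set0) ->
  (forall i, <<s gen (E i) >> (A i)) ->
  <<s gen (\big[setU/set0]_(i <- s) E i) >> (\big[setI/setT]_(i <- s) A i) /\
  pr nu (\big[setI/setT]_(i <- s) A i) = \prod_(i <- s) pr nu (A i).
Proof.
move=> + mE dE gA; elim: s => [_|i s IH /= /andP[nis us]].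
  rewrite !big_nil; split; last by rewrite /pr probability_setT.
  exact: (@measurableT _ (g_sigma_algebraType (gen set0))).
have [gs ps] := IH us; rewrite !big_cons; split.
  apply: sgen_setI; first by apply: sgen_mono (gA i) => x; left.
  by apply: sgen_mono gs => x; right.
rewrite -ps; apply: gen_indep (gA i) gs => //; first exact: bigsetU_measurable.
rewrite big_distrr /= big_seq big1// => j js; apply: dE.
by apply: contraNneq nis => ->.
Qed.

Let mu_setI_bigsetU (I : Type) (s : seq I) (Q : pred I) (E : I -> set X) A (r : R) :
  measurable A -> (forall i, measurable (E i)) -> 0 <= r ->
  (forall i, Q i -> (mu (A `&` E i) <= r%:E)%E) ->
  (mu (A `&` \big[setU/set0]_(i <- s | Q i) E i) <= (r *+ size s)%:E)%E.
Proof.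
move=> mA mE r0 AE; elim: s => [|i s IH]; first by rewrite big_nil setI0 measure0.
have mU : measurable (\big[setU/set0]_(i <- s | Q i) E i) by exact: bigsetU_measurable.
rewrite big_cons /= mulrS EFinD; case: ifPn => [Qi|_]; last first.
  by apply: (le_trans IH); rewrite leeDr// lee_fin.
rewrite setIUr; apply: (le_trans (measureU2 _ _ _)); try exact: measurableI.
by apply: leeD => //; exact: AE.
Qed.

(** Invariance under [T g] turns the overlap of two translates into one return set, to which [zeroT]
    applies. The action law holds almost everywhere, which is enough for measures. *)
Let muTT g h n :
  mu (T g^-1%g @^-1` D n `&` T h^-1%g @^-1` D n) =
  mu (D n `&` T (h^-1 * g)%g @^-1` D n).
Proof.
have [_ pT T1 TM] := mpT.
rewrite -(pT g); last by apply: measurableI; exact: mT.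
rewrite preimage_setI; apply: measure_eq_ae.
- by apply: measurableI; apply/mT/mT.
- by apply: measurableI => //; exact/mT.
have := TM g^-1%g g; rewrite mulVg => H1; have H2 := TM h^-1%g g.
near=> x => /=.
have <- : T 1%g x = T (g^-1)%g (T g x) by near: x.
have -> : T 1%g x = x by near: x.
by have -> : T (h^-1 * g)%g x = T (h^-1)%g (T g x) by near: x.
Unshelve. all: by end_near. Qed.

Hypothesis gen_robust : forall A, measurable A -> robust A.

Lemma mixing_criterion l : mixing_of_order nu S l.
Proof.
move=> eps eps0 A mA.
(* Two sums of [l.+1] errors will occur, one for the intersection and one for the product; each is
   at most [eps / 4]. *)
pose e := eps / (4 * l.+1%:R).
have e0 : 0 < e by rewrite divr_gt0// mulr_gt0// ltr0n.
have /choice[n /choice[r /all_and2[r0 Hr]]] := fun i => robust_shift (gen_robust (mA i)) e0.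
pose m := \max_i n i; pose r' := \big[Num.min/1]_i r i.
have r'0 : 0 < r' by apply/bigmin_gtP.
(* The overlaps are bounded by a sum of [l.+1] terms [r1]; dividing by [l.+2] keeps it strictly
   below [r']. *)
pose r1 := r' / l.+2%:R.
have r10 : 0 < r1 by rewrite divr_gt0// ltr0n.
have [K [cK HK]] := zeroT m r10.
exists K; split=> // g gK.
pose E i := T (g i)^-1%g @^-1` D m.
pose N i := \big[setU/set0]_(j | j != i) E j.
have mE i : measurable (E i) by exact: mT.
have mN i : measurable (N i) by exact: bigsetU_measurable.
have muN i : (mu (E i `&` N i) < (r i)%:E)%E.
  apply: (@le_lt_trans _ _ (r1 *+ size (index_enum 'I_l.+1))%:E).
    apply: mu_setI_bigsetU => //; first exact: ltW.
    by move=> j ji; rewrite /E muTT; apply/ltW/HK/gK.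
  rewrite lte_fin; apply: (@lt_le_trans _ _ r'); last exact: bigmin_le.
  have -> : size (index_enum 'I_l.+1) = l.+1.
    by rewrite -[RHS](card_ord l.+1) cardT enumT.
  by rewrite -mulr_natr /r1 mulrAC ltr_pdivrMr ?ltr0n// ltr_pM2l// ltr_nat.
have /choice[A' /all_and2[gA' pA']] :=
  fun i => Hr i m (leq_bigmax i) ((g i)^-1)%g (N i) (mN i) (muN i).
have dE i j : i != j -> (E i `\` N i) `&` (E j `\` N j) = set0.
  move=> ij; apply/seteqP; split=> // x [[Ei nNi] [Ej _]]; apply: nNi.
  by rewrite /N (bigD1 j) 1?eq_sym//; left.
have mA' i := sgen_measurable (gA' i).
have [_ prA'] := bigsetI_pr (index_enum_uniq _) (fun i => measurableD (mE i) (mN i)) dE gA'.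
have capE : \bigcap_(i in [set: 'I_l.+1]) (S (g i)^-1%g @^-1` A i) =
    \big[setI/setT]_i (S (g i)^-1%g @^-1` A i).
  rewrite -bigcap_seq (_ : [set` index_enum _] = setT)//.
  by apply/seteqP; split=> i // _ /=; exact: mem_index_enum.
rewrite capE -[fine _]/(pr nu _).
under [X in _ - X]eq_bigr => i _ do
  rewrite -[fine _]/(pr nu _) -(prS (g i)^-1%g (mA i)).
set B := fun i => S (g i)^-1%g @^-1` A i.
have mB i : measurable (B i) by exact: mS.
(* Both quantities are compared with the approximating events [A' i], for which the product formula
   is exact. *)
rewrite -[X in X - _](subrK (pr nu (\big[setI/setT]_i A' i))) {2}prA' -addrA.
have sume (b : 'I_l.+1 -> R) : (forall i, b i <= e) -> \sum_i b i <= eps / 4.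
  move=> be; apply: (le_trans (ler_sum _ (fun i _ => be i))).
  rewrite sumr_const card_ord -[_ *+ l.+1]mulr_natr /e invfM mulrA divfK// pnatr_eq0//.
apply: (le_lt_trans (ler_normD _ _)).
apply: (@le_lt_trans _ _ (eps / 4 + eps / 4)); last by lra.
apply: lerD.
  apply: (le_trans (pr_bigsetI_dist _ _ _ _)) => //.
  by apply: sume => i; exact/ltW/pA'.
apply: (le_trans (prod_dist _ _ _)) => [i|i|].
- by rewrite pr_ge0 pr_le1.
- by apply/andP; split; [exact: pr_ge0|exact: (pr_le1 nu (mB i))].
apply: sume => i; rewrite distrC; apply: (le_trans (pr_dist _ (mB i) (mA' i))).
exact/ltW/pA'.
Qed.

End mixing_criterion.

(** * Poisson suspensions *)

Lemma measure_bigsetU_seq d (X : measurableType d) (R : realType)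
    (m : {measure set X -> \bar R}) (I : eqType) (s : seq I) (Q : pred I)
    (F : I -> set X) :
  uniq s -> (forall i, measurable (F i)) ->
  (forall i j, i != j -> F i `&` F j = set0) ->
  m (\big[setU/set0]_(i <- s | Q i) F i) = (\sum_(i <- s | Q i) m (F i))%E.
Proof.
move=> + mF dF; elim: s => [|i s IH /= /andP[nis us]]; first by rewrite !big_nil measure0.
rewrite !big_cons; case: ifPn => [Qi|_]; last exact: IH.
rewrite measureU//; [|exact: bigsetU_measurable|].
  by congr (_ + _)%E; exact: IH.
rewrite big_distrr /= big_seq_cond big1// => j /andP[js _]; apply: dF.
by apply: contraNneq nis => ->.
Qed.

(** With [B] fixed, [P (A & B)] and [P A * P B] are finite measures in [A] that agree on a pi-system
    containing the whole space. This is used for each factor in turn. *)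
Lemma pi_system_indep d (Y : measurableType d) (R : realType)
    (P : probability Y R) (G1 G2 : set (set Y)) :
  G1 `<=` measurable -> G2 `<=` measurable -> setI_closed G1 -> setI_closed G2 ->
  G1 setT -> G2 setT ->
  (forall A B, G1 A -> G2 B -> pr P (A `&` B) = pr P A * pr P B) ->
  forall A B, <<s G1 >> A -> <<s G2 >> B -> pr P (A `&` B) = pr P A * pr P B.
Proof.
move=> G1m G2m G1I G2I G1T G2T G12.
have step (G : set (set Y)) B : G `<=` measurable -> setI_closed G -> G setT ->
    measurable B -> (forall A, G A -> pr P (A `&` B) = pr P A * pr P B) ->
    forall A, <<s G >> A -> pr P (A `&` B) = pr P A * pr P B.
  move=> Gm GI GT mB GB A GA.
  have mA : measurable A.
    by apply: (smallest_sub _ Gm) GA; exact: sigma_algebra_measurable.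
  have b0 := pr_ge0 P B; pose b : {nonneg R} := NngNum b0.
  pose m1 : {measure set Y -> \bar R} := mrestr P mB.
  pose m2 : {measure set Y -> \bar R} := mscale b P.
  have m1E C : measurable C -> m1 C = (pr P (C `&` B))%:E.
    by move=> mC; rewrite -(prE P (measurableI _ _ mC mB)).
  have m2E C : measurable C -> m2 C = (pr P C * pr P B)%:E.
    by move=> mC; rewrite mulrC EFinM -(prE P mC).
  suff : m1 A = m2 A by rewrite m1E// m2E// => -[].
  apply: (g_sigma_algebra_measure_unique G Gm (fun _ => setT)) => //.
  - by apply/seteqP; split=> // y _; exists 0%N.
  - by move=> C GC; have mC := Gm _ GC; rewrite m1E// m2E// GB.
  - by move=> _; rewrite m1E// ltry.
move=> A B G1A G2B.
have mB : measurable B.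
  by apply: (smallest_sub _ G2m) G2B; exact: sigma_algebra_measurable.
apply: (step G1) => // A' G1A'.
have mA' := G1m _ G1A'.
rewrite setIC [RHS]mulrC; apply: (step G2) => // B' G2B'.
by rewrite setIC G12// mulrC.
Qed.

(** * The sigma-algebra of counting measures *)

Section cmeasure_theory.
Context d (X : measurableType d) (R : realType).
Local Notation M := (cmeasure X R).

Lemma cmeasure_eq (w w' : M) : (forall A, measurable A -> w A = w' A) -> w = w'.
Proof.
case: w w' => [m mc mn] [m' mc' mn'] /= E.
have mm : m = m'.
  apply: eq_measure; apply/funext => A.
  by have [mA|nmA] := pselect (measurable A); [exact: E|rewrite mn// mn'].
by case: _ / mm mc' mn' {E} => mc' mn'; congr MkCMeasure; exact: Prop_irrelevance.
Qed.

Lemma cmeas_ev_measurable A B : measurable A -> measurable B ->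
  measurable [set w : M | B (w A)].
Proof. by move=> mA mB; apply: sub_sigma_algebra; exists A, B. Qed.

Lemma cmeas_eq_measurable A k : measurable A ->
  measurable [set w : M | w A = k%:R%:E].
Proof. by move=> mA; apply: (@cmeas_ev_measurable A [set k%:R%:E]). Qed.

Lemma poisson_suspension_measurable (T : H3 R -> {mfun X >-> X}) g :
  measurable_fun setT (poisson_suspension T g : M -> M).
Proof.
apply: (@measurability _ _ _ _ _ _ (@cmeas_evs _ X R)) => // _ [_ [A [B [mA mB ->]]] <-].
rewrite setTI.
have -> : poisson_suspension T g @^-1` [set w | B (w A)] =
    [set w : M | B (w (T g @^-1` A))].
  by apply/seteqP; split=> w; rewrite /= /cimage asboolT.
apply: cmeas_ev_measurable => //.
by rewrite -[X in measurable X]setTI; exact: measurable_funP.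
Qed.

Lemma poisson_suspensionE (T : H3 R -> {mfun X >-> X}) g (w : M) A :
  measurable A -> poisson_suspension T g w A = w (T g @^-1` A).
Proof. by move=> mA; rewrite /= /cimage asboolT. Qed.

Variable mu : {measure set X -> \bar R}.

(** Restricted to sets of finite measure, the only ones for which [poisson_law] prescribes the law
    of the count. *)
Definition countevents (E : set X) : set (set M) :=
  [set V | exists A k, [/\ measurable A, A `<=` E, (mu A < +oo)%E &
                           V = [set w : M | w A = k%:R%:E]]].

Lemma countevents_measurable E : countevents E `<=` measurable.
Proof. by move=> _ [A [k [mA _ _ ->]]]; exact: cmeas_eq_measurable. Qed.

Lemma countevents_mono E E' : E `<=` E' -> countevents E `<=` countevents E'.
Proof.
by move=> EE' V [A [k [mA AE fA ->]]]; exists A, k; split=> //; exact: subset_trans EE'.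
Qed.

Variable D : nat -> set X.
Hypotheses (mD : forall n, measurable (D n)) (ndD : nondecreasing_seq D).
Hypotheses (DT : \bigcup_n D n = setT) (fD : forall n, (mu (D n) < +oo)%E).

(** Since [w A] is the increasing limit of the [w (A & D n)], the event [w A <= k] is a countable
    intersection of finite-count events. Differences give [w A = k], and the value [+oo] is the
    complement of all finite ones; as there are no other values, every event on [w A] is reached. *)
Lemma cmeasure_sigma_algebra_ind (G : set (set M)) : sigma_algebra setT G ->
  (forall n, countevents (D n) `<=` G) -> measurable `<=` G.
Proof.
move=> GS DG; have G0 : G set0 by case: GS.
have GC A : G A -> G (~` A) by rewrite -setTD; case: GS => _ + _; exact.
have GU (A : (set M)^nat) : (forall n, G (A n)) -> G (\bigcup_n A n).
  by case: GS => _ _; exact.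
have GI (A : (set M)^nat) : (forall n, G (A n)) -> G (\bigcap_n A n).
  by move=> GA; rewrite -[X in G X]setCK setC_bigcap; apply: (GC); apply: GU => n; exact: GC.
have GU2 A B : G A -> G B -> G (A `|` B).
  move=> GA GB; rewrite -bigcup2E; by apply: GU => -[|[|n]].
have DS m n : (m <= n)%N -> D m `<=` D n by move=> mn; exact/subsetPset/ndD.
apply: smallest_sub => // _ [A [B [mA mB ->]]].
have Gle k : G [set w : M | (w A <= k%:R%:E)%E].
  have -> : [set w : M | (w A <= k%:R%:E)%E] =
      \bigcap_n \bigcup_(j in [set j | (j <= k)%N]) [set w : M | w (A `&` D n) = j%:R%:E].
    have mAD n : measurable (A `&` D n) by exact: measurableI.
    apply/seteqP; split=> w /=.
      move=> wA n _; have wAD : (w (A `&` D n) <= k%:R%:E)%E.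
        by apply: le_trans wA; apply: le_measure; rewrite ?inE.
      have [wADy|[j wj]] := cmeas_counting w (mAD n); first by rewrite wADy in wAD.
      by exists j => //=; move: wAD; rewrite wj lee_fin ler_nat.
    move=> wk; have <- : \bigcup_n (A `&` D n) = A by rewrite -setI_bigcupr DT setIT.
    have /cvg_lim <- // : w (A `&` D n) @[n --> \oo] --> w (\bigcup_n (A `&` D n)).
      apply: nondecreasing_cvg_mu => //; first exact: bigcup_measurable.
      by move=> m n mn; apply/subsetPset; apply: setIS; exact: DS.
    apply: lime_le; last first.
      by apply: nearW => n; have [j /= jk ->] := wk n I; rewrite lee_fin ler_nat.
    apply: ereal_nondecreasing_is_cvgn => m n mn.
    by apply: le_measure; rewrite ?inE//; apply: setIS; exact: DS.
  apply: GI => n; rewrite bigcup_mkcond; apply: GU => j; case: ifP => // _.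
  apply: (DG n); exists (A `&` D n), j; split=> //; first exact: measurableI.
  by apply: le_lt_trans (fD n); apply: le_measure; rewrite ?inE//; exact: measurableI.
have Geq k : G [set w : M | w A = k%:R%:E].
  have -> : [set w : M | w A = k%:R%:E] = ~` (~` [set w : M | (w A <= k%:R%:E)%E] `|`
      (if k is j.+1 then [set w : M | (w A <= j%:R%:E)%E] else set0)).
    apply/seteqP; split=> w /=.
      move=> wk; case=> [|]; first by rewrite wk lexx.
      by case: k wk => [//|k] /= ->; rewrite lee_fin ler_nat ltnn.
    move=> /not_orP[/contrapT wk wj].
    have [wy|[i wi]] := cmeas_counting w mA; first by rewrite wy in wk.
    move: wk; rewrite wi lee_fin ler_nat leq_eqVlt => /predU1P[->//|ik].
    by case: k ik wj => // k ik /=; rewrite wi lee_fin ler_nat => /(_ ik).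
  by apply: (GC); apply: GU2; [exact: GC|case: k => [|k]; [exact: G0|exact: Gle]].
have -> : [set w : M | B (w A)] =
    \bigcup_(k in [set k | B k%:R%:E]) [set w : M | w A = k%:R%:E] `|`
    (if pselect (B +oo%E) then ~` \bigcup_k [set w : M | w A = k%:R%:E] else set0).
  apply/seteqP; split=> w /=.
    move=> BwA; have [wy|[i wi]] := cmeas_counting w mA; last first.
      by left; exists i => //=; rewrite -wi.
    right; case: pselect => [_ [k _ /=]|]; first by rewrite wy.
    by rewrite -wy.
  case=> [[k /= Bk ->]//|]; case: pselect => // By nw.
  have [wy|[i wi]] := cmeas_counting w mA; first by rewrite wy.
  by exfalso; apply: nw; exists i.
apply: GU2; last by case: (pselect (B +oo%E)) => ?; [apply: GC; exact: GU|exact: G0].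
by rewrite bigcup_mkcond; apply: GU => j; case: ifP.
Qed.

End cmeasure_theory.

Lemma bigsetU_finP (T : Type) (I : finType) (Q : pred I) (F : I -> set T) x :
  (\big[setU/set0]_(i | Q i) F i) x <-> exists2 i, Q i & F i x.
Proof.
rewrite -bigcup_seq_cond; split=> [[i /= /andP[_ Qi] Fx]|[i Qi Fx]]; first by exists i.
by exists i => //=; rewrite mem_index_enum.
Qed.

(** * Atoms of a finite family of sets *)

Section atoms.
Context (T : Type) (I : finType).
Implicit Types A : I -> set T.

(** The condition on [#|s|] discards the complement of all the [A i], whose measure may be
    infinite. *)
Definition atom A (s : {set I}) : set T :=
  [set x | (0 < #|s|)%N /\ forall i, A i x <-> i \in s].

Lemma atom_disjoint A s t : s != t -> atom A s `&` atom A t = set0.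
Proof.
move=> st; apply/seteqP; split=> // x [[_ xs] [_ xt]]; move/eqP: st; apply.
by apply/setP => i; apply/idP/idP => ?; [apply/xt/xs|apply/xs/xt].
Qed.

Lemma atomP A i : A i = \big[setU/set0]_(s : {set I} | i \in s) atom A s.
Proof.
apply/seteqP; split=> x.
  move=> Aix; apply/bigsetU_finP; exists [set j | `[< A j x >]]%SET.
    by rewrite inE; apply/asboolP.
  split; last by move=> j; rewrite inE; split=> /asboolP.
  by apply/card_gt0P; exists i; rewrite inE; apply/asboolP.
by move=> /bigsetU_finP[s si [_ sA]]; apply/sA.
Qed.

End atoms.

Lemma atom_measurable d (X : measurableType d) (I : finType) (A : I -> set X) s :
  (forall i, measurable (A i)) -> measurable (atom A s).
Proof.
move=> mA; have [s0|/negbTE s0] := boolP (0 < #|s|)%N; last first.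
  by rewrite (_ : atom A s = set0)//; apply/seteqP; split=> // x []; rewrite s0.
have -> : atom A s = \big[setI/setT]_i (if i \in s then A i else ~` A i).
  rewrite -bigcap_seq; apply/seteqP; split=> x.
    move=> [_ xs] i _; case: ifPn; first by move/xs.
    by apply: contraNnot => /xs.
  move=> H; split=> // i; have := H i (mem_index_enum i).
  by case: ifPn => // _ nA; split.
by apply: bigsetI_measurable => i _; case: ifP => // _; exact: measurableC.
Qed.

Section poisson_process.
Context d (X : measurableType d) (R : realType) (mu : {measure set X -> \bar R}).
Variables (P : probability (cmeasure X R) R) (hP : poisson_law mu P).
Local Notation M := (cmeasure X R).

Definition poisson_weight (m : R) (k : nat) : R := m ^+ k / k`!%:R * expR (- m).

(** An arbitrary finite index type is allowed because families indexed by [{set I}] (atoms) and by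
    sum types (two families together) occur below. *)
Definition countcyl (I : finType) (A : I -> set X) (k : I -> nat) : set M :=
  [set w | forall i, w (A i) = (k i)%:R%:E].

Lemma countcylE (I : finType) (A : I -> set X) k :
  countcyl A k = \bigcap_(i in setT) [set w : M | w (A i) = (k i)%:R%:E].
Proof. by apply/seteqP; split=> [w wA i _|w wA i]; exact: wA. Qed.

Lemma countcyl_measurable (I : finType) (A : I -> set X) k :
  (forall i, measurable (A i)) -> measurable (countcyl A k).
Proof.
move=> mA; rewrite countcylE; apply: fin_bigcap_measurable => //.
by move=> i _; exact: cmeas_eq_measurable.
Qed.

Lemma pr_countcyl_disjoint (I : finType) (A : I -> set X) k :
  (forall i, measurable (A i)) -> (forall i, (mu (A i) < +oo)%E) ->
  (forall i j, i != j -> A i `&` A j = set0) ->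
  pr P (countcyl A k) = \prod_i poisson_weight (fine (mu (A i))) (k i).
Proof.
move=> mA fA dA; have [h1 h2] := hP.
have -> : countcyl A k = \bigcap_(j in [set: 'I_#|I|])
    [set w : M | [set (k (enum_val j))%:R%:E] (w (A (enum_val j)))].
  apply/seteqP; split=> w wA; first by move=> j _; exact: wA.
  by move=> i; have := wA (enum_rank i) Logic.I; rewrite /= enum_rankK.
rewrite /pr (h2 _ (fun j => A (enum_val j))
  (fun j => [set (k (enum_val j))%:R%:E]))//; last first.
  apply/trivIsetP => i j _ _ ij; apply: dA.
  by apply: contra_neq ij; exact: enum_val_inj.
rewrite (eq_bigr (fun j : 'I_#|I| => (poisson_weight (fine (mu (A (enum_val j))))
    (k (enum_val j)))%:E)); last by move=> j _; rewrite -h1.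
rewrite prodEFin /= [RHS](reindex (@enum_val I predT))//.
by apply: onW_bij; exact: enum_val_bij.
Qed.

(** Each [w (A i)] is the sum of the counts of the atoms it contains. An atom count is bounded by
    some [k i <= N], so finitely many assignments [v] suffice. *)
Lemma countcyl_atoms (I : finType) (A : I -> set X) (k : I -> nat) N :
  (forall i, measurable (A i)) -> (forall i, (k i <= N)%N) ->
  countcyl A k = \big[setU/set0]_(v : {ffun {set I} -> 'I_N.+1} |
    [forall i, \sum_(s : {set I} | i \in s) v s == k i]%N)
    countcyl (atom A) (fun s => v s : nat).
Proof.
move=> mA kN.
have mat s : measurable (atom A s) by exact: atom_measurable.
have wA (w : M) i : w (A i) = (\sum_(s : {set I} | i \in s) w (atom A s))%E.
  rewrite [in LHS](atomP A i) measure_bigsetU_seq//; first exact: index_enum_uniq.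
  by move=> s t; exact: atom_disjoint.
apply/seteqP; split=> w.
  move=> wk; have ex s : exists n : 'I_N.+1, w (atom A s) = n%:R%:E.
    (* No constraint involves the value at the empty [s]; its atom is empty, so the value is 0. *)
    have [s0|s0] := posnP #|s|.
      exists ord0; rewrite (_ : atom A s = set0) ?measure0//.
      by apply/seteqP; split=> // x []; rewrite s0.
    have [i si] := card_gt0P s0.
    have ws : (w (atom A s) <= N%:R%:E)%E.
      apply: (@le_trans _ _ (w (A i))); last by rewrite wk lee_fin ler_nat.
      apply: le_measure; rewrite ?inE// => x [_ /(_ i) H].
      by apply/H.
    have [wy|[n wn]] := cmeas_counting w (mat s); first by rewrite wy in ws.
    have nN : (n < N.+1)%N by move: ws; rewrite wn lee_fin ler_nat.
    by exists (Ordinal nN).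
  have /choice[v wv] := ex; apply/bigsetU_finP; exists [ffun s => v s]; last first.
    by move=> s; rewrite wv ffunE.
  apply/forallP => i; apply/eqP/eqP; rewrite -(eqr_nat R) -eqe -wk wA natr_sum -sumEFin.
  by apply/eqP; apply: eq_bigr => s _; rewrite ffunE wv.
move=> /bigsetU_finP[v /forallP vk wv] i.
rewrite wA (eq_bigr (fun s => (v s)%:R%:E)) => [|s _]; last exact: wv.
by rewrite sumEFin -natr_sum (eqP (vk i)).
Qed.

End poisson_process.

Lemma pr_bigsetU d (Y : measurableType d) (R : realType) (P : probability Y R)
    (I : finType) (Q : pred I) (F : I -> set Y) :
  (forall i, measurable (F i)) -> (forall i j, i != j -> F i `&` F j = set0) ->
  pr P (\big[setU/set0]_(i | Q i) F i) = \sum_(i | Q i) pr P (F i).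
Proof.
move=> mF dF; apply: EFin_inj.
rewrite -prE; last exact: bigsetU_measurable.
rewrite measure_bigsetU_seq//; last exact: index_enum_uniq.
by rewrite -sumEFin; apply: eq_bigr => i _; exact: prE.
Qed.

(** * Independence of Poisson counts in disjoint sets *)

Section poisson_independence.
Context d (X : measurableType d) (R : realType) (mu : {measure set X -> \bar R}).
Variables (P : probability (cmeasure X R) R) (hP : poisson_law mu P).
Local Notation M := (cmeasure X R).

(** The sum of all [k i] serves as the common bound [N] of [countcyl_atoms]. *)
Let weights (I : finType) (k : I -> nat) (v : {ffun {set I} -> 'I_(\sum_i k i).+1}) :=
  [forall i, \sum_(s : {set I} | i \in s) v s == k i]%N.

Let countcyl_disjoint (I : finType) (A : I -> set X) N (v u : {ffun I -> 'I_N.+1}) :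
  v != u -> countcyl A (fun i => v i : nat) `&` countcyl A (fun i => u i : nat) =
            set0 :> set M.
Proof.
move=> vu; apply/seteqP; split=> // w [wv wu]; move/eqP : vu; apply.
apply/ffunP => i; apply: val_inj; apply/eqP.
by rewrite -(eqr_nat R) -eqe -wv -wu.
Qed.

Let pr_countcyl_setI (I : finType) (A : I -> set X) k (W : set M) :
  (forall i, measurable (A i)) -> measurable W ->
  pr P (countcyl A k `&` W) = \sum_(v | @weights _ k v)
    pr P (countcyl (atom A) (fun s => v s : nat) `&` W).
Proof.
move=> mA mW; rewrite (@countcyl_atoms _ _ _ _ _ _ (\sum_i k i)%N)//; last first.
  by move=> i; rewrite (bigD1 i)//= leq_addr.
have mat s : measurable (atom A s) by exact: atom_measurable.
rewrite big_distrl /= pr_bigsetU// => [v|v u vu].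
  by apply: measurableI => //; exact: countcyl_measurable.
by rewrite setIACA countcyl_disjoint// set0I.
Qed.

Let atom_lty (I : finType) (A : I -> set X) s : (forall i, measurable (A i)) ->
  (forall i, (mu (A i) < +oo)%E) -> (mu (atom A s) < +oo)%E.
Proof.
move=> mA fA; have [s0|s0] := posnP #|s|.
  rewrite (_ : atom A s = set0) ?measure0//.
  by apply/seteqP; split=> // x []; rewrite s0.
have [i si] := card_gt0P s0; apply: le_lt_trans (fA i).
apply: le_measure; rewrite ?inE//; first exact: atom_measurable.
by move=> x [_ xs]; apply/xs.
Qed.

(** The right-hand side depends on [A] only through the measures of the atoms, which a
    measure-preserving map does not change; the invariance of the suspension rests on this. *)
Lemma pr_countcyl (I : finType) (A : I -> set X) k :
  (forall i, measurable (A i)) -> (forall i, (mu (A i) < +oo)%E) ->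
  pr P (countcyl A k) = \sum_(v | @weights _ k v)
    \prod_s poisson_weight (fine (mu (atom A s))) (v s).
Proof.
move=> mA fA; rewrite -[countcyl A k]setIT pr_countcyl_setI//.
apply: eq_bigr => v _; rewrite setIT (pr_countcyl_disjoint hP)//.
- by move=> s; exact: atom_measurable.
- by move=> s; exact: atom_lty.
- by move=> s t; exact: atom_disjoint.
Qed.

(** The atoms of [A] and those of [B] together form one disjoint family, so after decomposing both
    cylinders the Poisson weights simply multiply. *)
Lemma pr_countcyl_indep (I J : finType) (A : I -> set X) k (B : J -> set X) l :
  (forall i, measurable (A i)) -> (forall i, (mu (A i) < +oo)%E) ->
  (forall j, measurable (B j)) -> (forall j, (mu (B j) < +oo)%E) ->
  (forall i j, A i `&` B j = set0) ->
  pr P (countcyl A k `&` countcyl B l) = pr P (countcyl A k) * pr P (countcyl B l).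
Proof.
move=> mA fA mB fB AB.
have matA s : measurable (atom A s) by exact: atom_measurable.
have matB s : measurable (atom B s) by exact: atom_measurable.
have fatA s : (mu (atom A s) < +oo)%E by exact: atom_lty.
have fatB s : (mu (atom B s) < +oo)%E by exact: atom_lty.
have mB' : measurable (countcyl B l : set M) by exact: countcyl_measurable.
rewrite pr_countcyl_setI// !pr_countcyl// big_distrl /=; apply: eq_bigr => v _.
have mv : measurable (countcyl (atom A) (fun s => v s : nat) : set M).
  exact: countcyl_measurable.
rewrite setIC pr_countcyl_setI// big_distrr /=; apply: eq_bigr => u _.
pose C (z : {set I} + {set J}) := match z with inl s => atom A s | inr t => atom B t end.
pose m (z : {set I} + {set J}) : nat :=
  match z with inl s => v s | inr t => u t end.
have -> : countcyl (atom B) (fun s => u s : nat) `&`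
    countcyl (atom A) (fun s => v s : nat) = countcyl C m :> set M.
  apply/seteqP; split=> w; first by move=> [wu wv] [s|t]; [exact: wv|exact: wu].
  by move=> wm; split=> s; [exact: (wm (inr s))|exact: (wm (inl s))].
have atAB s t : atom A s `&` atom B t = set0.
  apply/seteqP; split=> // x [[s0 xs] [t0 xt]].
  have [i si] := card_gt0P s0; have [j tj] := card_gt0P t0.
  by rewrite -(AB i j); split; [apply/xs|apply/xt].
rewrite (pr_countcyl_disjoint hP)//.
- by rewrite big_sumType.
- by case.
- by case.
- case=> [s|s] [t|t] st; rewrite /= ?atAB//; [|by rewrite setIC atAB|];
    by apply: atom_disjoint; apply: contraNneq st => ->.
Qed.

(** A pi-system containing [countevents], which in general is not closed under intersection. *)
Definition countcyls (E : set X) : set (set M) :=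
  [set V | exists (I : finType) A k, [/\ forall i : I, measurable (A i),
    forall i, A i `<=` E, forall i, (mu (A i) < +oo)%E & V = countcyl A k]].

Lemma countcyls_measurable E : countcyls E `<=` measurable.
Proof. by move=> _ [I [A [k [mA _ _ ->]]]]; exact: countcyl_measurable. Qed.

Lemma countcyls_setI E : setI_closed (countcyls E).
Proof.
move=> _ _ [I [A [k [mA AE fA ->]]]] [J [B [l [mB BE fB ->]]]].
exists (I + J)%type, (fun z => match z with inl i => A i | inr j => B j end),
  (fun z => match z with inl i => k i | inr j => l j end).
split; [by case..|].
apply/seteqP; split=> w; first by move=> [wk wl] [].
by move=> wm; split=> i; [exact: (wm (inl i))|exact: (wm (inr i))].
Qed.

Lemma countcylsT E : countcyls E setT.
Proof.
exists void, (fun _ => set0), (fun _ => 0%N); split; [by case..|].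
by apply/seteqP; split=> // w _ [].
Qed.

Lemma countevents_countcyls E : countevents mu E `<=` countcyls E.
Proof.
move=> _ [A [k [mA AE fA ->]]]; exists unit, (fun _ => A), (fun _ => k).
by split=> //; apply/seteqP; split=> [w wk _|w /(_ tt)].
Qed.

Lemma countevents_indep E E' A B : E `&` E' = set0 ->
  <<s countevents mu E >> A -> <<s countevents mu E' >> B ->
  pr P (A `&` B) = pr P A * pr P B.
Proof.
move=> EE' EA E'B; apply: (@pi_system_indep _ _ _ P (countcyls E) (countcyls E')).
- exact: countcyls_measurable.
- exact: countcyls_measurable.
- exact: countcyls_setI.
- exact: countcyls_setI.
- exact: countcylsT.
- exact: countcylsT.
- move=> _ _ [I [A' [k [mA AE fA ->]]]] [J [B' [l [mB BE fB ->]]]].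
  apply: pr_countcyl_indep => // i j; apply/seteqP; split=> // x [/AE Ex /BE E'x].
  by rewrite -EE'.
- by move: EA; apply: sub_smallest2r => //; exact: countevents_countcyls.
- by move: E'B; apply: sub_smallest2r => //; exact: countevents_countcyls.
Qed.

End poisson_independence.

(** * The Poisson suspension as a mixing action *)

Section poisson_suspension_mixing.
Context d (X : measurableType d) (R : realType) (mu : {measure set X -> \bar R}).
Variables (P : probability (cmeasure X R) R) (hP : poisson_law mu P).
Local Notation M := (cmeasure X R).
Variables (T : H3 R -> {mfun X >-> X}) (D : nat -> set X).
Hypotheses (mpT : mp_action mu T) (mD : forall n, measurable (D n)).
Hypotheses (ndD : nondecreasing_seq D) (DT : \bigcup_n D n = setT).
Hypothesis fD : forall n, (mu (D n) < +oo)%E.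

Let mT g A : measurable A -> measurable (T g @^-1` A).
Proof. by move=> mA; rewrite -[X in measurable X]setTI; exact: measurable_funP. Qed.

Let muT g A : measurable A -> mu (T g @^-1` A) = mu A.
Proof. by case: mpT => _ + _ _; exact. Qed.

(** This is [1 - exp(-m) <= m]: a set of small measure probably carries no point. *)
Let pr_pos A : measurable A -> (mu A < +oo)%E ->
  pr P (~` [set w : M | w A = 0%:R%:E]) <= fine (mu A).
Proof.
move=> mA fA; have [h1 _] := hP.
have mw := @cmeas_eq_measurable _ _ R _ 0%N mA.
rewrite /pr probability_setC// (h1 A mA fA 0%N) /= expr0 fact0 divr1 mul1r.
by have := expR_ge1Dx (- fine (mu A)); lra.
Qed.

(** Almost surely a given null set carries no point. The laws of [T], valid almost everywhere, thus
    pass to the suspension. *)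
Let ae_cmeas (Q : X -> Prop) : {ae mu, forall x, Q x} ->
  {ae P, forall w : M, {ae w, forall x, Q x}}.
Proof.
move=> [Z [mZ Z0 QZ]].
exists (~` [set w : M | w Z = 0%:R%:E]).
have mw := @cmeas_eq_measurable _ _ R _ 0%N mZ.
split; first exact: measurableC.
  rewrite (prE P (measurableC mw)).
  congr EFin; apply/eqP; rewrite eq_le pr_ge0 andbT.
  by apply: (le_trans (pr_pos mZ _)); rewrite Z0.
by move=> w; apply: contra_not => w0; exists Z.
Qed.

Lemma poisson_suspension_mp_action : mp_action P (poisson_suspension T).
Proof.
have [_ _ T1 TM] := mpT.
split.
- by move=> g; exact: poisson_suspension_measurable.
- move=> g; have mTg := @poisson_suspension_measurable _ X R T g.
  pose f : {mfun M >-> M} := HB.pack (poisson_suspension T g : M -> M)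
    (isMeasurableFun.Build _ _ _ _ _ mTg).
  pose m1 := distribution P f.
  suff H : <<s countcyls mu setT >> `<=` [set A | m1 A = P A].
    move=> A mA; apply: H; move: A mA.
    apply: (cmeasure_sigma_algebra_ind mD ndD DT fD); first exact: smallest_sigma_algebra.
    move=> n; apply: subset_trans (@sub_gen_smallest _ _ _).
    by apply: subset_trans (@countevents_countcyls _ _ _ _ _);
      exact: countevents_mono.
  apply: (@g_sigma_algebra_measure_unique _ _ _ _ _ (fun _ => setT)).
  + exact: countcyls_measurable.
  + by move=> _; exact: countcylsT.
  + by apply/seteqP; split=> // y _; exists 0%N.
  + exact: countcyls_setI.
  + move=> _ [I [A [k [mA _ fA ->]]]].
    have mTA i : measurable (T g @^-1` A i) by exact: mT.
    have E : poisson_suspension T g @^-1` countcyl A k =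
        countcyl (fun i => T g @^-1` A i) k :> set M.
      by apply/seteqP; split=> w wk i; have := wk i;
        rewrite -(poisson_suspensionE T g w (mA i)).
    transitivity (P (countcyl (fun i => T g @^-1` A i) k)); first by rewrite -E.
    rewrite (prE P (countcyl_measurable _ mTA)).
    apply: etrans (esym (prE P (countcyl_measurable k mA))).
    rewrite !(pr_countcyl hP)//; last by move=> i; rewrite muT.
    congr EFin; apply: eq_bigr => v _; apply: eq_bigr => s _.
    congr (poisson_weight (fine _) _).
    by rewrite -[RHS](muT g)//; exact: atom_measurable.
  + by move=> _; apply: (@le_lt_trans _ _ (P setT)); rewrite // probability_setT ltry.
- apply: filterS (ae_cmeas T1) => w Tw; apply: cmeasure_eq => A mA.
  rewrite poisson_suspensionE//; apply: measure_eq_ae => //; first exact: mT.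
  by apply: filterS Tw => x /= ->.
- move=> g h; apply: filterS (ae_cmeas (TM g h)) => w Tw; apply: cmeasure_eq => A mA.
  have mTA := mT g mA.
  rewrite !poisson_suspensionE//; apply: measure_eq_ae; [exact: mT|exact: mT|].
  by apply: filterS Tw => x /= ->.
Qed.

Hypothesis zeroT : forall n (e : R), 0 < e -> exists K : set (H3 R), compact K /\
  forall g, ~ K g -> (mu (D n `&` T g @^-1` D n) < e%:E)%E.

Lemma poisson_suspension_mixing : mixing_of_all_orders P (poisson_suspension T).
Proof.
have mpP := poisson_suspension_mp_action.
split=> // l _.
apply: (mixing_criterion mpT mD ndD zeroT mpP (gen := countevents mu)).
- exact: countevents_measurable.
- exact: countevents_mono.
- by move=> E E' A B _ _; exact: countevents_indep.
have robS := robust_sigma_algebra mu T mD ndD mpP (@countevents_measurable _ _ _ mu)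
  (@countevents_mono _ _ _ mu).
apply: (cmeasure_sigma_algebra_ind mD ndD DT fD robS).
move=> n _ [B [k [mB BD fB ->]]]; split; first exact: cmeas_eq_measurable.
(* Deleting [N] changes the count only if a point falls in the intersection of [T_g^-1 D_n] with
   [N], which has probability at most its measure; so [r = e] works. *)
move=> e e0; exists n, e; split=> // g N mN muN.
have mTB := mT g mB; have mTD := mT g (mD n).
exists [set w : M | w (T g @^-1` B `\` N) = k%:R%:E]; split.
  apply: sub_gen_smallest; exists (T g @^-1` B `\` N), k; split=> //.
  - exact: measurableD.
  - by move=> x [/BD].
  - rewrite (le_lt_trans _ fB)// -(muT g mB) le_measure ?inE//.
    exact: measurableD.
have mTN : measurable (T g @^-1` D n `&` N) by exact: measurableI.
have fTN : (mu (T g @^-1` D n `&` N) < +oo)%E by rewrite (lt_trans muN)// ltry.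
apply: (@le_lt_trans _ _ (pr P (~` [set w : M | w (T g @^-1` D n `&` N) = 0%:R%:E]))).
  apply: pr_le.
  - apply: measurable_setY.
      have [mS _ _ _] := mpP; rewrite -[X in measurable X]setTI; apply: mS => //.
      exact: cmeas_eq_measurable.
    by apply: cmeas_eq_measurable; exact: measurableD.
  - by apply: measurableC; exact: cmeas_eq_measurable.
  move=> w; apply: contraPnot => w0.
  have E : w (T g @^-1` B) = w (T g @^-1` B `\` N).
    rewrite (measureDI w mTB mN) [X in (_ + X)%E](_ : _ = 0%E) ?adde0//.
    apply/eqP; rewrite -measure_le0 -[leRHS]w0 le_measure ?inE//.
      exact: measurableI.
    by move=> x [/BD].
  have -> : poisson_suspension T g @^-1` [set w : M | w B = k%:R%:E] =
      [set w : M | w (T g @^-1` B) = k%:R%:E].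
    by apply/seteqP; split=> w' /=; rewrite /cimage asboolT.
  by rewrite /= E; case=> -[].
apply: (le_lt_trans (pr_pos mTN fTN)).
by rewrite -lte_fin fineK// ge0_fin_numE.
Qed.

End poisson_suspension_mixing.

(** * One-dimensional Gaussian integrals *)

Section gauss_trig.
Variable R : realType.
Local Notation mu := (@lebesgue_measure R).
Local Open Scope ereal_scope.

Lemma ge0_integral_affine (G : R -> R) (a b : R) : (0 < a)%R ->
  continuous G -> (forall x, 0 <= G x)%R ->
  \int[mu]_x (G x)%:E = \int[mu]_x (G (x * a + b) * a)%:E.
Proof.
move=> a0 cG G0; pose F (x : R^o) : R^o := (x * a + b)%R.
have F'E : F^`()%classic = cst a.
  apply/funext => x; rewrite derive1E /F deriveD// deriveM// !derive_cst derive_id.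
  by rewrite scaler0 add0r addr0 scaler1.
rewrite (increasing_ge0_integration_by_substitutionT (F := F))//.
- by rewrite F'E.
- by move=> x y xy; rewrite /F ltrD2r ltr_pM2r.
- by rewrite F'E => ?; exact: cvg_cst.
- by rewrite F'E; exact: is_cvg_cst.
- by rewrite F'E; exact: is_cvg_cst.
- apply: (@cvg_comp _ _ _ (fun x => x * a)%R (fun x => x + b)%R _ (ninfty_nbhs R)).
    by apply: gt0_cvgMlNy.
  exact: cvg_addrr_Ny.
- apply: (@cvg_comp _ _ _ (fun x => x * a)%R (fun x => x + b)%R _ (pinfty_nbhs R)).
    by apply: gt0_cvgMly.
  exact: cvg_addrr.
Qed.

(** The explicit density agrees almost everywhere with the Radon-Nikodym derivative, as both have
    the same integral over every measurable set. *)
Lemma integral_normal_prob (s : R) (f : R -> \bar R) :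
  measurable_fun setT f -> (forall x, 0 <= f x) ->
  \int[normal_prob 0 s]_x f x = \int[mu]_x (f x * (normal_pdf 0 s x)%:E).
Proof.
move=> mf f0.
have dom := normal_prob_dominates (0 : R) s.
rewrite -(Radon_Nikodym_SigmaFinite.change_of_variables dom)//.
apply: ae_eq_integral => //.
- apply: emeasurable_funM => //; apply: (measurable_int mu).
  exact: Radon_Nikodym_SigmaFinite.f_integrable.
- apply: emeasurable_funM => //; apply/measurable_EFinP.
  exact: measurable_normal_pdf.
apply: ae_eqe_mul2l; apply: integral_ae_eq => //.
- exact: Radon_Nikodym_SigmaFinite.f_integrable.
- by apply/measurable_EFinP; exact: measurable_normal_pdf.
- by move=> E _ mE; rewrite -Radon_Nikodym_SigmaFinite.f_integral.
Qed.

Lemma integral_normal_prob_gauss (s : R) (G : R -> R) : s != 0%R ->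
  continuous G -> (forall x, 0 <= G x)%R ->
  \int[normal_prob 0 s]_x (G x)%:E =
  ((Num.sqrt pi)^-1)%:E *
    \int[mu]_x (G (Num.sqrt 2 * `|s| * x)%R * gauss_fun x)%:E.
Proof.
move=> s0 cG G0; rewrite integral_normal_prob; first last.
- by move=> x; rewrite lee_fin.
- by apply/measurable_EFinP; exact: continuous_measurable_fun.
(* [gauss_fun] is [exp(-x^2)], of variance 1/2 once normalized; hence the scale [sqrt 2 * |s|]. *)
have a0 : (0 < Num.sqrt 2 * `|s|)%R by rewrite mulr_gt0 ?sqrtr_gt0 ?normr_gt0.
have cgauss := @continuous_gauss_fun R.
have c_comp : continuous (fun x => G (Num.sqrt 2 * `|s| * x))%R.
  move=> x; apply: (@continuous_comp _ _ _ (fun x => Num.sqrt 2 * `|s| * x)%R G) => //.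
    by apply: cvgM; [exact: cvg_cst|exact: cvg_id].
  exact: cG.
transitivity (\int[mu]_x (G x * normal_pdf 0 s x)%R%:E); first exact: eq_integral.
have := @ge0_integral_affine (fun y => G y * normal_pdf 0 s y)%R _ 0%R a0.
move=> ->; first last.
- by move=> x; rewrite mulr_ge0// normal_pdf_ge0.
- move=> x; apply: cvgM; first exact: cG.
  exact: continuous_normal_pdf.
rewrite -ge0_integralZl//; first last.
- by move=> x _; rewrite lee_fin mulr_ge0// gauss_fun_ge0.
- apply/measurable_EFinP; apply: continuous_measurable_fun => x.
  by apply: cvgM; [exact: c_comp|exact: cgauss].
apply: eq_integral => x _; rewrite -EFinM addr0 (mulrC x); congr EFin.
rewrite -mulrA [RHS]mulrCA; congr (_ * _)%R.
rewrite normal_pdfE// /normal_peak /normal_fun /gauss_fun subr0.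
have -> : (- (Num.sqrt 2 * `|s| * x) ^+ 2 / (s ^+ 2 *+ 2) = - x ^+ 2)%R.
  rewrite !exprMn sqr_sqrtr// real_normK ?num_real//.
  by field; rewrite s0.
rewrite mulrAC; congr (_ * _)%R.
have -> : (s ^+ 2 * pi *+ 2 = 2 * `|s| ^+ 2 * pi)%R.
  by rewrite real_normK ?num_real//; ring.
rewrite sqrtrM ?mulr_ge0// ?sqr_ge0// sqrtrM// sqrtr_sqr normr_id.
by rewrite invfM mulrAC mulVf ?mul1r// gt_eqF.
Qed.

Local Notation g := (@gauss_fun R).

Let ge0_integralZ (c : R) (f : R -> R) : measurable_fun setT f ->
  (forall x, 0 <= f x)%R -> (0 <= c)%R ->
  \int[mu]_x (c * f x)%:E = c%:E * \int[mu]_x (f x)%:E.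
Proof.
move=> mf f0 c0; under eq_integral do rewrite EFinM.
by rewrite ge0_integralZl//; [exact/measurable_EFinP|move=> x _; rewrite lee_fin].
Qed.

(* With [r^2 = s^2 + t^2], the shears [y |-> z = (s x + t y) / r] and then
   [x |-> w = (r x - s z) / t] turn [x^2 + y^2] into [z^2 + w^2]. *)
Lemma gauss_shear (G : R -> R) (s t r : R) : continuous G ->
  (forall x, 0 <= G x)%R -> (0 < t)%R -> (0 < r)%R -> (r ^+ 2 = s ^+ 2 + t ^+ 2)%R ->
  \int[mu]_x \int[mu]_y (G (s * x + t * y) * (g x * g y))%:E =
  (Num.sqrt pi)%:E * \int[mu]_z (G (r * z) * g z)%:E.
Proof.
move=> cG G0 t0 r0 rE.
have mG := continuous_measurable_fun cG.
have mg := @measurable_gauss_fun R.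
have cg := @continuous_gauss_fun R.
have g0 := @gauss_fun_ge0 R.
pose K (x z : R) := (G (r * z) * (g x * g (z * (r / t) + - (s * x / t))) * (r / t))%R.
have rt0 : (0 < r / t)%R by rewrite divr_gt0.
have K0 x z : (0 <= K x z)%R by rewrite /K mulr_ge0 ?(ltW rt0)// mulr_ge0 ?G0// mulr_ge0 ?g0.
transitivity (\int[mu]_x \int[mu]_z (K x z)%:E).
  apply: eq_integral => x _.
  rewrite (@ge0_integral_affine (fun y => G (s * x + t * y) * (g x * g y))%R _
    (- (s * x / t)) rt0); first last.
  - by move=> y; rewrite !mulr_ge0 ?G0 ?g0.
  - move=> y; apply: cvgM; last by apply: cvgM; [exact: cvg_cst|exact: cg].
    apply: (@continuous_comp _ _ _ (fun y => s * x + t * y)%R G); last exact: cG.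
    apply: cvgD; first exact: cvg_cst.
    by apply: cvgM; [exact: cvg_cst|exact: cvg_id].
  apply: eq_integral => z _; congr (_%:E); rewrite /K; congr (G _ * _ * _)%R.
  by field; rewrite gt_eqF.
have mK : measurable_fun setT (fun xz : R * R => (K xz.1 xz.2)%:E).
  apply/measurable_EFinP; apply: measurable_funM => //; apply: measurable_funM.
    by apply: measurableT_comp => //; exact: measurable_funM.
  apply: measurable_funM; first exact: measurableT_comp.
  apply: measurableT_comp => //; apply: measurable_funD; first exact: measurable_funM.
  by apply: measurableT_comp => //; apply: measurable_funM => //; exact: measurable_funM.
rewrite (@fubini_tonelli _ _ _ _ _ mu mu (fun xz => (K xz.1 xz.2)%:E))//=; last first.
  by move=> xz; rewrite lee_fin.
rewrite -ge0_integralZ//; first last.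
- by move=> z; rewrite mulr_ge0 ?G0 ?g0.
- apply: measurable_funM => //; apply: measurableT_comp => //; exact: measurable_funM.
apply: eq_integral => z _.
transitivity (\int[mu]_x (G (r * z) * g z * (g (x * (r / t) + - (s * z / t)) * (r / t)))%:E).
  apply: eq_integral => x _; rewrite /K; congr (_%:E).
  rewrite -!mulrA; congr (_ * _)%R; rewrite !mulrA; congr (_ * _ / _)%R.
  rewrite /gauss_fun -!expRD; congr expR.
  have -> : (z ^+ 2 = (s ^+ 2 + t ^+ 2) / r ^+ 2 * z ^+ 2)%R.
    by rewrite -rE divff ?mul1r// expf_neq0// gt_eqF.
  have t0' : t != 0%R by rewrite gt_eqF.
  have r0' : r != 0%R by rewrite gt_eqF.
  apply/eqP; rewrite -subr_eq0; apply/eqP.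
  have : ((z * (r / t) - s * x / t) ^+ 2 + x ^+ 2 - z ^+ 2 -
    (x * (r / t) - s * z / t) ^+ 2 = (r ^+ 2 - s ^+ 2 - t ^+ 2) * (z ^+ 2 - x ^+ 2) / t ^+ 2)%R.
    by field.
  rewrite rE divff ?mul1r; last by rewrite -rE expf_neq0.
  by rewrite (_ : (s ^+ 2 + t ^+ 2 - s ^+ 2 - t ^+ 2 = 0)%R); [rewrite !mul0r; lra|ring].
rewrite ge0_integralZ; first last.
- by rewrite mulr_ge0 ?G0 ?g0.
- by move=> x; rewrite mulr_ge0 ?g0// ltW.
- apply: measurable_funM => //; apply: measurableT_comp => //.
  by apply: measurable_funD => //; exact: measurable_funM.
rewrite -(@ge0_integral_affine g)// integralT_gauss -EFinM.
by rewrite mulrC.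
Qed.

(** The characteristic function is recovered as [gauss_cos s / sqrt pi - 1]. *)
Definition gauss_cos (s : R) : \bar R := \int[mu]_x ((1 + cos (s * x)) * g x)%:E.

Let cos1_ge0 (x : R) : (0 <= 1 + cos x)%R.
Proof. by have := cos_geN1 x; lra. Qed.

Let continuous_cos1 : continuous (fun x : R => 1 + cos x)%R.
Proof. by move=> x; apply: cvgD; [exact: cvg_cst|exact: continuous_cos]. Qed.

Let measurable_cos1 (s : R) : measurable_fun setT (fun x => (1 + cos (s * x)) * g x)%R.
Proof.
apply: measurable_funM; last exact: measurable_gauss_fun.
apply: (measurableT_comp (continuous_measurable_fun continuous_cos1)).
exact: measurable_funM.
Qed.

Let cos1_gauss_ge0 (s x : R) : (0 <= (1 + cos (s * x)) * g x)%R.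
Proof. by rewrite mulr_ge0// ?cos1_ge0// gauss_fun_ge0. Qed.

Lemma gauss_cos_fin_num s : gauss_cos s \is a fin_num.
Proof.
rewrite ge0_fin_numE; last by apply: integral_ge0 => x _; rewrite lee_fin.
apply: (@le_lt_trans _ _ (\int[mu]_x (2 * g x)%:E)).
  apply: ge0_le_integral => //.
  - by move=> x _; rewrite lee_fin.
  - by apply/measurable_EFinP; exact: measurable_cos1.
  - apply/measurable_EFinP; apply: measurable_funM => //; exact: measurable_gauss_fun.
  - move=> x _; rewrite lee_fin ler_wpM2r ?gauss_fun_ge0//.
    by have := cos_le1 (s * x); lra.
rewrite ge0_integralZ//; [|exact: measurable_gauss_fun|exact: gauss_fun_ge0].
by rewrite integralT_gauss -EFinM ltry.
Qed.

Let prod_integral (u v : R -> R) : measurable_fun setT u -> measurable_fun setT v ->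
  (forall x, 0 <= u x)%R -> (forall x, 0 <= v x)%R ->
  \int[mu]_x (v x)%:E \is a fin_num ->
  \int[mu \x mu]_z (u z.1 * v z.2)%:E = \int[mu]_x (u x)%:E * \int[mu]_x (v x)%:E.
Proof.
move=> mu_ mv u0 v0 fv; rewrite fubini_tonelli1; first last.
- by move=> z; rewrite lee_fin mulr_ge0.
- by apply/measurable_EFinP; apply: measurable_funM; exact: measurableT_comp.
have -> : \int[mu]_x (v x)%:E = (fine (\int[mu]_x (v x)%:E))%:E by rewrite fineK.
set c := fine _; have c0 : (0 <= c)%R.
  by apply/fine_ge0/integral_ge0 => x _; rewrite lee_fin.
rewrite muleC -ge0_integralZ//; apply: eq_integral => x _.
by rewrite /fubini_F /= ge0_integralZ// mulrC EFinM /c fineK.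
Qed.

(** Write [cos(sx) cos(ty)] as the mean of [cos(sx + ty)] and [cos(-sx + ty)]. Both have the same
    Gaussian integral, since [gauss_shear] sees [s] only through [r^2 = s^2 + t^2]. *)
Lemma gauss_cosM (s t r : R) : (0 <= s)%R -> (0 <= t)%R -> (0 <= r)%R ->
  (r ^+ 2 = s ^+ 2 + t ^+ 2)%R ->
  (fine (gauss_cos r) / Num.sqrt pi - 1 =
   (fine (gauss_cos s) / Num.sqrt pi - 1) * (fine (gauss_cos t) / Num.sqrt pi - 1))%R.
Proof.
move=> s0 t0 r0 rE.
have sp0 : (0 < Num.sqrt pi :> R)%R by rewrite sqrtr_gt0 pi_gt0.
have mg := @measurable_gauss_fun R.
have g0 := @gauss_fun_ge0 R.
(* The shear divides by [t], so [t = 0] is settled directly: then [r = s] and the second factor is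
   1. *)
have [tE|/eqP tN] := pselect (t = 0%R).
  have -> : r = s.
    apply/eqP; rewrite -(eqrXn2 (n := 2))// rE tE expr0n addr0//.
  have -> : gauss_cos t = ((1 + 1) * Num.sqrt pi)%:E.
    rewrite /gauss_cos tE; under eq_integral do rewrite mul0r cos0.
    by rewrite ge0_integralZ// integralT_gauss.
  rewrite /= mulfK ?gt_eqF//.
  by rewrite (_ : (1 + 1 - 1 = 1)%R) ?mulr1//; ring.
have {}t0 : (0 < t)%R by rewrite lt_neqAle eq_sym tN.
have {}r0 : (0 < r)%R.
  rewrite lt_neqAle r0 andbT; apply/eqP => r00; move: rE; rewrite -r00 expr0n /=.
  by have := sqr_ge0 s; have := exprn_gt0 2 t0; lra.
have mm (f : R * R -> R) : measurable_fun setT f ->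
    measurable_fun setT (fun z : R * R => (f z * (g z.1 * g z.2))%:E).
  move=> mf; apply/measurable_EFinP; apply: measurable_funM => //.
  by apply: measurable_funM; exact: measurableT_comp.
have mcos (a b : R) : measurable_fun setT (fun z : R * R => (1 + cos (a * z.1 + b * z.2)) / 2)%R.
  apply: measurable_funM => //.
  apply: (measurableT_comp (continuous_measurable_fun continuous_cos1)).
  by apply: measurable_funD; exact: measurable_funM.
have shear a : (a ^+ 2 = s ^+ 2)%R ->
    \int[mu \x mu]_z ((1 + cos (a * z.1 + t * z.2)) / 2 * (g z.1 * g z.2))%:E =
    (Num.sqrt pi / 2)%:E * gauss_cos r.
  move=> aE; rewrite fubini_tonelli1; first last.
  - by move=> z; rewrite lee_fin !mulr_ge0.
  - exact: mm.
  have cG : continuous (fun x : R => (1 + cos x) / 2)%R.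
    by move=> x; apply: cvgM; [exact: continuous_cos1|exact: cvg_cst].
  have G0 (x : R) : (0 <= (1 + cos x) / 2)%R by rewrite mulr_ge0.
  have rE' : (r ^+ 2 = a ^+ 2 + t ^+ 2)%R by rewrite aE.
  apply: (etrans (gauss_shear cG G0 t0 r0 rE')).
  rewrite EFinM -muleA; congr (_ * _).
  rewrite -ge0_integralZ//; apply: eq_integral => x _; congr (_%:E).
  by rewrite mulrAC mulrC mulrA.
have gfin : \int[mu]_x (g x)%:E \is a fin_num by rewrite integralT_gauss.
(* Integrated form of [(1 + cos a)(1 + cos b) + 2 = (1 + cos a) + (1 + cos b) + (1 + cos(a + b))/2 +
   (1 + cos(-a + b))/2], arranged so that every term is nonnegative. *)
have P : gauss_cos s * gauss_cos t + (2 * Num.sqrt pi)%:E * (Num.sqrt pi)%:E =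
    gauss_cos s * (Num.sqrt pi)%:E + (Num.sqrt pi)%:E * gauss_cos t +
    (Num.sqrt pi / 2)%:E * gauss_cos r + (Num.sqrt pi / 2)%:E * gauss_cos r.
  rewrite -{1}(shear s erefl) -(shear (- s)%R); last by rewrite sqrrN.
  have -> : (2 * Num.sqrt pi)%:E = \int[mu]_x (2 * g x)%:E :> \bar R.
    by rewrite ge0_integralZ// integralT_gauss.
  rewrite -!integralT_gauss.
  have mc := measurable_cos1; have c0 := cos1_gauss_ge0.
  have m2 : measurable_fun setT (fun x => 2 * g x)%R by exact: measurable_funM.
  have g20 x : (0 <= 2 * g x)%R by rewrite mulr_ge0.
  rewrite -(prod_integral (mc s) (mc t) (c0 s) (c0 t) (gauss_cos_fin_num t)).
  rewrite -(prod_integral m2 mg g20 g0 gfin).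
  rewrite -(prod_integral (mc s) mg (c0 s) g0 gfin).
  rewrite -(prod_integral mg (mc t) g0 (c0 t) (gauss_cos_fin_num t)).
  have mp (u v : R -> R) : measurable_fun setT u -> measurable_fun setT v ->
      measurable_fun setT (fun z : R * R => (u z.1 * v z.2)%:E).
    move=> mu_ mv; apply/measurable_EFinP.
    by apply: measurable_funM; exact: measurableT_comp.
  have mm' a := mm _ (mcos a t).
  have m3 := mp _ _ (mc s) (mc t); have m4 := mp _ _ m2 mg.
  have m5 := mp _ _ (mc s) mg; have m6 := mp _ _ mg (mc t).
  have m56 := emeasurable_funD m5 m6; have m56s := emeasurable_funD m56 (mm' s).
  rewrite -!ge0_integralD//; last first.
  all: try by [exact: mm'|exact: m3|exact: m4|exact: m5|exact: m6|exact: m56|exact: m56s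
    |move=> z _; do ?apply: adde_ge0; rewrite lee_fin !mulr_ge0].
  apply: eq_integral => -[x y] _ /=; rewrite -!EFinD; congr (_%:E).
  rewrite mulNr (addrC (- _)%R) (addrC (s * x)%R) !cosD cosN sinN.
  by field.
move: P (gauss_cos_fin_num s) (gauss_cos_fin_num t) (gauss_cos_fin_num r).
case: (gauss_cos s) => [a| |]//; case: (gauss_cos t) => [b| |]//.
case: (gauss_cos r) => [c| |]// + _ _ _; rewrite -!EFinM -!EFinD => -[H] /=.
set p := Num.sqrt pi in sp0 H *.
have p0 : p != 0%R by rewrite gt_eqF.
have {}H : (p * c = a * b + 2 * p * p - a * p - p * b)%R by rewrite H; field.
have -> : (c / p = (a * b + 2 * p * p - a * p - p * b) / p ^+ 2)%R by rewrite -H; field.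
by field.
Qed.

End gauss_trig.

(** * Moments of centered Gaussian variables *)

Section centered_gaussian_theory.
Context d (Y : measurableType d) (R : realType) (nu : probability Y R).
Local Notation mu := (@lebesgue_measure R).
Local Notation g := (@gauss_fun R).
Local Open Scope ereal_scope.

(** The body of [centered_gaussian] with its parameter exposed, so that laws can be compared through
    [|s|]. *)
Definition gaussian_law (f : Y -> R) (s : R) : Prop := forall B : set R, measurable B ->
  nu (f @^-1` B) = if s == 0%R then \d_(0%R : R) B else normal_prob 0 s B.

(** The Dirac mass needs no separate formula: for [s = 0] the argument of [G] is constantly 0. *)
Lemma gaussian_law_integral f s (G : R -> R) : measurable_fun setT f ->
  gaussian_law f s -> continuous G -> (forall x, 0 <= G x)%R ->
  \int[nu]_y (G (f y))%:E = ((Num.sqrt pi)^-1)%:E *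
    \int[mu]_x (G (Num.sqrt 2 * `|s| * x)%R * g x)%:E.
Proof.
move=> mf fs cG G0; have mf' : @measurable_fun _ _ Y (measurableTypeR R) setT f by [].
pose F : {mfun Y >-> measurableTypeR R} := HB.pack f (isMeasurableFun.Build _ _ _ _ _ mf').
have mG : measurable_fun setT (EFin \o G).
  by apply/measurable_EFinP; exact: continuous_measurable_fun.
transitivity (\int[distribution nu F]_x (G x)%:E).
  by rewrite ge0_integral_distribution// => x; rewrite lee_fin.
have [s0|s0] := eqVneq s 0%R.
  transitivity (\int[\d_(0%R : measurableTypeR R)]_x (G x)%:E).
    by apply: eq_measure_integral => A mA _; have := fs A mA; rewrite s0 eqxx.
  rewrite integral_dirac// diracT mul1e s0 normr0 mulr0.
  under eq_integral do rewrite mul0r EFinM.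
  rewrite ge0_integralZl//; first last.
  - by rewrite lee_fin.
  - by move=> x _; rewrite lee_fin gauss_fun_ge0.
  - by apply/measurable_EFinP; exact: measurable_gauss_fun.
  rewrite integralT_gauss -!EFinM mulrCA mulVf ?mulr1//.
  by rewrite gt_eqF// sqrtr_gt0 pi_gt0.
rewrite -integral_normal_prob_gauss//.
by apply: eq_measure_integral => A mA _; have := fs A mA; rewrite (negbTE s0).
Qed.

Let sqr_gauss_ge0 (x : R) : (0 <= 2 * x ^+ 2 * g x)%R.
Proof.
by apply: mulr_ge0; [apply: mulr_ge0; [|exact: sqr_ge0]|exact: gauss_fun_ge0].
Qed.

(** The variance of the standard normal law, that is 1; positivity and finiteness suffice to cancel
    it from equations between variances. *)
Definition gauss_var : \bar R := ((Num.sqrt pi)^-1)%:E * \int[mu]_x (2 * x ^+ 2 * g x)%:E.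

Lemma gauss_var_gt0 : 0 < gauss_var.
Proof.
rewrite /gauss_var mule_gt0// ?lte_fin ?invr_gt0 ?sqrtr_gt0 ?pi_gt0//.
have m : measurable_fun setT (fun x : R => (2 * x ^+ 2 * g x)%:E).
  apply/measurable_EFinP; apply: measurable_funM; last exact: measurable_gauss_fun.
  by apply: measurable_funM => //; exact: measurable_funX.
apply: (@lt_le_trans _ _ (\int[mu]_(x in `[1%R, 2%R]) (expR (- 4))%:E)).
  rewrite integral_cst//= lebesgue_measure_itv /= lte_fin ltr1n.
  by rewrite -EFinB -EFinM lte_fin mulr_gt0// ?expR_gt0//; lra.
apply: (@le_trans _ _ (\int[mu]_(x in `[1%R, 2%R]) (2 * x ^+ 2 * g x)%:E)).
  apply: ge0_le_integral => //.
    exact: measurable_funTS.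
  move=> x /=; rewrite in_itv /= => /andP[x1 x2]; rewrite lee_fin.
  apply: (@le_trans _ _ (1 * g x)%R).
    by rewrite mul1r ler_expR lerN2; nra.
  by rewrite ler_wpM2r ?gauss_fun_ge0//; nra.
by apply: ge0_subset_integral => // x _; rewrite lee_fin; exact: sqr_gauss_ge0.
Qed.

Lemma gauss_var_fin_num : gauss_var \is a fin_num.
Proof.
rewrite fin_numM// ge0_fin_numE; last first.
  by apply: integral_ge0 => x _; rewrite lee_fin; exact: sqr_gauss_ge0.
have p0 : (0 < normal_peak (1 : R))%R by apply: normal_peak_gt0; exact: oner_neq0.
(* From [x^2 / 2 <= exp(x^2 / 2)], the integrand is at most [4 exp(-x^2 / 2)]. *)
apply: (@le_lt_trans _ _ (\int[mu]_x ((4 / normal_peak 1)%:E * (normal_pdf 0 1 x)%:E))).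
  apply: ge0_le_integral => //.
  - by move=> x _; rewrite lee_fin; exact: sqr_gauss_ge0.
  - apply/measurable_EFinP; apply: measurable_funM; last exact: measurable_gauss_fun.
    by apply: measurable_funM => //; exact: measurable_funX.
  - apply/emeasurable_funM => //; apply/measurable_EFinP.
    exact: measurable_normal_pdf.
  move=> x _; rewrite -EFinM lee_fin normal_pdfE ?oner_neq0// [leRHS]mulrA divfK ?gt_eqF//.
  rewrite /normal_fun /gauss_fun subr0 expr1n.
  have -> : (- x ^+ 2 / (1 *+ 2) = - x ^+ 2 + x ^+ 2 / 2 :> R)%R by field.
  rewrite expRD [leRHS]mulrCA [leRHS]mulrC ler_wpM2r ?expR_ge0//.
  by have := expR_ge1Dx (x ^+ 2 / 2); have := sqr_ge0 x; lra.
rewrite ge0_integralZl//.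
- by rewrite integral_normal_pdf mule1 ltry.
- by apply/measurable_EFinP; exact: measurable_normal_pdf.
- by move=> x _; rewrite lee_fin normal_pdf_ge0.
- by rewrite lee_fin divr_ge0// ltW.
Qed.

Lemma gaussian_law_sqr f s : measurable_fun setT f -> gaussian_law f s ->
  \int[nu]_y (f y ^+ 2)%:E = (s ^+ 2)%:E * gauss_var.
Proof.
move=> mf fs; rewrite (@gaussian_law_integral f s (fun x => x ^+ 2)%R)//; first last.
- by move=> x; rewrite sqr_ge0.
- by move=> x; exact: sqr_continuous.
rewrite /gauss_var muleCA -(@ge0_integralZl _ _ _ mu _ _ (fun x => (2 * x ^+ 2 * g x)%:E))//; first last.
- by rewrite lee_fin sqr_ge0.
- by move=> x _; rewrite lee_fin; exact: sqr_gauss_ge0.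
- apply/measurable_EFinP; apply: measurable_funM; last exact: measurable_gauss_fun.
  by apply: measurable_funM => //; exact: measurable_funX.
congr (_ * _); apply: eq_integral => x _; rewrite -EFinM; congr (_%:E).
by rewrite !exprMn sqr_sqrtr// real_normK ?num_real//; ring.
Qed.

Lemma gaussian_law_cos f s : measurable_fun setT f -> gaussian_law f s ->
  \int[nu]_y (1 + cos (f y))%:E = ((Num.sqrt pi)^-1)%:E * gauss_cos (Num.sqrt 2 * `|s|).
Proof.
move=> mf fs; rewrite (@gaussian_law_integral f s (fun x => 1 + cos x)%R)//.
by move=> x; apply: cvgD; [exact: cvg_cst|exact: continuous_cos].
Qed.

End centered_gaussian_theory.

(** * Bounded closures *)

Section threshold.
Variable R : realType.
Implicit Type x : R.

(** A cubic with fixed points 0, 1/2 and 1, the outer two attracting on the unit interval. Iterating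
    it produces a threshold at 1/2 from products and linear combinations alone. *)
Definition smoothstep x : R := 3 * x ^+ 2 - 2 * x ^+ 3.

Let smoothstep_lt_half x : 0 <= x -> x < 2^-1 ->
  iter n smoothstep x @[n --> \oo] --> (0 : R).
Proof.
(* [smoothstep z = (3z - 2z^2) z], and the first factor increases on [0, 1/2]; its value at the
   starting point bounds the contraction ratio throughout. *)
move=> x0 x2; pose r := 3 * x - 2 * x ^+ 2.
have r0 : 0 <= r by rewrite /r; nra.
have r1 : r < 1 by rewrite /r; nra.
have H n : 0 <= iter n smoothstep x <= x /\ iter n smoothstep x <= r ^+ n.
  elim: n => [|n]; first by rewrite /= x0 lexx expr0; split=> //; lra.
  rewrite iterS exprS; set z := iter n _ _; set q := r ^+ n => -[/andP[z0 zx] zq].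
  have -> : smoothstep z = (3 * z - 2 * z ^+ 2) * z by rewrite /smoothstep; ring.
  have zr : 3 * z - 2 * z ^+ 2 <= r by rewrite /r; nra.
  have z3 : 0 <= 3 * z - 2 * z ^+ 2 by nra.
  have le_rz : (3 * z - 2 * z ^+ 2) * z <= r * z by rewrite ler_wpM2r.
  split; first by apply/andP; split; [exact: mulr_ge0|nra].
  by apply: (le_trans le_rz); rewrite ler_wpM2l.
apply: (@squeeze_cvgr _ _ _ _ (cst 0) (fun n => r ^+ n)).
- by apply: nearW => n; have [/andP[-> _] ->] := H n.
- exact: cvg_cst.
- by apply: cvg_expr; rewrite ger0_norm.
Qed.

Let smoothstep_onem n x : iter n smoothstep (1 - x) = 1 - iter n smoothstep x.
Proof. by elim: n => //= n ->; rewrite /smoothstep; ring. Qed.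

Lemma smoothstep_cvg x : 0 <= x <= 1 -> iter n smoothstep x @[n --> \oo] -->
  ((2^-1 < x)%R%:R + (x == 2^-1)%:R / 2 : R).
Proof.
move=> /andP[x0 x1]; have [xh|xh|->] := ltgtP x 2^-1.
- by rewrite mul0r addr0; exact: smoothstep_lt_half.
- rewrite mul0r addr0.
  have -> : (fun n => iter n smoothstep x) = (fun n => 1 - iter n smoothstep (1 - x)).
    by apply/funext => n; rewrite smoothstep_onem subKr.
  rewrite -[X in _ --> X]subr0; apply: cvgB; first exact: cvg_cst.
  by apply: smoothstep_lt_half; lra.
- rewrite add0r mul1r; have -> : (fun n => iter n smoothstep 2^-1) = cst 2^-1.
    by apply/funext; elim=> //= n ->; rewrite /smoothstep; field.
  exact: cvg_cst.
Qed.

End threshold.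

(** * Products, expectations and events in the bounded closure *)

Section bounded_closure.
Context d (Y : measurableType d) (R : realType) (nu : probability Y R).
Implicit Types (u v : Y -> R) (B : set (Y -> R)).

Lemma bounded_integrable u M : measurable_fun setT u ->
  (forall y, `|u y| <= M) -> nu.-integrable setT (EFin \o u).
Proof.
move=> mu_ uM; apply: (@le_integrable _ _ _ nu setT measurableT _ (EFin \o cst M)).
- exact/measurable_EFinP.
- by move=> y _ /=; rewrite lee_fin (le_trans (uM y))// ler_norm.
- exact: finite_measure_integrable_cst.
Qed.

(* A functional substitute for the monotone class theorem: the product formula
   for expectations passes to this closure, and when [B] is stable under products
   the indicators in the closure form a sigma-algebra. *)
Inductive bclosure B : (Y -> R) -> Prop :=
| bclosure_gen u : B u -> bclosure B u
| bclosure_cst c : bclosure B (cst c)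
| bclosure_lin a u v : bclosure B u -> bclosure B v ->
    bclosure B (fun y => a * u y + v y)
| bclosure_lim (u_ : nat -> Y -> R) u M : (forall n, bclosure B (u_ n)) ->
    (forall n y, `|u_ n y| <= M) -> (forall y, u_ n y @[n --> \oo] --> u y) ->
    bclosure B u.

Definition bounded_mfun u := measurable_fun setT u /\ exists M, forall y, `|u y| <= M.

Definition bounded_mfuns B := forall u, B u -> bounded_mfun u.

Lemma bclosure_bounded B : bounded_mfuns B -> bounded_mfuns (bclosure B).
Proof.
move=> mB u; elim=> {u} [u /mB//|c|a u v _ [mu_ [M uM]] _ [mv [N vN]]|u_ u M _ IH uM cu].
- by split=> //; exists `|c|.
- split; first by apply: measurable_funD => //; exact: measurable_funM.
  exists (`|a| * M + N) => y; apply: (le_trans (ler_normD _ _)).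
  by rewrite normrM lerD// ler_wpM2l.
- split; first by apply: (measurable_fun_cvg (fun n => (IH n).1)) => y _; exact: cu.
  exists M => y; have /(cvg_norm (V := R^o)) cuy := cu y.
  have : cvg (`|u_ n y| @[n --> \oo]) by apply/cvg_ex; exists `|u y|.
  by move=> /limr_le H; rewrite -(cvg_lim _ cuy)//; apply: H; exact: nearW.
Qed.

(** [step] extends the first factor from [B] to the closure with the second one fixed; it is applied
    to each factor in turn. *)
Lemma bclosureM B : bounded_mfuns B ->
  (forall u v, B u -> B v -> bclosure B (u \* v)) ->
  forall u v, bclosure B u -> bclosure B v -> bclosure B (u \* v).
Proof.
move=> mB BM.
have lim_mul (u_ : nat -> Y -> R) u v M N : (forall n, bclosure B (u_ n \* v)) ->
    (forall n y, `|u_ n y| <= M) -> (forall y, `|v y| <= N) ->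
    (forall y, u_ n y @[n --> \oo] --> u y) -> bclosure B (u \* v).
  move=> IH uM vN cu; apply: (@bclosure_lim _ (fun n => u_ n \* v) _ (M * N)) => //.
    by move=> n y /=; rewrite normrM ler_pM.
  by move=> y /=; apply: cvgM => //; exact: cvg_cst.
have step v : (forall u, B u -> bclosure B (u \* v)) -> bclosure B v ->
    forall u, bclosure B u -> bclosure B (u \* v).
  move=> Bv cv u; elim=> {u} [//|c|a u w _ IHu _ IHw|u_ u M _ IH uM cu].
  - rewrite (_ : _ \* _ = (fun y => c * v y + cst 0 y)); last first.
      by apply/funext => y /=; rewrite addr0.
    by apply: bclosure_lin => //; exact: bclosure_cst.
  - rewrite (_ : _ \* _ = (fun y => a * (u \* v) y + (w \* v) y)); last first.
      by apply/funext => y /=; ring.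
    exact: bclosure_lin.
  - by have [_ [N vN]] := bclosure_bounded mB cv; exact: lim_mul vN cu.
move=> u v cu cv; apply: (step v) => // {cu}u Bu.
rewrite (_ : _ \* _ = v \* u); last by apply/funext => y /=; rewrite mulrC.
apply: (step u) => // [w Bw|]; [exact: BM|exact: bclosure_gen].
Qed.

Local Notation "\E u" := (\int[nu]_y u y) (at level 10).

(** Both sides are linear in each factor and continuous under bounded pointwise limits, by dominated
    convergence. *)
Lemma bclosure_indep B1 B2 : bounded_mfuns B1 -> bounded_mfuns B2 ->
  (forall u v, B1 u -> B2 v -> \E (u \* v) = \E u * \E v) ->
  forall u v, bclosure B1 u -> bclosure B2 v -> \E (u \* v) = \E u * \E v.
Proof.
move=> mB1 mB2 B12.
have int w : bounded_mfun w ->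
    nu.-integrable setT (EFin \o w).
  by move=> [mw [M wM]]; exact: bounded_integrable wM.
have bM (w1 w2 : Y -> R) : bounded_mfun w1 ->
    bounded_mfun w2 ->
    bounded_mfun (w1 \* w2).
  move=> [mw1 [M wM]] [mw2 [N wN]]; split; first exact: measurable_funM.
  by exists (M * N) => y /=; rewrite normrM ler_pM.
have Elim (u_ : nat -> Y -> R) u M : (forall n, measurable_fun setT (u_ n)) ->
    (forall n y, `|u_ n y| <= M) -> (forall y, u_ n y @[n --> \oo] --> u y) ->
    \E (u_ n) @[n --> \oo] --> \E u.
  move=> mu_ uM cu; rewrite /Rintegral; apply: fine_cvg; rewrite fineK; last first.
    apply: integral_fune_fin_num => //; apply: int; split.
      by apply: (measurable_fun_cvg mu_) => y _; exact: cu.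
    exists M => y; have /(cvg_norm (V := R^o)) cuy := cu y.
    have : cvg (`|u_ n y| @[n --> \oo]) by apply/cvg_ex; exists `|u y|.
    by move=> /limr_le H; rewrite -(cvg_lim _ cuy)//; apply: H; exact: nearW.
  apply: (@dominated_cvg _ _ _ nu setT measurableT (fun n => EFin \o u_ n) _ (EFin \o cst M)) => //.
  - by move=> n; exact/measurable_EFinP.
  - by move=> y _; apply: cvg_EFin; [exact: nearW|exact: cu].
  - exact: finite_measure_integrable_cst.
  - by move=> n y _ /=; rewrite lee_fin.
have step v : bounded_mfun v ->
    forall B, bounded_mfuns B -> (forall u, B u -> \E (u \* v) = \E u * \E v) ->
    forall u, bclosure B u -> \E (u \* v) = \E u * \E v.
  move=> bv B mB Bv u cu.
  elim: cu => {u} [u /Bv//|c|a u w cu IHu cw IHw|u_ u M cu IH uM ul].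
  - rewrite /= RintegralZl//; last exact: int.
    by rewrite Rintegral_cst//= [X in fine X]probability_setT /= mulr1.
  - have bu := bclosure_bounded mB cu; have bw := bclosure_bounded mB cw.
    have Elin f1 f2 : bounded_mfun f1 ->
        bounded_mfun f2 ->
        \int[nu]_y (a * f1 y + f2 y) = a * \E f1 + \E f2.
      move=> b1 b2; have bf1 : bounded_mfun (fun y => a * f1 y).
        by apply: (bM (cst a)) => //; split=> //; exists `|a|.
      by rewrite RintegralD//; [rewrite RintegralZl//; exact: int|exact: int|exact: int].
    rewrite (_ : _ \* _ = (fun y => a * (u \* v) y + (w \* v) y)); last first.
      by apply/funext => y /=; ring.
    rewrite Elin; [|exact: bM..]; rewrite Elin// IHu IHw; ring.
  - have mu_ n := (bclosure_bounded mB (cu n)).1.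
    have E1 := Elim _ _ _ mu_ uM ul.
    have [mv [N vN]] := bv.
    have E2 : \E (u_ n \* v) @[n --> \oo] --> \E (u \* v).
      apply: (Elim _ _ (M * N)) => [n|n y|y] /=; first exact: measurable_funM.
        by rewrite normrM ler_pM.
      by apply: cvgM => //; exact: cvg_cst.
    have E3 : \E (u_ n \* v) @[n --> \oo] --> \E u * \E v.
      by under eq_fun do rewrite IH; apply: cvgM => //; exact: cvg_cst.
    by rewrite -(cvg_lim _ E2)// -(cvg_lim _ E3).
move=> u v cu cv; apply: (step v _ B1) => //; first exact: (bclosure_bounded mB2).
move=> {cu}u Bu; rewrite mulrC (_ : u \* v = v \* u); last first.
  by apply/funext => y /=; rewrite mulrC.
apply: (step u _ B2) => //; first exact: mB1.
move=> {cv}v Bv; rewrite mulrC (_ : v \* u = u \* v); last first.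
  by apply/funext => y /=; rewrite mulrC.
exact: B12.
Qed.

Section sigma_algebra.
Variable B : set (Y -> R).
Hypothesis mB : bounded_mfuns B.
Hypothesis BM : forall u v, B u -> B v -> bclosure B (u \* v).
Local Notation cl := (bclosure B).

Definition bclosure_set : set (set Y) := [set A | cl \1_A].

Let clM u v : cl u -> cl v -> cl (u \* v). Proof. exact: bclosureM. Qed.

Lemma bclosure_sigma_algebra : sigma_algebra setT bclosure_set.
Proof.
have cC A : bclosure_set A -> bclosure_set (~` A).
  move=> cA; rewrite /bclosure_set /= (_ : \1_(~` A) = (fun y => -1 * \1_A y + cst 1 y)).
    by apply: bclosure_lin; [exact: cA|exact: bclosure_cst].
  by apply/funext => y; rewrite indicC indicE /=; case: (y \in A) => /=; ring.
have c0 : bclosure_set set0.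
  by rewrite /bclosure_set /= indic0; exact: bclosure_cst.
have cI A A' : bclosure_set A -> bclosure_set A' -> bclosure_set (A `&` A').
  move=> cA cA'; rewrite /bclosure_set /= indicI.
  exact: clM.
split=> // [A|A cA]; first by rewrite setTD; exact: cC.
have cU A1 A2 : bclosure_set A1 -> bclosure_set A2 -> bclosure_set (A1 `|` A2).
  by move=> ? ?; rewrite -[X in bclosure_set X]setCK setCU; apply/cC/cI; exact: cC.
have cn n : bclosure_set (\big[setU/set0]_(i < n) A i).
  elim: n => [|n IH]; first by rewrite big_ord0.
  by rewrite big_ord_recr; exact: cU.
apply: (@bclosure_lim _ (fun n => \1_(\big[setU/set0]_(i < n) A i)) _ 1) => //.
  by move=> n y; rewrite indicE; case: (_ \in _); rewrite ?normr1 ?normr0.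
move=> y; have [[n _ Any]|nA] := pselect ((\bigcup_n A n) y).
  apply: cvg_near_cst; exists n.+1 => // m /= nm; rewrite !indicE.
  rewrite mem_set ?mem_set//; first by exists n.
  by rewrite -bigcup_mkord; exists n.
apply: cvg_near_cst; apply: nearW => n; rewrite !indicE.
rewrite memNset ?memNset//; rewrite -bigcup_mkord => -[i _ Aiy].
by apply: nA; exists i.
Qed.

Let bclosure_set_gt_half u : cl u -> (forall y, 0 <= u y <= 1) ->
  bclosure_set [set y | 2^-1 < u y].
Proof.
move=> cu u01.
have cs v : cl v -> cl (fun y => smoothstep (v y)).
  move=> cv; rewrite (_ : (fun y => _) = (fun y => -2 * (v \* (v \* v)) y +
      (fun y => 3 * (v \* v) y + cst 0 y) y)); last first.
    by apply/funext => y; rewrite /smoothstep /=; ring.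
  by apply: bclosure_lin; [|apply: bclosure_lin; last exact: bclosure_cst];
    do ?apply: clM.
have ci n : cl (fun y => iter n (@smoothstep R) (u y)).
  by elim: n => [|n IH] //; exact: cs.
have i01 n y : 0 <= iter n (@smoothstep R) (u y) <= 1.
  elim: n => [|n /andP[]]; first exact: u01.
  rewrite iterS /smoothstep; set z := iter n _ _ => z0 z1; apply/andP; split.
    have -> : 3 * z ^+ 2 - 2 * z ^+ 3 = z ^+ 2 * (3 - 2 * z) by ring.
    by apply: mulr_ge0; [exact: sqr_ge0|lra].
  rewrite -subr_ge0.
  have -> : 1 - (3 * z ^+ 2 - 2 * z ^+ 3) = (1 - z) ^+ 2 * (1 + 2 * z) by ring.
  by apply: mulr_ge0; [exact: sqr_ge0|lra].
pose h y : R := (2^-1 < u y)%R%:R + (u y == 2^-1)%:R / 2.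
have ch : cl h.
  apply: (@bclosure_lim _ (fun n y => iter n (@smoothstep R) (u y)) _ 1) => //.
    by move=> n y; have /andP[? ?] := i01 n y; rewrite ger0_norm.
  by move=> y; apply: smoothstep_cvg.
(* The limit [h] takes the values 0, 1/2 and 1; the polynomial [2 h^2 - h] fixes 0 and 1 and sends
   1/2 to 0, which makes the inequality strict. *)
rewrite /bclosure_set /= (_ : \1_ _ = (fun y => 2 * (h \* h) y + (fun y => -1 * h y + cst 0 y) y)).
  by apply: bclosure_lin; [exact: clM|apply: bclosure_lin => //; exact: bclosure_cst].
apply/funext => y; rewrite indicE /= /h.
have -> : (y \in [set y | 2^-1 < u y]) = (2^-1 < u y).
  by apply/idP/idP => [/set_mem|?]; last exact/mem_set.
by case: (ltgtP (u y) 2^-1) => //= _; field.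
Qed.

Lemma bclosure_set_gt u c : cl u -> bclosure_set [set y | c < u y].
Proof.
move=> cu; have [_ [M uM]] := bclosure_bounded mB cu.
(* [K] is positive and bounds [|u - c|], so [(1 + (u - c) / K) / 2] lies in [0, 1] and exceeds 1/2
   exactly where [u > c]. *)
pose K := `|M| + `|c| + 1.
have K0 : 0 < K by rewrite ltr_wpDl// addr_ge0.
rewrite (_ : [set y | c < u y] = [set y | 2^-1 < (2 * K)^-1 * u y + cst (2^-1 - c / (2 * K)) y]).
  apply: bclosure_set_gt_half; first by apply: bclosure_lin => //; exact: bclosure_cst.
  move=> y /=; have -> : (2 * K)^-1 * u y + (2^-1 - c / (2 * K)) =
      2^-1 * (1 + (u y - c) / K) by field; rewrite gt_eqF.
  have : `|(u y - c) / K| <= 1.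
    rewrite normrM normfV (gtr0_norm K0) ler_pdivrMr// mul1r.
    apply: (le_trans (ler_normB _ _)); rewrite /K -addrA lerD//.
      by rewrite (le_trans (uM y))// ler_norm.
    by rewrite lerDl.
  by rewrite ler_norml => /andP[? ?]; apply/andP; split; lra.
apply/seteqP; split=> y /=.
  all: have -> : (2 * K)^-1 * u y + (2^-1 - c / (2 * K)) = 2^-1 + (u y - c) / (2 * K)
    by field; rewrite gt_eqF.
  all: by rewrite ltrDl pmulr_lgt0 ?invr_gt0 ?mulr_gt0// subr_gt0.
Qed.

End sigma_algebra.

End bounded_closure.

(** * Gaussian actions *)

Section square_integrable.
Context d (X : measurableType d) (R : realType) (mu : {measure set X -> \bar R}).
Implicit Types f h : X -> R.

Lemma sqr_Lnorm2 f :
  ('N[mu]_2%:E [EFin \o f] `^ 2 = \int[mu]_x (f x ^+ 2)%:E)%E.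
Proof.
rewrite powR_Lnorm//; apply: eq_integral => x _ /=.
by rewrite (powR_mulrn 2)// real_normK// num_real.
Qed.

Lemma Lfun2P f : f \in Lfun mu 2%:E <->
  measurable_fun setT f /\ (\int[mu]_x (f x ^+ 2)%:E < +oo)%E.
Proof.
split=> [/andP[]|[mf lf]].
  rewrite !inE /= => mf lf; split=> //.
  by rewrite -sqr_Lnorm2 poweR_lty.
apply/andP; rewrite !inE /finite_norm; split=> //.
by apply: (@lty_poweRy _ _ 2) => //; rewrite sqr_Lnorm2.
Qed.

Lemma Lfun2_le f h : measurable_fun setT h -> f \in Lfun mu 2%:E ->
  (forall x, `|h x| <= `|f x|) -> h \in Lfun mu 2%:E.
Proof.
move=> mh /Lfun2P[mf lf] hf; apply/Lfun2P; split=> //.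
apply: le_lt_trans lf; apply: ge0_le_integral => //.
- by move=> x _; rewrite lee_fin sqr_ge0.
- by apply/measurable_EFinP; exact: measurable_funX.
- by apply/measurable_EFinP; exact: measurable_funX.
- move=> x _; rewrite lee_fin -(real_normK (num_real (h x))).
  by rewrite -[leRHS]real_normK ?num_real// lerXn2r ?nnegrE.
Qed.

Lemma Lfun2_lin (a : R) f h : f \in Lfun mu 2%:E -> h \in Lfun mu 2%:E ->
  (fun x => a * f x + h x) \in Lfun mu 2%:E.
Proof.
move=> f2 h2; have p1 : (1 <= 2%:E :> \bar R)%E by rewrite lee_fin ler1n.
by have [_ H] := Lfun_submod_closed mu p1; exact: (H a f h).
Qed.

End square_integrable.

Lemma measurable_fun_gtP d (Y : measurableType d) (R : realType) (u : Y -> R) :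
  (forall c, measurable [set y | c < u y]) -> measurable_fun setT u.
Proof.
move=> mu_; apply: (measurability _ (RGenOInfty.measurableE R)) => // _ [_ [c ->] <-].
rewrite setTI; have -> // : u @^-1` `]c, +oo[%classic = [set y | c < u y].
by apply/seteqP; split=> y /=; rewrite in_itv /= andbT.
Qed.

(** The derivative of [sin] at 0 is 1. This recovers an unbounded Gaussian variable from bounded
    trigonometric functions of it. *)
Lemma cvg_mulr_sin_div (R : realType) (x : R) :
  n.+1%:R * sin (x / n.+1%:R) @[n --> \oo] --> x.
Proof.
have [->|x0] := eqVneq x 0.
  under eq_fun do rewrite mul0r sin0 mulr0; exact: cvg_cst.
have d0 : h^-1 * sin h @[h --> (0 : R)^'] --> (1 : R).
  have [dsin] := @is_derive_sin R 0; rewrite cos0 /derive => dE.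
  have : h^-1 *: (sin (h *: 1 + 0) - sin 0) @[h --> (0 : R)^'] --> (1 : R).
    by rewrite -[X in _ --> X]dE; exact: dsin.
  by under [in X in X -> _]eq_fun do rewrite sin0 subr0 addr0 [_ *: 1]mulr1.
have h0 : (forall n, x / n.+1%:R != 0) /\ x / n.+1%:R @[n --> \oo] --> (0 : R).
  split=> [n|]; first by rewrite mulf_neq0// invr_neq0// pnatr_eq0.
  by rewrite -(mulr0 x); apply: cvgM; [exact: cvg_cst|exact: cvg_harmonic].
have /(_ (fun n => x / n.+1%:R) h0) H := (cvgr_dnbhsP _ _ _).1 d0.
rewrite -[X in _ --> X]mulr1.
have -> : (fun n => n.+1%:R * sin (x / n.+1%:R)) =
    (fun n => x * ((x / n.+1%:R)^-1 * sin (x / n.+1%:R))).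
  by apply/funext => n; rewrite invfM invrK mulrA mulrA divff// mul1r.
by apply: cvgM => //; exact: cvg_cst.
Qed.

Lemma gaussian_law_Ecos d (Y : measurableType d) (R : realType)
    (nu : probability Y R) (f : Y -> R) s :
  measurable_fun setT f -> gaussian_law nu f s ->
  \int[nu]_y cos (f y) = fine (gauss_cos (Num.sqrt 2 * `|s|)) / Num.sqrt pi - 1.
Proof.
move=> mf fs; have := congr1 fine (gaussian_law_cos mf fs).
rewrite -[LHS]/(\int[nu]_y (1 + cos (f y))) RintegralD//; last first.
- apply: (@bounded_integrable _ _ _ nu _ 1) => [|y].
    by apply: (measurableT_comp _ mf); apply: continuous_measurable_fun; exact: continuous_cos.
  by rewrite ler_norml cos_geN1 cos_le1.
- exact: finite_measure_integrable_cst.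
rewrite Rintegral_cst//= [X in fine X]probability_setT /= mul1r fineM ?gauss_cos_fin_num//= => H.
by rewrite [X in _ = X - 1]mulrC -H; ring.
Qed.

(** * Independence of Gaussian variables with disjoint supports *)

Section gaussian_family.
Context d (X : measurableType d) (R : realType) (mu : {measure set X -> \bar R}).
Variable T : H3 R -> X -> X.
Context d' (Y : measurableType d') (nu : probability Y R) (S : H3 R -> Y -> Y).
Variable Phi : (X -> R) -> (Y -> R).
Hypothesis PhiP : gaussian_map mu T nu S Phi.
Local Notation L2X f := (f \in Lfun mu 2%:E).

Lemma Phi_measurable f : L2X f -> measurable_fun setT (Phi f).
Proof. by case: PhiP => [[+ _ _] _ _ _] => /[apply] /Lfun2P[]. Qed.

Lemma Phi_sqr f : L2X f ->
  (\int[nu]_y (Phi f y ^+ 2)%:E = \int[mu]_x (f x ^+ 2)%:E)%E.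
Proof. by move=> f2; case: PhiP => [[_ _ +] _ _ _] => /(_ f f2) H; rewrite -!sqr_Lnorm2 H. Qed.

Lemma Phi_law f : L2X f -> exists s, gaussian_law nu (Phi f) s.
Proof.
move=> f2; case: PhiP => _ _ /(_ 1%N (fun _ => f) (fun _ => 1)) H _.
have [s] := H (fun _ => f2).
have -> : (fun y => \sum_(i < 1) 1 * Phi f y) = Phi f.
  by apply/funext => y; rewrite big_ord1 mul1r.
by exists s.
Qed.

(* Versions of the [Phi f] with [f] supported in [E]; equality holds only almost
   everywhere, as [Phi] is only linear up to null sets. *)
Definition gaussian_on (E : set X) : set (Y -> R) :=
  [set L | measurable_fun setT L /\ exists f,
    [/\ L2X f, forall x, ~ E x -> f x = 0 & {ae nu, forall y, L y = Phi f y}]].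

Lemma gaussian_on_Phi E f : L2X f -> (forall x, ~ E x -> f x = 0) ->
  gaussian_on E (Phi f).
Proof.
move=> f2 fE; split; first exact: Phi_measurable.
by exists f; split=> //; exact: nearW.
Qed.

Lemma gaussian_on_mono E E' : E `<=` E' -> gaussian_on E `<=` gaussian_on E'.
Proof.
move=> EE' L [mL [f [f2 fE Lf]]]; split=> //; exists f; split=> // x nE'x.
by apply: fE => /EE'.
Qed.

Lemma gaussian_on_lin E a L L' : gaussian_on E L -> gaussian_on E L' ->
  gaussian_on E (fun y => a * L y + L' y).
Proof.
move=> [mL [f [f2 fE Lf]]] [mL' [f' [f'2 f'E L'f']]]; split.
  by apply: measurable_funD => //; exact: measurable_funM.
exists (fun x => a * f x + f' x); split.
- exact: Lfun2_lin.
- by move=> x nEx; rewrite fE// f'E// mulr0 addr0.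
- case: PhiP => [[_ /(_ a f f' f2 f'2) H _] _ _ _].
  by apply: filterS3 Lf L'f' H => y -> -> ->.
Qed.

Lemma gaussian_onN E L : gaussian_on E L -> gaussian_on E (fun y => - L y).
Proof.
move=> gL; have := gaussian_on_lin (-2) gL gL.
by congr gaussian_on; apply/funext => y; ring.
Qed.

Lemma gaussian_on_law E L : gaussian_on E L -> exists s, gaussian_law nu L s.
Proof.
move=> [mL [f [f2 fE Lf]]]; have [s fs] := Phi_law f2; exists s => B mB.
rewrite -fs//; apply: measure_eq_ae.
- by rewrite -[X in measurable X]setTI; exact: mL.
- by rewrite -[X in measurable X]setTI; apply: (Phi_measurable f2).
- by apply: filterS Lf => y /= ->.
Qed.

Lemma gaussian_on_sqr f L : measurable_fun setT L -> L2X f ->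
  {ae nu, forall y, L y = Phi f y} ->
  (\int[nu]_y (L y ^+ 2)%:E = \int[mu]_x (f x ^+ 2)%:E)%E.
Proof.
move=> mL f2 Lf; rewrite -Phi_sqr//; apply: ae_eq_integral => //.
- by apply/measurable_EFinP; exact: measurable_funX.
- by apply/measurable_EFinP/measurable_funX; exact: Phi_measurable.
- by apply: filterS Lf => y -> _.
Qed.

(** [Phi] is isometric and the cross term [f * f'] vanishes identically. The sign [a] treats sums
    and differences alike. *)
Lemma gaussian_on_pythagoras E E' a L L' : E `&` E' = set0 -> a ^+ 2 = 1 ->
  gaussian_on E L -> gaussian_on E' L' ->
  (\int[nu]_y ((a * L y + L' y) ^+ 2)%:E =
   \int[nu]_y (L y ^+ 2)%:E + \int[nu]_y (L' y ^+ 2)%:E)%E.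
Proof.
move=> EE' a1 [mL [f [f2 fE Lf]]] [mL' [f' [f'2 f'E L'f']]].
have [mf _] := (Lfun2P mu f).1 f2; have [mf' _] := (Lfun2P mu f').1 f'2.
rewrite (gaussian_on_sqr mL f2 Lf) (gaussian_on_sqr mL' f'2 L'f').
rewrite (@gaussian_on_sqr (fun x => a * f x + f' x) (fun y => a * L y + L' y)).
- rewrite -ge0_integralD//; first last.
  + by apply/measurable_EFinP; exact: measurable_funX.
  + by move=> x _; rewrite lee_fin sqr_ge0.
  + by apply/measurable_EFinP; exact: measurable_funX.
  + by move=> x _; rewrite lee_fin sqr_ge0.
  apply: eq_integral => x _; rewrite -EFinD; congr EFin.
  have ff' : f x * f' x = 0.
    have [Ex|nEx] := pselect (E x); last by rewrite fE// mul0r.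
    by rewrite f'E ?mulr0// => E'x; have : set0 x by rewrite -EE'.
  transitivity (a ^+ 2 * f x ^+ 2 + f' x ^+ 2 + 2 * a * (f x * f' x)); first by ring.
  by rewrite ff' a1 mulr0 addr0 mul1r.
- by apply: measurable_funD => //; exact: measurable_funM.
- exact: Lfun2_lin.
- case: PhiP => [[_ /(_ a f f' f2 f'2) H _] _ _ _].
  by apply: filterS3 Lf L'f' H => y -> -> ->.
Qed.

Local Notation "\E u" := (\int[nu]_y u y) (at level 10).

Lemma gaussian_on_measurable E L : gaussian_on E L -> measurable_fun setT L.
Proof. by case. Qed.

(** [- L] is Gaussian with the same second moment as [L], hence with the same [|s|], and so
    [1 + sin L] and [1 - sin L] have equal means. *)
Lemma gaussian_on_sin E L : gaussian_on E L -> \E (sin \o L) = 0.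
Proof.
move=> gL; have mL := gaussian_on_measurable gL.
have gNL := gaussian_onN gL; have mNL := gaussian_on_measurable gNL.
have [s Ls] := gaussian_on_law gL; have [t Lt] := gaussian_on_law gNL.
have st : `|s| = `|t|.
  have : ((s ^+ 2)%:E * gauss_var R = (t ^+ 2)%:E * gauss_var R)%E.
    rewrite -(gaussian_law_sqr mL Ls) -(gaussian_law_sqr mNL Lt).
    by apply: eq_integral => y _; rewrite sqrrN.
  rewrite -(fineK (gauss_var_fin_num R)) -!EFinM => -[].
  have v0 : fine (gauss_var R) != 0.
    by rewrite gt_eqF// fine_gt0// gauss_var_gt0 ltey_eq gauss_var_fin_num.
  by move=> /(mulIf v0) /eqP; rewrite eqf_sqr => /orP[/eqP->//|/eqP->]; rewrite normrN.
have c1 : continuous (fun x : R => 1 + sin x).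
  by move=> x; apply: cvgD; [exact: cvg_cst|exact: continuous_sin].
have p1 (x : R) : 0 <= 1 + sin x by have := sin_geN1 x; lra.
have ms : measurable_fun setT (sin \o L).
  by apply: (measurableT_comp _ mL); apply: continuous_measurable_fun; exact: continuous_sin.
have is_ : nu.-integrable setT (EFin \o (sin \o L)).
  apply: (@bounded_integrable _ _ _ nu _ 1) => // y /=.
  by rewrite ler_norml sin_geN1 sin_le1.
have : \int[nu]_y (1 + sin (L y)) = \int[nu]_y (1 - sin (L y)).
  rewrite /Rintegral; congr fine.
  transitivity (\int[nu]_y (1 + sin (- L y))%:E)%E.
    rewrite (gaussian_law_integral mL Ls c1 p1) (gaussian_law_integral mNL Lt c1 p1).
    by rewrite st.
  by apply: eq_integral => y _; rewrite sinN.
rewrite RintegralD// ?RintegralB//; try exact: finite_measure_integrable_cst.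
rewrite /comp; lra.
Qed.

(** Only the one-dimensional law of [a L + L'] enters: its variance is the sum of the two others,
    which is the relation required by [gauss_cosM]. *)
Lemma gaussian_on_cosM E E' a L L' : E `&` E' = set0 -> a ^+ 2 = 1 ->
  gaussian_on E L -> gaussian_on E' L' ->
  \int[nu]_y cos (a * L y + L' y) = \E (cos \o L) * \E (cos \o L').
Proof.
move=> EE' a1 gL gL'.
have gLT := gaussian_on_mono (@subsetT _ E) gL.
have gLT' := gaussian_on_mono (@subsetT _ E') gL'.
have gK := gaussian_on_lin a gLT gLT'.
have [s Ls] := gaussian_on_law gL; have [t Lt] := gaussian_on_law gL'.
have [r Kr] := gaussian_on_law gK.
have mL := gaussian_on_measurable gL; have mL' := gaussian_on_measurable gL'.
have mK := gaussian_on_measurable gK.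
rewrite (gaussian_law_Ecos mK Kr) (gaussian_law_Ecos mL Ls) (gaussian_law_Ecos mL' Lt).
have s2 : 0 <= Num.sqrt 2 :> R by [].
apply: gauss_cosM; rewrite ?mulr_ge0//.
rewrite !exprMn !real_normK ?num_real// -mulrDr; congr (_ * _).
have := gaussian_on_pythagoras EE' a1 gL gL'.
rewrite (gaussian_law_sqr mK Kr) (gaussian_law_sqr mL Ls) (gaussian_law_sqr mL' Lt).
rewrite -(fineK (gauss_var_fin_num R)) -!EFinM -EFinD => -[].
have v0 : fine (gauss_var R) != 0.
  by rewrite gt_eqF// fine_gt0// gauss_var_gt0 ltey_eq gauss_var_fin_num.
by rewrite -mulrDl => /(mulIf v0).
Qed.

(** Real and imaginary parts of [exp(iL)]. Unlike the variables [L], they are bounded, and their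
    products are linear combinations of functions of the same kind. *)
Definition trig_on E : set (Y -> R) :=
  [set u | exists2 L, gaussian_on E L & u = cos \o L \/ u = sin \o L].

Let trig_bounded (L : Y -> R) : measurable_fun setT L -> bounded_mfun (cos \o L) /\ bounded_mfun (sin \o L).
Proof.
move=> mL; split; split.
- by apply: (measurableT_comp _ mL); apply: continuous_measurable_fun; exact: continuous_cos.
- by exists 1 => y /=; rewrite ler_norml cos_geN1 cos_le1.
- by apply: (measurableT_comp _ mL); apply: continuous_measurable_fun; exact: continuous_sin.
- by exists 1 => y /=; rewrite ler_norml sin_geN1 sin_le1.
Qed.

Lemma trig_on_bounded E : bounded_mfuns (trig_on E).
Proof. by move=> _ [L [mL _] [->|->]]; have [] := trig_bounded mL. Qed.

Let trig_product (L L' : Y -> R) :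
  [/\ (cos \o L) \* (cos \o L') = (fun y => 2^-1 * cos (L y + L' y) + 2^-1 * cos (- L y + L' y)),
      (sin \o L) \* (sin \o L') = (fun y => - 2^-1 * cos (L y + L' y) + 2^-1 * cos (- L y + L' y)),
      (cos \o L) \* (sin \o L') = (fun y => 2^-1 * sin (L y + L' y) + 2^-1 * sin (- L y + L' y)) &
      (sin \o L) \* (cos \o L') = (fun y => 2^-1 * sin (L y + L' y) - 2^-1 * sin (- L y + L' y))].
Proof.
by split; apply/funext => y /=; rewrite !(sinD, cosD, sinN, cosN); field.
Qed.

Let gaussian_on_addsub E L L' : gaussian_on E L -> gaussian_on E L' ->
  gaussian_on E (fun y => L y + L' y) /\ gaussian_on E (fun y => - L y + L' y).
Proof.
move=> gL gL'; split.
  have := gaussian_on_lin 1 gL gL'.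
  by congr gaussian_on; apply/funext => y; rewrite mul1r.
have := gaussian_on_lin (-1) gL gL'.
by congr gaussian_on; apply/funext => y; rewrite mulN1r.
Qed.

Lemma trig_onM E u v : trig_on E u -> trig_on E v -> bclosure (trig_on E) (u \* v).
Proof.
move=> [L gL uL] [L' gL' vL'].
have [gD gB] := gaussian_on_addsub gL gL'.
have [cc ss cs sc] := trig_product L L'.
have comb a b (f g : Y -> R) : trig_on E f -> trig_on E g ->
    bclosure (trig_on E) (fun y => a * f y + b * g y).
  move=> Ef Eg.
  have -> : (fun y => a * f y + b * g y) =
      (fun y => a * f y + (fun y => b * g y + cst 0 y) y).
    by apply/funext => y /=; rewrite addr0.
  apply: bclosure_lin; first exact: bclosure_gen.
  by apply: bclosure_lin; [exact: bclosure_gen|exact: bclosure_cst].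
have cD : trig_on E (fun y => cos (L y + L' y)) by exists (fun y => L y + L' y) => //; left.
have cB : trig_on E (fun y => cos (- L y + L' y)) by exists (fun y => - L y + L' y) => //; left.
have sD : trig_on E (fun y => sin (L y + L' y)) by exists (fun y => L y + L' y) => //; right.
have sB : trig_on E (fun y => sin (- L y + L' y)) by exists (fun y => - L y + L' y) => //; right.
case: uL vL' => -> [] ->.
- by rewrite cc; exact: comb.
- by rewrite cs; exact: comb.
- rewrite sc (_ : (fun y => _) =
    (fun y => 2^-1 * sin (L y + L' y) + - 2^-1 * sin (- L y + L' y))); first exact: comb.
  by apply/funext => y; rewrite mulNr.
- by rewrite ss; exact: comb.
Qed.

(** The cosines of [L + L'] and of [- L + L'] have the same mean, so the two terms add up for a
    product of cosines and cancel for a product of sines. Mixed products have mean 0, as every sine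
    does. *)
Lemma trig_on_indep E E' u v : E `&` E' = set0 -> trig_on E u -> trig_on E' v ->
  \E (u \* v) = \E u * \E v.
Proof.
move=> EE' [L gL uL] [L' gL' vL'].
have gLT := gaussian_on_mono (@subsetT _ E) gL.
have gLT' := gaussian_on_mono (@subsetT _ E') gL'.
have [gD gB] := gaussian_on_addsub gLT gLT'.
have [cc ss cs sc] := trig_product L L'.
have int (f : Y -> R) : bounded_mfun f -> nu.-integrable setT (EFin \o f).
  by move=> [mf [M fM]]; exact: bounded_integrable fM.
have comb a b (f g : Y -> R) : bounded_mfun f -> bounded_mfun g ->
    \int[nu]_y (a * f y + b * g y) = a * \E f + b * \E g.
  move=> bf bg; rewrite RintegralD//; last 2 first.
  - exact: (integrableZl measurableT a (int _ bf)).
  - exact: (integrableZl measurableT b (int _ bg)).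
  by rewrite !RintegralZl//; exact: int.
have [bcD bsD] := trig_bounded (gaussian_on_measurable gD).
have [bcB bsB] := trig_bounded (gaussian_on_measurable gB).
have EcD : \int[nu]_y cos (L y + L' y) = \E (cos \o L) * \E (cos \o L').
  rewrite -(gaussian_on_cosM (a := 1) EE' _ gL gL') ?expr1n//.
  by apply: eq_Rintegral => y _; rewrite mul1r.
have EcB : \int[nu]_y cos (- L y + L' y) = \E (cos \o L) * \E (cos \o L').
  rewrite -(gaussian_on_cosM (a := -1) EE' _ gL gL') ?sqrrN ?expr1n//.
  by apply: eq_Rintegral => y _; rewrite mulN1r.
have EsD : \int[nu]_y sin (L y + L' y) = 0 := gaussian_on_sin gD.
have EsB : \int[nu]_y sin (- L y + L' y) = 0 := gaussian_on_sin gB.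
have EsL := gaussian_on_sin gL; have EsL' := gaussian_on_sin gL'.
case: uL vL' => -> [] ->.
- by rewrite cc comb// EcD EcB; field.
- by rewrite cs comb// EsD EsB EsL' !mulr0 addr0.
- rewrite sc (_ : (fun y => _) =
    (fun y => 2^-1 * sin (L y + L' y) + - 2^-1 * sin (- L y + L' y))); last first.
    by apply/funext => y; rewrite mulNr.
  by rewrite comb// EsD EsB EsL !mulr0 addr0 mul0r.
- by rewrite ss comb// EcD EcB EsL mul0r; ring.
Qed.

Definition levels_on (E : set X) : set (set Y) :=
  [set A | exists L c, gaussian_on E L /\ A = [set y | c < L y]].

Lemma levels_on_measurable E : levels_on E `<=` measurable.
Proof.
move=> _ [L [c [[mL _] ->]]].
have -> : [set y | c < L y] = L @^-1` `]c, +oo[%classic.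
  by apply/seteqP; split=> y /=; rewrite in_itv /= andbT.
by rewrite -[X in measurable X]setTI; exact: mL.
Qed.

Lemma levels_on_mono E E' : E `<=` E' -> levels_on E `<=` levels_on E'.
Proof.
by move=> EE' A [L [c [gL ->]]]; exists L, c; split=> //; exact: gaussian_on_mono gL.
Qed.

Lemma levels_on_bclosure E : <<s levels_on E >> `<=` bclosure_set (trig_on E).
Proof.
have saB := bclosure_sigma_algebra (@trig_on_bounded E) (@trig_onM E).
apply: smallest_sub => // _ [L [c [gL ->]]].
pose Y' := g_sigma_algebraType (bclosure_set (trig_on E)).
have mY' A : @measurable _ Y' A = bclosure_set (trig_on E) A.
  by rewrite -[in RHS](sigma_algebra_id saB).
suff mL : measurable_fun (setT : set Y') L.
  have -> : [set y | c < L y] = L @^-1` `]c, +oo[%classic.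
    by apply/seteqP; split=> y /=; rewrite in_itv /= andbT.
  by rewrite -mY' -[X in measurable X]setTI; exact: mL.
(* [L] is unbounded, so [bclosure_set_gt] cannot be applied to it directly; it applies to the
   functions [sin (L / n.+1)]. *)
apply: (@measurable_fun_cvg _ Y' _ setT (fun n y => n.+1%:R * sin (L y / n.+1%:R))).
  move=> n; apply: measurable_funM => //; apply: measurable_fun_gtP => b.
  rewrite mY'; apply: (bclosure_set_gt (@trig_on_bounded E) (@trig_onM E)).
  apply: bclosure_gen; exists (fun y => L y / n.+1%:R); last by right.
  have [s Ls] := gaussian_on_law gL.
  have := gaussian_on_lin (n.+1%:R^-1 - 1) gL gL.
  by congr gaussian_on; apply/funext => y; ring.
by move=> y _; exact: cvg_mulr_sin_div.
Qed.

Lemma levels_on_indep E E' A B : E `&` E' = set0 ->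
  <<s levels_on E >> A -> <<s levels_on E' >> B ->
  pr nu (A `&` B) = pr nu A * pr nu B.
Proof.
move=> EE' EA E'B.
have sm E0 : <<s levels_on E0 >> `<=` measurable.
  by apply: smallest_sub; [exact: sigma_algebra_measurable|exact: levels_on_measurable].
have mA := sm _ _ EA; have mB := sm _ _ E'B.
have prI C : measurable C -> pr nu C = \E (\1_C).
  by move=> mC; rewrite /Rintegral integral_indic// setIT.
rewrite !prI//; last exact: measurableI.
rewrite indicI; have H := bclosure_indep (@trig_on_bounded E)
  (@trig_on_bounded E') (fun u v => @trig_on_indep E E' u v EE').
exact: (H _ _ (levels_on_bclosure EA) (levels_on_bclosure E'B)).
Qed.

End gaussian_family.

(** * The Gaussian action as a mixing action *)

Section gaussian_mixing.
Context d (X : measurableType d) (R : realType) (mu : {measure set X -> \bar R}).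
Variables (T : H3 R -> {mfun X >-> X}) (D : nat -> set X).
Hypotheses (mpT : mp_action mu T) (mD : forall n, measurable (D n)).
Hypotheses (ndD : nondecreasing_seq D) (DT : \bigcup_n D n = setT).
Context d' (Y : measurableType d') (nu : probability Y R) (S : H3 R -> Y -> Y).
Hypothesis mpS : mp_action nu S.
Variable Phi : (X -> R) -> (Y -> R).
Hypothesis PhiP : gaussian_map mu T nu S Phi.
Local Notation L2X f := (f \in Lfun mu 2%:E).
Local Notation robust := (robust mu T D nu S (levels_on mu nu Phi)).

Let mT g A : measurable A -> measurable (T g @^-1` A).
Proof. by move=> mA; rewrite -[X in measurable X]setTI; exact: measurable_funP. Qed.

Let mS g A : measurable A -> measurable (S g @^-1` A).
Proof. by move=> mA; rewrite -[X in measurable X]setTI; case: mpS => + _ _ _; apply. Qed.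

Let integral_T g (h : X -> \bar R) : measurable_fun setT h -> (forall x, 0 <= h x)%E ->
  (\int[mu]_x h (T g x) = \int[mu]_x h x)%E.
Proof.
move=> mh h0; have [_ pT _ _] := mpT.
transitivity (\int[pushforward mu (T g)]_x h x)%E; last first.
  by apply: eq_measure_integral => A mA _; exact: pT.
by rewrite ge0_integral_pushforward.
Qed.

Let L2X_T g f : L2X f -> L2X (f \o T g).
Proof.
move=> /Lfun2P[mf lf]; apply/Lfun2P; split; first exact: measurableT_comp.
rewrite (integral_T g (h := fun x => (f x ^+ 2)%:E))//.
- by apply/measurable_EFinP; exact: measurable_funX.
- by move=> x; rewrite lee_fin sqr_ge0.
Qed.

(** The part of [f^2] outside [D n] or where [|f| > n]: its integral tends to 0, and elsewhere [f^2]
    is at most [n^2], which controls the loss on any small set [N]. *)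
Let tail f n : X -> R :=
  fun x => f x ^+ 2 * \1_(~` (D n `&` [set x | `|f x| <= n%:R])) x.

Let tail_ge0 f n x : 0 <= tail f n x.
Proof. by rewrite mulr_ge0 ?sqr_ge0. Qed.

Let tail_measurable f n : measurable_fun setT f -> measurable_fun setT (tail f n).
Proof.
move=> mf; apply: measurable_funM; first exact: measurable_funX.
apply: measurable_indic; apply: measurableC; apply: measurableI => //.
have -> : [set x | `|f x| <= n%:R] = f @^-1` `[- n%:R, n%:R]%classic.
  by apply/seteqP; split=> x /=; rewrite in_itv /= ler_norml.
by rewrite -[X in measurable X]setTI; exact: mf.
Qed.

Let tail_cvg f : L2X f -> (\int[mu]_x (tail f n x)%:E)%E @[n --> \oo] --> 0%E.
Proof.
move=> f2; have [mf _] := (Lfun2P mu f).1 f2.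
rewrite -(integral0 mu setT).
apply: (@dominated_cvg _ _ _ mu setT measurableT (fun n x => (tail f n x)%:E) _
  (fun x => (f x ^+ 2)%:E)) => //.
- by move=> n; apply/measurable_EFinP; exact: tail_measurable.
- move=> x _; have [m _ Dmx] : (\bigcup_n D n) x by rewrite DT.
  apply: cvg_near_cst; near=> n; congr EFin; rewrite /tail indicE memNset ?mulr0//.
  have mn : (m <= n)%N by near: n; exact: nbhs_infty_ge.
  have DD : D m `<=` D n by exact/subsetPset/ndD.
  apply; split; first exact: DD.
  rewrite /=; near: n; exists (Num.truncn `|f x|).+1 => // n /= fn.
  by rewrite (le_trans (ltW (truncnS_gt _)))// ler_nat.
- exact: Lfun2_integrable_sqr.
- by move=> n x _; rewrite lee_fin ger0_norm// /tail ler_piMr ?sqr_ge0.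
Unshelve. all: by end_near. Qed.

(** A degenerate law has its only atom at 0, and a nondegenerate one is dominated by Lebesgue
    measure. *)
Let atomless f c : L2X f -> c != 0 -> nu (Phi f @^-1` [set c]) = 0%E.
Proof.
move=> f2 c0; have [s ->//] := Phi_law PhiP f2.
have [_|s0] := eqVneq s 0.
  by rewrite diracE memNset// => /= c0'; rewrite c0' eqxx in c0.
have /null_content_dominatesP H := normal_prob_dominates (0 : R) s.
by apply: H => //; exact: lebesgue_measure_set1.
Qed.

Let mPhi f (A : set R) : L2X f -> measurable A -> measurable (Phi f @^-1` A).
Proof.
by move=> f2 mA; rewrite -[X in measurable X]setTI; exact: (Phi_measurable PhiP f2).
Qed.

Let small_window f c e : L2X f -> c != 0 -> 0 < e ->
  exists2 r : R, 0 < r & pr nu (Phi f @^-1` `[c - r, c + r]%classic) < e.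
Proof.
move=> f2 c0 e0; pose A n := Phi f @^-1` `[c - n.+1%:R^-1, c + n.+1%:R^-1]%classic.
have mA n : measurable (A n) by exact: mPhi.
have capA : \bigcap_n A n = Phi f @^-1` [set c].
  apply/seteqP; split=> y /=; last first.
    by move=> Ey n _; rewrite /A /= Ey in_itv /= lerBlDr lerDl invr_ge0 ler0n.
  move=> H; apply/eqP; rewrite -subr_eq0 -normr_eq0; apply: contrapT => /negP n0.
  (* The window of index [m.-1] has half-width [1 / m], smaller than the distance from [Phi f y] to
     [c]. *)
  have := truncnS_gt (`|Phi f y - c|^-1); set m := (Num.truncn _).+1 => hm.
  have := H m.-1 I; rewrite /A /= in_itv /= -ler_distlC distrC /m /= -/m.
  rewrite leNgt => /negP; apply.
  rewrite invf_plt ?posrE// ?ltr0n//.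
  by rewrite lt_def n0 normr_ge0.
have ndA : nonincreasing_seq A.
  move=> m n mn; apply/subsetPset => y; rewrite /A /= !in_itv /=.
  have : n.+1%:R^-1 <= m.+1%:R^-1 :> R by rewrite lef_pV2 ?posrE ?ltr0n// ler_nat.
  move: (n.+1%:R^-1) (m.+1%:R^-1) => a b H /andP[? ?].
  by apply/andP; split; lra.
have cA : nu (A n) @[n --> \oo] --> nu (\bigcap_n A n).
  apply: nonincreasing_cvg_mu => //; last by apply: bigcapT_measurable.
  by rewrite (le_lt_trans (probability_le1 nu (mA 0%N)))// ltry.
rewrite capA atomless// in cA.
have /fine_cvgP[_ /cvgrPdist_lt/(_ e e0)[n _ /(_ n (leqnn n)) H]] := cA.
exists n.+1%:R^-1; first by rewrite invr_gt0 ltr0n.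
by move: H; rewrite /= sub0r normrN ger0_norm// fine_ge0.
Qed.

Let markov_sqr (Z : Y -> R) (r : R) : measurable_fun setT Z -> 0 < r ->
  ((r ^+ 2)%:E * nu [set y | (r <= `|Z y|)%R] <= \int[nu]_y (Z y ^+ 2)%:E)%E.
Proof.
move=> mZ r0; set B := [set y | _].
have mB : measurable B.
  have mN : measurable_fun setT (fun y => `|Z y|) by exact: measurableT_comp.
  have -> : B = (fun y => `|Z y|) @^-1` `[r, +oo[%classic.
    by apply/seteqP; split=> y /=; rewrite in_itv /= andbT.
  by rewrite -[X in measurable X]setTI; exact: mN.
rewrite -[leLHS](integral_cst nu mB).
have m2 : measurable_fun setT (fun y => (Z y ^+ 2)%:E).
  by apply/measurable_EFinP; exact: measurable_funX.
apply: (@le_trans _ _ (\int[nu]_(y in B) (Z y ^+ 2)%:E)%E).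
  apply: ge0_le_integral => //.
  - by move=> y _; rewrite lee_fin sqr_ge0.
  - exact: measurable_funTS.
  - move=> y By; rewrite lee_fin -(real_normK (num_real (Z y))).
    by rewrite lerXn2r ?nnegrE// ltW.
by apply: ge0_subset_integral => // y _; rewrite lee_fin sqr_ge0.
Qed.

(** Where the two functions differ, either [T g x] is in the support of the tail, or [x] is in both
    [T_g^-1 D_n] and [N] with [|f (T g x)| <= n]. As [T g] preserves [mu], the bound does not depend
    on [g]. *)
Let truncation_error f n (r : R) g N : L2X f -> measurable N ->
  (mu (T g @^-1` D n `&` N) < r%:E)%E ->
  (\int[mu]_x ((f (T g x) - f (T g x) * \1_(T g @^-1` D n `\` N) x) ^+ 2)%:E <=
    \int[mu]_x (tail f n x)%:E + (n%:R ^+ 2 * r)%:E)%E.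
Proof.
move=> f2 mN muN; have [mf _] := (Lfun2P mu f).1 f2.
have mTD : measurable (T g @^-1` D n) by exact: mT.
have mTN : measurable (T g @^-1` D n `&` N) by exact: measurableI.
have mt : measurable_fun setT (fun x => (tail f n x)%:E).
  by apply/measurable_EFinP; exact: tail_measurable.
have mtT : measurable_fun setT (fun x => (tail f n (T g x))%:E).
  by apply: (measurableT_comp mt).
apply: (@le_trans _ _ (\int[mu]_x ((tail f n (T g x))%:E +
    (n%:R ^+ 2 * \1_(T g @^-1` D n `&` N) x)%:E)))%E; last first.
  rewrite ge0_integralD//; first last.
  - by apply/measurable_EFinP; apply: measurable_funM => //; exact: measurable_indic.
  - by move=> x _; rewrite lee_fin mulr_ge0// sqr_ge0.
  rewrite (integral_T g (h := fun x => (tail f n x)%:E))//; last first.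
    by move=> x; rewrite lee_fin.
  apply: leeD => //.
  under eq_integral do rewrite EFinM.
  rewrite ge0_integralZl//; last by apply/measurable_EFinP; exact: measurable_indic.
  rewrite integral_indic// setIT [leRHS]EFinM lee_wpmul2l ?lee_fin ?sqr_ge0//.
  exact: ltW.
have mfT : measurable_fun setT (f \o T g) by exact: measurableT_comp.
apply: ge0_le_integral => //.
- by move=> x _; rewrite lee_fin sqr_ge0.
- apply/measurable_EFinP; apply: measurable_funX; apply: measurable_funB => //.
  by apply: measurable_funM => //; apply: measurable_indic; exact: measurableD.
- apply: emeasurable_funD => //; apply/measurable_EFinP.
  by apply: measurable_funM => //; exact: measurable_indic.
move=> x _; rewrite -EFinD lee_fin /tail !indicE.
have n0 : 0 <= n%:R ^+ 2 :> R by exact: sqr_ge0.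
have f0 := sqr_ge0 (f (T g x)).
have [xDN|xDN] := pselect ((T g @^-1` D n `\` N) x).
  rewrite (mem_set xDN) mulr1 subrr expr0n /= addr_ge0// mulr_ge0//.
rewrite (memNset xDN) mulr0 subr0.
have [xD|xD] := pselect (D n (T g x)); last first.
  rewrite (@mem_set _ (~` _)); last by move=> [/xD].
  by rewrite mulr1 lerDl mulr_ge0.
have xN : N x by apply: contrapT => nN; apply: xDN.
rewrite (@mem_set _ (T g @^-1` D n `&` N))// mulr1.
have [fn|fn] := leP `|f (T g x)| n%:R.
  apply: (@le_trans _ _ (n%:R ^+ 2)); last by rewrite lerDr mulr_ge0.
  by rewrite -(real_normK (num_real (f _))) lerXn2r ?nnegrE.
rewrite (@mem_set _ (~` _)); first by rewrite mulr1 lerDl.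
by move=> [_ /=]; rewrite leNgt fn.
Qed.

Let robust_Phi_gt f c : L2X f -> c != 0 -> robust [set y | c < Phi f y].
Proof.
move=> f2 c0; have [mf _] := (Lfun2P mu f).1 f2.
have lvl h b : [set y | b < Phi h y] = Phi h @^-1` `]b, +oo[%classic.
  by apply/seteqP; split=> y /=; rewrite in_itv /= andbT.
split=> [|e e0]; first by rewrite lvl; exact: mPhi.
have e20 : 0 < e / 2 by rewrite divr_gt0.
have [r r0 rE] := small_window f2 c0 e20.
(* The error [W] below has second moment less than [2 * eta], so Markov's inequality bounds the
   probability of [|W| >= r] by [e / 4]. *)
pose eta := r ^+ 2 * e / 8.
have eta0 : 0 < eta by rewrite divr_gt0// mulr_gt0// exprn_gt0.
have /fine_cvgP[[n1 _ fin] /cvgrPdist_lt/(_ _ eta0)[n2 _ lt_eta]] := tail_cvg f2.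
pose n := maxn n1 n2.
have tailn : (\int[mu]_x (tail f n x)%:E < eta%:E)%E.
  have := lt_eta n (leq_maxr _ _); rewrite /= sub0r normrN => H.
  rewrite -(fineK (fin n (leq_maxl _ _))) lte_fin.
  by apply: le_lt_trans H; exact: ler_norm.
have s0 : 0 < eta / (n%:R ^+ 2 + 1) by rewrite divr_gt0// ltr_wpDl ?sqr_ge0.
(* With this bound on the measure, the term [n^2 * r] of [truncation_error] is at most [eta]; the
   added 1 covers [n = 0]. *)
exists n, (eta / (n%:R ^+ 2 + 1)); split=> // g N mN muN.
set E := T g @^-1` D n `\` N.
have mE : measurable E by apply: measurableD => //; exact: mT.
pose f' x := f (T g x) * \1_E x.
have fT2 := L2X_T g f2; have [mfT _] := (Lfun2P mu _).1 fT2.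
have mf' : measurable_fun setT f'.
  by apply: measurable_funM => //; exact: measurable_indic.
have f'2 : L2X f'.
  apply: (Lfun2_le mf' fT2) => x; rewrite /f' normrM ler_piMr// indicE.
  by case: (_ \in _); rewrite ?normr1 ?normr0.
have gL : gaussian_on mu nu Phi E (Phi f').
  apply: (gaussian_on_Phi PhiP) => // x nEx.
  by rewrite /f' indicE memNset// mulr0.
exists [set y | c < Phi f' y]; split.
  by apply: sub_gen_smallest; exists (Phi f'), c.
pose k x := f (T g x) - f' x.
have kE : (fun x => -1 * f' x + (f \o T g) x) = k.
  by apply/funext => x; rewrite /k /= mulN1r addrC.
have k2 : L2X k by rewrite -kE; exact: Lfun2_lin.
pose Z y := Phi f (S g y); pose W y := Z y - Phi f' y.
have mZ : measurable_fun setT Z.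
  have [mSg _ _ _] := mpS.
  exact: (measurableT_comp (Phi_measurable PhiP f2) (mSg g)).
have mL := Phi_measurable PhiP f'2.
have mW : measurable_fun setT W by exact: measurable_funB.
(* [koopman] composes with [T (g^-1)], so equivariance is invoked at [g^-1] to obtain [f \o T g]. *)
have Wk : {ae nu, forall y, W y = Phi k y}.
  have [[_ lin _] eqv _ _] := PhiP.
  have H1 := eqv g^-1%g f f2; have H2 := lin (-1) _ _ f'2 fT2.
  rewrite kE in H2; apply: filterS2 H1 H2 => y.
  by rewrite /koopman invgK /W /Z /= => <- ->; rewrite mulN1r addrC.
have ltW : (\int[nu]_y (W y ^+ 2)%:E < (2 * eta)%:E)%E.
  rewrite (gaussian_on_sqr PhiP mW k2 Wk).
  apply: (le_lt_trans (truncation_error f2 mN muN)).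
  rewrite mulr2n mulrDl mul1r EFinD; apply: lte_leD => //.
  rewrite lee_fin mulrA ler_pdivrMr; last by rewrite ltr_wpDl ?sqr_ge0.
  by rewrite mulrC ler_wpM2l ?(ltW eta0)// lerDl.
pose B1 := S g @^-1` (Phi f @^-1` `[c - r, c + r]%classic).
pose B2 := [set y | r <= `|W y|].
have mB1 : measurable B1 by apply: mS; exact: mPhi.
have mB2 : measurable B2.
  have mW1 : measurable_fun setT (fun y => `|W y|) by exact: measurableT_comp.
  have -> : B2 = (fun y => `|W y|) @^-1` `[r, +oo[%classic.
    by apply/seteqP; split=> y /=; rewrite in_itv /= andbT.
  by rewrite -[X in measurable X]setTI; exact: mW1.
have prB1 : pr nu B1 < e / 2.
  by have [_ pS _ _] := mpS; rewrite /pr pS//; exact: mPhi.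
have prB2 : pr nu B2 < e / 2.
  have := le_lt_trans (markov_sqr mW r0) ltW.
  rewrite (prE nu mB2) -EFinM lte_fin /eta => H.
  have r20 : 0 < r ^+ 2 by rewrite exprn_gt0.
  rewrite -(ltr_pM2l r20); apply: (lt_le_trans H).
  have : 0 < r ^+ 2 * e by rewrite mulr_gt0.
  lra.
apply: (@le_lt_trans _ _ (pr nu B1 + pr nu B2)); last first.
  by rewrite [ltRHS](splitr e) ltrD.
apply: (le_trans _ (pr_setU _ mB1 mB2)); apply: pr_le.
- apply: measurable_setY; [apply: mS|]; rewrite lvl; exact: mPhi.
- exact: measurableU.
(* If [z] and [w] lie on different sides of [c] and [|z - w| < r], then [z] is within [r] of [c]. *)
move=> y; rewrite /B1 /B2 /W /Z /=; set z := Phi f (S g y); set w := Phi f' y.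
rewrite in_itv /= => H; have [rw|wr] := leP r `|z - w|; first by right.
left; move: wr; rewrite ltr_norml => /andP[? ?].
by case: H => -[? /negP]; rewrite -leNgt => ?; apply/andP; split; lra.
Qed.

Lemma gaussian_robust A : measurable A -> robust A.
Proof.
have saR : sigma_algebra setT robust.
  exact: (robust_sigma_algebra _ _ mD ndD mpS (@levels_on_measurable _ _ _ mu _ _ nu Phi)
    (@levels_on_mono _ _ _ mu _ _ nu Phi)).
pose Y' := g_sigma_algebraType robust.
have mY' B : @measurable _ Y' B = robust B by rewrite -[in RHS](sigma_algebra_id saR).
have robust_gt f c : L2X f -> robust [set y | c < Phi f y].
  move=> f2; have [->|] := eqVneq c 0; last exact: robust_Phi_gt.
  (* The level 0, where an atom may sit, is reached by a countable union of positive levels. *)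
  have -> : [set y | 0 < Phi f y] = \bigcup_n [set y | n.+1%:R^-1 < Phi f y].
    apply/seteqP; split=> y /=; last first.
      by move=> [n _ /=]; apply: lt_trans; rewrite invr_gt0 ltr0n.
    by move=> /ltr_add_invr[n]; rewrite add0r => ?; exists n.
  have [_ _ +] := saR; apply => n; exact: robust_Phi_gt.
have robust_gen : <<s [set Phi f @^-1` B | f in [set f | L2X f] & B in measurable] >>
    `<=` robust.
  apply: smallest_sub => // _ [f f2 [B mB <-]].
  have mf' : measurable_fun (setT : set Y') (Phi f).
    by apply: measurable_fun_gtP => c; rewrite mY'; exact: robust_gt.
  by rewrite -mY' -[X in measurable X]setTI; exact: mf'.
move=> mA; have [_ _ _ /(_ A mA)[B sB [Z [mZ Z0 ABZ]]]] := PhiP.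
apply: (robust_approx mD ndD mpS (@levels_on_measurable _ _ _ mu _ _ nu Phi)
  (@levels_on_mono _ _ _ mu _ _ nu Phi)) => // e e0; exists B; first exact: robust_gen.
have mB : measurable B by case: (robust_gen _ sB).
rewrite setYC; apply: (@le_lt_trans _ _ (pr nu Z)).
  by apply: pr_le => //; exact: measurable_setY.
by rewrite /pr Z0.
Qed.

Hypothesis zeroT : forall n (e : R), 0 < e -> exists K : set (H3 R), compact K /\
  forall g, ~ K g -> (mu (D n `&` T g @^-1` D n) < e%:E)%E.

Lemma gaussian_mixing : mixing_of_all_orders nu S.
Proof.
split=> // l _.
apply: (mixing_criterion mpT mD ndD zeroT mpS (gen := levels_on mu nu Phi)).
- exact: levels_on_measurable.
- exact: levels_on_mono.
- by move=> E E' A B _ _; exact: (levels_on_indep PhiP).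
- exact: gaussian_robust.
Qed.

End gaussian_mixing.

Theorem corollary5p2 (R : realType)
  (lambda : {measure set (H3 R) -> \bar R}) (Hlambda : haar_measure lambda)
  (F C : nat -> set (H3 R)) (HFC : CF_sequences lambda F C)
  (Hinfinite : (\prod_(0 <= n < N)
      (fine (lambda (F n.+1)) / (fine (lambda (F n)) * (ncard (C n.+1))%:R)))
    @[N --> \oo] --> +oo)
  (H_i : forall n, F n *s invset (F n) *s F n *s C n.+1 `<=` F n.+1)
  (H_ii : forall n,
    let D (c : H3 R * H3 R) :=
      F n *s [set c.1] *s [set (c.2^-1)%g] *s invset (F n) in
    let offdiag (c : H3 R * H3 R) :=
      [/\ C n.+1 c.1, C n.+1 c.2 & c.1 <> c.2] in
    (forall c c', offdiag c -> offdiag c' -> c <> c' -> D c `&` D c' = set0) /\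
    (forall c, offdiag c -> D c `&` (F n *s invset (F n)) = set0))
  (H_iii : ncard (C n) @[n --> \oo] --> \oo)
  (mu : {measure set (CFspace HFC) -> \bar R}) (Hmu : CF_measure mu)
  (T : H3 R -> {mfun CFspace HFC >-> CFspace HFC}) (HT : CF_action mu T) :
  (forall P : probability (cmeasure (CFspace HFC) R) R,
     poisson_law mu P -> mixing_of_all_orders P (poisson_suspension T)) /\
  (forall (d : measure_display) (Y : measurableType d) (nu : probability Y R)
     (S : H3 R -> Y -> Y),
     gaussian_action mu T nu S -> mixing_of_all_orders nu S).
Proof.
have mpT : mp_action mu T by case: HT.
pose D n : set (CFspace HFC) := CFset n.
have mD n : measurable (D n) by exact: CFset_measurable.
have ndD : nondecreasing_seq D by exact: CFset_nondecreasing.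
have DT : \bigcup_n D n = setT by exact: bigcup_CFset.
have fD n : (mu (D n) < +oo)%E by rewrite ltey_eq (CFset_fin_num Hlambda Hmu).
have zeroT n (e : R) : 0 < e -> exists K : set (H3 R), compact K /\
    forall g, ~ K g -> (mu (D n `&` T g @^-1` D n) < e%:E)%E.
  by move=> e0; exact: (CF_zero_type H_ii Hlambda H_iii Hmu HT).
split=> [P hP|d Y nu S [_ mpS [Phi PhiP]]].
  exact: (poisson_suspension_mixing hP mpT mD ndD DT fD zeroT).
exact: (gaussian_mixing mpT mD ndD DT mpS PhiP zeroT).
Qed.
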